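(* Let $(Q,L,D)$ be a nonholonomic system with a $G$-symmetry satisfying the dimension assumption $T_qQ=D_q+V_q$ for all $q\in Q$, and let $W$ be a $G$-invariant vertical complement of the constraints $D$ that satisfies the vertical symmetry condition. If $\eta\in\mathfrak g$ is such that $$\langle\mathcal J,\mathcal K_{\mathcal W}\rangle\big(X_{\mathrm{nh}},(P_{\mathfrak g_S}(\eta))_{\mathcal M}\big)=0,$$ then: (i) $f_\eta=\langle\mathcal J^{\mathrm{nh}},P_{\mathfrak g_S}(\eta)\rangle$ is a first integral of the nonholonomic dynamics $X_{\mathrm{nh}}$, which is linear in the momenta (i.e. linear on the fibers of $\mathcal M\to Q$); (ii) the $\mathcal M$-cotangent lift $(P_{\mathfrak g_S}(\eta))_Q^{\mathcal M}\in\mathfrak X(\mathcal M)$ of $(P_{\mathfrak g_S}(\eta))_Q\in\mathfrak X(Q)$ satisfies $(P_{\mathfrak g_S}(\eta))_Q^{\mathcal M}(\mathcal H_{\mathcal M})=0$.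
   Context: All manifolds, distributions and maps are smooth; distributions are regular (constant rank); group actions are free and proper. Nonholonomic system. $(Q,L,D)$ consists of a manifold $Q$, a Lagrangian $L:TQ\to\mathbb R$ of mechanical type ($L=$ kinetic energy of a Riemannian metric $\kappa$ minus a potential on $Q$) and a (non-integrable) distribution $D\subset TQ$. Let $\kappa^\flat:TQ\to T^*Q$, $\kappa^\flat(X)(Y)=\kappa(X,Y)$. The constraint submanifold is the vector subbundle $\mathcal M=\kappa^\flat(D)\subset T^*Q$, with inclusion $\iota:\mathcal M\to T^*Q$ and projection $\tau_{\mathcal M}:\mathcal M\to Q$. $\mathcal H:T^*Q\to\mathbb R$ is the Hamiltonian associated to $L$, $\mathcal H_{\mathcal M}=\iota^*\mathcal H$. $\Theta_Q$ is the canonical 1-form on $T^*Q$, $\Omega_Q=-d\Theta_Q$, $\Theta_{\mathcal M}=\iota^*\Theta_Q$, $\Omega_{\mathcal M}=\iota^*\Omega_Q$. Set $\mathcal C_m=\{v\in T_m\mathcal M: T\tau_{\mathcal M}(v)\in D_{\tau_{\mathcal M}(m)}\}$. The restriction $\Omega_{\mathcal M}|_{\mathcal C}$ is nondegenerate, and the nonholonomic dynamics is the unique section $X_{\mathrm{nh}}$ of $\mathcal C$ with $\mathbf i_{X_{\mathrm{nh}}}\Omega_{\mathcal M}|_{\mathcal C}=d\mathcal H_{\mathcal M}|_{\mathcal C}$. A function $f\in C^\infty(\mathcal M)$ is a first integral if $X_{\mathrm{nh}}(f)=0$. Symmetry. A Lie group $G$ (Lie algebra $\mathfrak g$) acting on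 $Q$ is a symmetry if the tangent lifted action preserves $L$ and $D$; then the cotangent lifted action restricts to $\mathcal M$. $V\subset TQ$ and $\mathcal V\subset T\mathcal M$ are the distributions tangent to the $G$-orbits; $\eta_Q,\eta_{\mathcal M}$ are infinitesimal generators of $\eta\in\mathfrak g$ on $Q$ and $\mathcal M$. A section $\xi$ of the trivial bundle $\mathfrak g\times Q\to Q$ has generators $\xi_Q(q)=(\xi_q)_Q(q)$ and $\xi_{\mathcal M}(m)=(\xi_{\tau_{\mathcal M}(m)})_{\mathcal M}(m)$. Let $S=D\cap V$ and let $\mathfrak g_S\to Q$ be the subbundle of $\mathfrak g\times Q$ with fibers $\{\xi_q\in\mathfrak g:\ (\xi_q)_Q(q)\in S_q\}$. The nonholonomic momentum map $\mathcal J^{\mathrm{nh}}:\mathcal M\to\mathfrak g_S^*$ is given by $\langle\mathcal J^{\mathrm{nh}},\xi\rangle=\mathbf i_{\xi_{\mathcal M}}\Theta_{\mathcal M}$ for $\xi\in\Gamma(\mathfrak g_S)$, and $\mathcal J:\mathcal M\to\mathfrak g^*$ is the restriction to $\mathcal M$ of the canonical momentum map, $\langle\mathcal J,\eta\rangle=\mathbf i_{\eta_{\mathcal M}}\Theta_{\mathcal M}$. $\mathcal M$-cotangent lift. For $X\in\mathfrak X(Q)$ let $X^{T^*Q}$ be its cotangent lift, i.e. the vector field on $T^*Q$ with $\mathbf i_{X^{T^*Q}}\Omega_Q=d\tilde X$, $\tilde X(\alpha)=\alpha(X)$. For $m\in\mathcal M$ one has $T_m(T^*Q)=\mathcal C_m\oplus\mathcal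 C_m^{\Omega}$, where $\mathcal C_m^\Omega$ is the $\Omega_Q$-orthogonal of $\mathcal C_m$ in $T_m(T^*Q)$; let $\mathcal T_{\mathcal C}(m)$ be the projection onto $\mathcal C_m$. For a section $\xi$ of $\mathfrak g\times Q\to Q$, the $\mathcal M$-cotangent lift of $\xi_Q$ is the vector field $\xi_Q^{\mathcal M}(m)=\mathcal T_{\mathcal C}(\xi_Q^{T^*Q})(m)$ on $\mathcal M$. Vertical complement. A $G$-invariant vertical complement of the constraints is a $G$-invariant distribution $W$ on $Q$ with $TQ=D\oplus W$ and $W\subset V$. It induces $\mathcal W_m=(T\tau_{\mathcal M}|_{\mathcal V_m})^{-1}(W_{\tau_{\mathcal M}(m)})$, with $T\mathcal M=\mathcal C\oplus\mathcal W$, and associated projections $P_{\mathcal C}:T\mathcal M\to\mathcal C$, $P_{\mathcal W}:T\mathcal M\to\mathcal W$. Let $\mathfrak g_W\to Q$ be the subbundle of $\mathfrak g\times Q$ with fibers $\{\xi_q\in\mathfrak g:(\xi_q)_Q(q)\in W_q\}$; then $\mathfrak g\times Q=\mathfrak g_S\oplus\mathfrak g_W$, and $P_{\mathfrak g_S}$ is the projection onto $\mathfrak g_S$ along $\mathfrak g_W$; for $\eta\in\mathfrak g$ (viewed as a constant section), $P_{\mathfrak g_S}(\eta)\in\Gamma(\mathfrak g_S)$. $W$ satisfies the vertical symmetry condition if $\mathfrak g_W$ is a trivial bundle given by a Lie subalgebra of $\mathfrak g$, i.e. there is a fixed Lie subalgebra of $\mathfrak g$ equal to every fiber of $\mathfrak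 g_W$. The 2-form $\langle\mathcal J,\mathcal K_{\mathcal W}\rangle$. Define the $\mathfrak g$-valued 1-form $\mathcal A_{\mathcal W}$ on $\mathcal M$ by $\mathcal A_{\mathcal W}(v_m)=\xi$ iff $P_{\mathcal W}(v_m)=\xi_{\mathcal M}(m)$, and the $\mathfrak g$-valued 2-form $\mathcal K_{\mathcal W}(X,Y)=d\mathcal A_{\mathcal W}(P_{\mathcal C}X,P_{\mathcal C}Y)$. Then $\langle\mathcal J,\mathcal K_{\mathcal W}\rangle$ is the 2-form on $\mathcal M$ obtained by pairing $\mathcal J$ with $\mathcal K_{\mathcal W}$. *)

(* Defs.v *)
From HB Require Import structures.
From mathcomp Require Import all_boot all_order all_algebra.
From mathcomp Require Import all_classical all_reals all_analysis.

Set Implicit Arguments.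
Unset Strict Implicit.
Unset Printing Implicit Defensive.

Import Order.TTheory GRing.Theory Num.Theory numFieldNormedType.Exports.
Local Open Scope classical_set_scope.
Local Open Scope ring_scope.

(* Definite description with a default value, over an arbitrary type. *)
Definition the (T : Type) (x0 : T) (P : set T) : T :=
  xget (x0 : {classic T}) (P : set {classic T}).

Section Euclidean.
Context {R : realType} {n : nat}.

Definition iter_partial (s : seq 'I_n) (F : 'rV[R]_n -> R) : 'rV[R]_n -> R :=
  foldr (fun i H x => 'D_(delta_mx ord0 i : 'rV[R]_n) H x) F s.

(* C^infinity on the open set U; the values of F outside U are irrelevant *)
Definition Cinfty_on (U : set 'rV[R]_n) (F : 'rV[R]_n -> R) : Prop :=
  forall (s : seq 'I_n) (x : 'rV[R]_n), U x ->
    {for x, continuous (iter_partial s F)} /\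
    forall i : 'I_n,
      derivable (iter_partial s F) x (delta_mx ord0 i : 'rV[R]_n).

End Euclidean.

(* Smooth structures are presented in the style of Sikorski: a set S of        *)
(* real-valued functions on T generates                                        *)
(*  - a topology, the coarsest one making the members of S continuous;         *)
(*  - an algebra of smooth functions: those that locally are of the form       *)
(*    F (g_1, ..., g_k) with g_i in S and F in C^infinity(R^k).                *)
(* Every manifold arises in this way (take S to be all smooth functions), the  *)
(* structure of a submanifold is generated by the restricted functions, and    *)
(* that of a product by the functions pulled back from the factors. [manifold] *)
(* below is the usual notion: Hausdorff, second countable, with charts.        *)

Definition eval_gens (R : realType) (T : Type) (S : set (T -> R))
    (x : {classic T}) : {ptws {g : T -> R | S g} -> R} :=
  fun g => sval g x.

Definition space_of (R : realType) (T : Type) (S : set (T -> R)) : Type :=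
  initial_topology (eval_gens (S := S)).

HB.instance Definition _ (R : realType) (T : Type) (S : set (T -> R)) :=
  Topological.copy (space_of S) (initial_topology (eval_gens (S := S))).

Section SmoothSpaces.
Context {R : realType}.

Definition smooth_at T (S : set (T -> R)) (f : T -> R) (p : T) : Prop :=
  exists (U : set (space_of S)) (k : nat) (g : 'I_k -> T -> R)
         (F : 'rV[R]_k -> R),
    [/\ open U /\ U p, forall i, S (g i), Cinfty_on setT F &
        forall x, U x -> f x = F (\row_i g i x)].

Definition smooth_on T (S : set (T -> R)) (U : set T) (f : T -> R) : Prop :=
  forall p, U p -> smooth_at S f p.

Definition smooth T (S : set (T -> R)) (f : T -> R) : Prop :=
  forall p, smooth_at S f p.

Definition smooth_map T1 T2 (S1 : set (T1 -> R)) (S2 : set (T2 -> R))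
    (phi : T1 -> T2) : Prop :=
  forall f, smooth S2 f -> smooth S1 (f \o phi).

Definition chart n T (S : set (T -> R)) (U : set (space_of S))
    (phi : T -> 'rV[R]_n) : Prop :=
  [/\ open U /\ open [set phi x | x in U],
      forall x y, U x -> U y -> phi x = phi y -> x = y,
      forall i : 'I_n, smooth_on S U (fun x => phi x ord0 i) &
      forall f, smooth_on S U f ->
        exists2 F, Cinfty_on [set phi x | x in U] F &
                   forall x, U x -> f x = F (phi x)].

Definition manifold n T (S : set (T -> R)) : Prop :=
  [/\ hausdorff_space (space_of S), @second_countable (space_of S) &
      forall p : T, exists2 U : set (space_of S), U p &
        exists phi : T -> 'rV[R]_n, chart U phi].

Definition prod_structure T1 T2 (S1 : set (T1 -> R)) (S2 : set (T2 -> R)) :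
    set (T1 * T2 -> R) :=
  [set h | (exists2 f, S1 f & h = f \o fst) \/ (exists2 f, S2 f & h = f \o snd)].

Definition sub_structure T (S : set (T -> R)) (P : set T) :
    set ({x : T | P x} -> R) :=
  [set f \o sval | f in S].

(* Tangent vectors at p are the derivations at p of the algebra of smooth      *)
(* functions. They are functions on all of T -> R, so each is required to      *)
(* vanish on non-smooth functions: tangent vectors that agree on smooth        *)
(* functions are then equal.                                                   *)
Definition vec (T : Type) : Type := (T -> R) -> R.

Definition tangent T (S : set (T -> R)) (p : T) : set (vec T) :=
  [set v | [/\ forall f, ~ smooth S f -> v f = 0,
      forall a f g, smooth S f -> smooth S g ->
        v (fun x => a * f x + g x) = a * v f + v g &
      forall f g, smooth S f -> smooth S g ->
        v (fun x => f x * g x) = v f * g p + f p * v g]].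

Definition on_smooth T (S : set (T -> R)) (v : vec T) : vec T :=
  fun f => if `[< smooth S f >] then v f else 0.

Definition tmap T1 T2 (S2 : set (T2 -> R)) (phi : T1 -> T2) (v : vec T1) :
    vec T2 :=
  on_smooth S2 (fun f => v (f \o phi)).

Definition vfield T (S : set (T -> R)) (X : T -> vec T) : Prop :=
  (forall p, tangent S p (X p)) /\
  (forall f, smooth S f -> smooth S (fun p => X p f)).

Definition vbracket T (S : set (T -> R)) (X Y : T -> vec T) : T -> vec T :=
  fun p => on_smooth S (fun f => X p (fun q => Y q f) - Y p (fun q => X q f)).

(* Exterior derivative of the 1-form theta at p on u, v: the value at p of     *)
(* X(theta(Y)) - Y(theta(X)) - theta([X,Y]) for any vector fields X, Y         *)
(* extending u, v.                                                             *)
Definition extd T (S : set (T -> R)) (theta : T -> vec T -> R)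
    (p : T) (u v : vec T) : R :=
  the 0 [set r | exists X Y, [/\ vfield S X /\ vfield S Y, X p = u, Y p = v &
    r = X p (fun q => theta q (Y q)) - Y p (fun q => theta q (X q))
        - theta p (vbracket S X Y p)]].

Definition distribution r T (S : set (T -> R)) (D : T -> set (vec T)) : Prop :=
  forall p : T, exists2 U : set (space_of S), open U /\ U p &
    exists2 X : 'I_r -> T -> vec T, forall i, vfield S (X i) &
      forall q, U q ->
        D q = [set \sum_i c i *: X i q | c in [set: 'I_r -> R]] /\
        forall c : 'I_r -> R, \sum_i c i *: X i q = 0 -> forall i, c i = 0.

(* through every point passes an integral manifold of D *)
Definition integrable_distribution T (S : set (T -> R)) (D : T -> set (vec T)) :
    Prop :=
  forall p : T, exists (k : nat) (N : Type) (SN : set (N -> R)) (i : N -> T),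
    [/\ manifold k SN, smooth_map SN S i /\ injective i, exists x, i x = p &
        forall x, D (i x) = [set tmap S i v | v in tangent SN x] /\
          forall v, tangent SN x v -> tmap S i v = 0 -> v = 0].

Definition sumv T (A B : set (vec T)) : set (vec T) :=
  [set a + b | a in A & b in B].

Definition direct_sum T (E A B : set (vec T)) : Prop :=
  E = sumv A B /\ A `&` B = [set 0].

(* the projection onto A along B *)
Definition proj_along T (A B : set (vec T)) (v : vec T) : vec T :=
  the 0 [set a | A a /\ B (v - a)].

Definition riemannian T (S : set (T -> R)) (kappa : T -> vec T -> vec T -> R) :
    Prop :=
  (forall p,
    [/\ forall a u v w, tangent S p u -> tangent S p v -> tangent S p w ->
          kappa p (a *: u + v) w = a * kappa p u w + kappa p v w,
        forall u v, tangent S p u -> tangent S p v ->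
          kappa p u v = kappa p v u &
        forall u, tangent S p u -> u != 0 -> 0 < kappa p u u]) /\
  (forall X Y, vfield S X -> vfield S Y ->
    smooth S (fun p => kappa p (X p) (Y p))).

(* Covectors at p, extended by zero outside the tangent space at p. *)
Definition covector T (S : set (T -> R)) (p : T) (a : vec T -> R) : Prop :=
  (forall v, ~ tangent S p v -> a v = 0) /\
  (forall c u v, tangent S p u -> tangent S p v ->
    a (c *: u + v) = c * a u + a v).

Definition cotangent T (S : set (T -> R)) : Type :=
  {x : T * (vec T -> R) | covector S x.1 x.2}.

Section CotangentBundle.
Context {T : Type} (S : set (T -> R)).

Definition base (x : cotangent S) : T := (sval x).1.
Definition cov (x : cotangent S) : vec T -> R := (sval x).2.

(* generated by the functions on T and the fibrewise linear functions given by *)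
(* vector fields                                                               *)
Definition cotangent_structure : set (cotangent S -> R) :=
  [set h | (exists2 f, smooth S f & h = f \o base) \/
           (exists2 X, vfield S X & h = (fun x => cov x (X (base x))))].

Definition ThetaQ (x : cotangent S) (u : vec (cotangent S)) : R :=
  cov x (tmap S base u).

Definition OmegaQ (x : cotangent S) (u v : vec (cotangent S)) : R :=
  - extd cotangent_structure ThetaQ x u v.

Definition cotangent_lift (X : T -> vec T) : cotangent S -> vec (cotangent S) :=
  fun x => the 0 [set u | tangent cotangent_structure x u /\
    forall w, tangent cotangent_structure x w ->
      OmegaQ x u w = w (fun y => cov y (X (base y)))].

End CotangentBundle.

End SmoothSpaces.

Arguments cotangent_structure {R T} S _.

Record nh_system (R : realType) := NHSystem {
  conf : Type;
  conf_str : set (conf -> R);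
  conf_dim : nat;
  conf_manifold : manifold conf_dim conf_str;
  metric : conf -> vec (R := R) conf -> vec (R := R) conf -> R;
  metricP : riemannian conf_str metric;
  potential : conf -> R;
  potentialP : smooth conf_str potential;
  dist : conf -> set (vec (R := R) conf);
  dist_rank : nat;
  distP : distribution dist_rank conf_str dist;
  dist_nonintegrable : ~ integrable_distribution conf_str dist
}.

Arguments conf_str {R} n _.

Section NHSystem.
Context {R : realType} (N : nh_system R).
Local Notation Q := (conf N).
Local Notation SQ := (conf_str N).
Local Notation vecQ := (vec (R := R) Q).

Definition lagrangian (q : Q) (v : vecQ) : R :=
  2%:R^-1 * metric q v v - potential q.

Definition flat (q : Q) (v : vecQ) : vecQ -> R :=
  fun w => if `[< tangent SQ q w >] then metric q v w else 0.

Definition sharp (q : Q) (a : vecQ -> R) : vecQ :=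
  the 0 [set v | tangent SQ q v /\ flat q v = a].

(* <alpha, v> - L(v) with v = FL^-1(alpha); the fibre derivative FL of L is    *)
(* [flat]                                                                      *)
Definition hamiltonian (x : cotangent SQ) : R :=
  let v := sharp (base x) (cov x) in cov x v - lagrangian (base x) v.

Definition in_constraint (x : cotangent SQ) : Prop :=
  exists2 v, dist (base x) v & cov x = flat (base x) v.

Definition cmfd : Type := {x : cotangent SQ | in_constraint x}.
Definition iotaM (m : cmfd) : cotangent SQ := sval m.
Definition tauM (m : cmfd) : Q := base (iotaM m).

Local Notation ST := (cotangent_structure SQ).
Definition cmfd_str : set (cmfd -> R) :=
  sub_structure ST (P := in_constraint).
Local Notation SM := cmfd_str.
Local Notation vecM := (vec (R := R) cmfd).

Definition HM (m : cmfd) : R := hamiltonian (iotaM m).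

Definition ThetaM (m : cmfd) (u : vecM) : R :=
  ThetaQ (iotaM m) (tmap ST iotaM u).

Definition OmegaM (m : cmfd) (u v : vecM) : R :=
  OmegaQ (iotaM m) (tmap ST iotaM u) (tmap ST iotaM v).

Definition calC (m : cmfd) : set vecM :=
  [set v | tangent SM m v /\ dist (tauM m) (tmap SQ tauM v)].

Definition nh_dynamics (X : cmfd -> vecM) : Prop :=
  [/\ vfield SM X, forall m, calC m (X m) &
      forall m v, calC m v -> OmegaM m (X m) v = v HM].

Definition first_integral (X : cmfd -> vecM) (f : cmfd -> R) : Prop :=
  smooth SM f /\ forall m, X m f = 0.

Definition linear_in_momenta (f : cmfd -> R) : Prop :=
  forall (a : R) (m1 m2 m : cmfd),
    tauM m1 = tauM m -> tauM m2 = tauM m ->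
    cov (iotaM m) = a *: cov (iotaM m1) + cov (iotaM m2) ->
    f m = a * f m1 + f m2.

(* the OmegaQ-orthogonal of calC m in the tangent space of the cotangent       *)
(* bundle at iotaM m                                                           *)
Definition calC_orth (m : cmfd) : set (vec (cotangent SQ)) :=
  [set u | tangent ST (iotaM m) u /\
    forall v, calC m v -> OmegaQ (iotaM m) u (tmap ST iotaM v) = 0].

(* T_C(X^{T^*Q}), where T_C is the projection onto calC along calC_orth; its   *)
(* value at m is given as an element of calC m                                 *)
Definition M_cotangent_lift (X : Q -> vecQ) : cmfd -> vecM :=
  fun m => the 0 [set v | calC m v /\
    calC_orth m (cotangent_lift X (iotaM m) - tmap ST iotaM v)].

End NHSystem.

Arguments cmfd_str {R} N _.
Arguments HM {R} N m.
Arguments iotaM {R N} m.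
Arguments tauM {R N} m.

Definition lie_group (R : realType) (k : nat) (G : groupType)
    (SG : set (G -> R)) : Prop :=
  [/\ manifold k SG,
      smooth_map (prod_structure SG SG) SG (fun x : G * G => (x.1 * x.2)%g) &
      smooth_map SG SG (fun g : G => g^-1%g)].

Definition is_action (G : groupType) (Q : Type) (act : G -> Q -> Q) : Prop :=
  (forall q, act 1%g q = q) /\
  (forall g h q, act (g * h)%g q = act g (act h q)).

Definition free_action (G : groupType) (Q : Type) (act : G -> Q -> Q) : Prop :=
  forall g q, act g q = q -> g = 1%g.

Definition proper_action (R : realType) (G : groupType) (Q : Type)
    (SG : set (G -> R)) (SQ : set (Q -> R)) (act : G -> Q -> Q) : Prop :=
  forall A : set (space_of SQ * space_of SQ), compact A ->
    compact [set x : space_of SG * space_of SQ |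
              A ((act x.1 x.2 : space_of SQ), x.2)].

Record symmetry (R : realType) (N : nh_system R) := Symmetry {
  grp : groupType;
  grp_str : set (grp -> R);
  grp_dim : nat;
  grpP : lie_group grp_dim grp_str;
  act : grp -> conf N -> conf N;
  act_action : is_action act;
  act_smooth : smooth_map (prod_structure grp_str (conf_str N)) (conf_str N)
                 (fun x => act x.1 x.2);
  act_free : free_action act;
  act_proper : proper_action grp_str (conf_str N) act;
  act_lagrangian : forall g q v, tangent (conf_str N) q v ->
    lagrangian (act g q) (tmap (conf_str N) (act g) v) = lagrangian q v;
  act_dist : forall g q,
    [set tmap (conf_str N) (act g) v | v in dist q] = dist (act g q)
}.

Arguments grp_str {R N} s _.
Arguments act {R N} s _ _.

Section Symmetry.
Context {R : realType} {N : nh_system R} (Y : symmetry N).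
Local Notation Q := (conf N).
Local Notation SQ := (conf_str N).
Local Notation M := (cmfd N).
Local Notation SM := (cmfd_str N).
Local Notation G := (grp Y).
Local Notation SG := (grp_str Y).
Local Notation vecQ := (vec (R := R) Q).
Local Notation vecM := (vec (R := R) M).
Local Notation vecG := (vec (R := R) G).

Definition lie_alg : set vecG := tangent SG 1%g.

Definition left_invariant (xi : vecG) : G -> vecG :=
  fun g => tmap SG (fun h => (g * h)%g) xi.

Definition lie_bracket (xi zeta : vecG) : vecG :=
  vbracket SG (left_invariant xi) (left_invariant zeta) 1%g.

Definition lie_subalgebra (h : set vecG) : Prop :=
  [/\ h `<=` lie_alg, h 0,
      forall a xi zeta, h xi -> h zeta -> h (a *: xi + zeta) &
      forall xi zeta, h xi -> h zeta -> h (lie_bracket xi zeta)].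

(* The cotangent lifted action, restricted to the constraint submanifold:      *)
(* <g.m, w> = <m, T(g^-1).w>.                                                  *)
Definition actM (g : G) (m : M) : M :=
  the m [set m' | tauM m' = act Y g (tauM m) /\
    forall w, tangent SQ (tauM m') w ->
      cov (iotaM m') w = cov (iotaM m) (tmap SQ (act Y g^-1%g) w)].

(* infinitesimal generators: tangent maps at 1 of the orbit maps *)
Definition genQ (xi : vecG) (q : Q) : vecQ := tmap SQ (fun g => act Y g q) xi.
Definition genM (xi : vecG) (m : M) : vecM := tmap SM (fun g => actM g m) xi.

Definition vertQ (q : Q) : set vecQ := [set genQ xi q | xi in lie_alg].
Definition vertM (m : M) : set vecM := [set genM xi m | xi in lie_alg].

Definition dimension_assumption : Prop :=
  forall q, tangent SQ q = sumv (dist q) (vertQ q).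

Definition distS (q : Q) : set vecQ := dist q `&` vertQ q.
Definition lie_alg_S (q : Q) : set vecG :=
  [set xi | lie_alg xi /\ distS q (genQ xi q)].

(* <J, zeta>(m), and <J^nh, xi>(m) for a section xi of lie_alg_S *)
Definition momentum (m : M) (zeta : vecG) : R := ThetaM m (genM zeta m).
Definition nh_momentum (xi : Q -> vecG) (m : M) : R :=
  ThetaM m (genM (xi (tauM m)) m).

Record vertical_complement := VerticalComplement {
  vcomp : Q -> set vecQ;
  vcomp_rank : nat;
  vcompP : distribution vcomp_rank SQ vcomp;
  vcomp_direct : forall q, direct_sum (tangent SQ q) (dist q) (vcomp q);
  vcomp_vertical : forall q, vcomp q `<=` vertQ q;
  vcomp_invariant : forall g q,
    [set tmap SQ (act Y g) v | v in vcomp q] = vcomp (act Y g q)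
}.

Section Complement.
Variable W : vertical_complement.

Definition calW (m : M) : set vecM :=
  [set v | vertM m v /\ vcomp W (tauM m) (tmap SQ tauM v)].

Definition projC (m : M) : vecM -> vecM := proj_along (calC m) (calW m).
Definition projW (m : M) : vecM -> vecM := proj_along (calW m) (calC m).

Definition lie_alg_W (q : Q) : set vecG :=
  [set xi | lie_alg xi /\ vcomp W q (genQ xi q)].

(* P_{g_S}(eta), for eta viewed as a constant section *)
Definition proj_S (eta : vecG) : Q -> vecG :=
  fun q => proj_along (lie_alg_S q) (lie_alg_W q) eta.

Definition vertical_symmetry_condition : Prop :=
  exists2 h, lie_subalgebra h & forall q, lie_alg_W q = h.

Definition formA (m : M) (v : vecM) : vecG :=
  the 0 [set xi | lie_alg xi /\ projW m v = genM xi m].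

(* The exterior derivative of the vector-valued form formA is taken            *)
(* componentwise: elements of the Lie algebra are functions of f : G -> R.     *)
Definition formK (m : M) (u v : vecM) : vecG :=
  fun f => extd SM (fun m' w => formA m' w f) m (projC m u) (projC m v).

Definition JK (m : M) (u v : vecM) : R := momentum m (formK m u v).

End Complement.

End Symmetry.

(* Main.v *)
Require Import Defs.
From HB Require Import structures.
From mathcomp Require Import all_boot all_order all_algebra.
From mathcomp Require Import all_classical all_reals all_analysis.
From mathcomp Require Import ring lra.

Set Implicit Arguments.
Unset Strict Implicit.
Unset Printing Implicit Defensive.

Import Order.TTheory GRing.Theory Num.Theory numFieldNormedType.Exports.
Local Open Scope classical_set_scope.
Local Open Scope ring_scope.

Local Notation "''e_' k" := (delta_mx ord0 k) (at level 8, k at level 2).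

(* Write P_S(eta) for the projection of eta onto g_S along g_W. The function f_eta sends m to
   <m, (P_S(eta))_Q>. Freeze xi = P_S(eta)(q) at the base point q of m. The generator of the
   constant xi is Hamiltonian for <J, xi> and lies in C at m, so invariance of H gives
   X_nh(<J, xi>) = 0 there. Now eta - P_S(eta) = sum_b zeta_b e_b for a fixed basis (e_b) of
   the algebra equal to every fibre of g_W, and differentiating the coefficients yields
   X_nh(f_eta) = - sum_b X_nh(zeta_b) <J, e_b>. On the other hand the distributions are
   invariant, so A_W is equivariant, and Cartan's formula at m gives
   K_W(X_nh, xi_M) = sum_b X_nh(zeta_b) e_b. Hence X_nh(f_eta) = - <J, K_W>(X_nh, xi_M) = 0.
   Finally the M-cotangent lift Z of P_S(eta)_Q lies in C and is Omega-dual to d f_eta on C,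
   so that dH(Z) = Omega(X_nh, Z) = - X_nh(f_eta) = 0.

   Tangent vectors are derivations of the algebra of smooth functions; bump functions make
   them local and Hadamard's lemma computes them in charts. *)

(** * Smooth functions on R^n *)

(** Neither [cotangent SQ] nor [cmfd N] is ever given charts: both are handled through their
    generating functions, and charts serve on [Q] and [G] alone. The price lies in [extd], a
    definite description over vector fields extending the two arguments, which has content only once
    such extensions exist. On the cotangent bundle they are built by hand; on [cmfd N] the vectors
    that occur, values of [Xnh] and of generators, already come from fields. No flow is integrated.
    The Lie derivative in Cartan's formula becomes a derivative in the group variable of an
    expression constant in [g], and the symmetry of mixed derivatives of derivations exchanges it
    with the other vector. For Theta the expression is constant because covector and vector move
    together; for A_W it is [0], since translates of a vector of C stay over D, so no adjoint action
    appears. Freeness matters at the infinitesimal level: it makes the algebra element recovered by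
    [formA] unique. In place of one-parameter subgroups, a minimum argument proves it. *)

Section PartialDerivatives.
Context {R : realType}.

Lemma norm_rV_lt n (y : 'rV[R]_n) (e : R) :
  0 < e -> (forall i, `|y 0 i| < e) -> `|y| < e.
Proof.
move=> e0 ye; rewrite /Num.norm/= mx_normrE; apply: bigmax_lt => //= -[i j] _ /=.
by rewrite (ord1 i).
Qed.

Lemma norm_rV_coord n (y : 'rV[R]_n) i : `|y 0 i| <= `|y|.
Proof.
rewrite [leRHS]/Num.norm/= mx_normrE.
exact: (le_bigmax _ (fun ij => `|y ij.1 ij.2|) (ord0, i)).
Qed.

Lemma norm_delta_rV n (i : 'I_n) : `|'e_i : 'rV[R]_n| = 1.
Proof.
apply/le_anti/andP; split.
  rewrite /Num.norm/= mx_normrE; apply: bigmax_le => // -[i0 j] _ /=.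
  by rewrite mxE; case: (_ && _); rewrite ?normr1 ?normr0.
by have := norm_rV_coord ('e_i : 'rV[R]_n) i; rewrite mxE !eqxx normr1.
Qed.

Lemma closed_ball_compact n (a : 'rV[R]_n) (e : R) : compact [set y : 'rV[R]_n | `|y - a| <= e].
Proof.
apply: bounded_closed_compact.
  exists (e + `|a|); split; first exact: num_real.
  move=> x rx z Az; apply: ltW; apply: le_lt_trans rx.
  by rewrite -{1}(subrK a z) (le_trans (ler_normD _ _))// lerD2r.
have -> : [set y : 'rV[R]_n | `|y - a| <= e] = closed_ball_ Num.norm a e.
  by apply/seteqP; split => y; rewrite /closed_ball_/= distrC.
exact: closed_closed_ball_.
Qed.

Lemma cvg_sumr (T : Type) (F : set_system T) (I : Type) (r : seq I)
    (f : I -> T -> R) (l : I -> R) : Filter F ->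
  (forall i, f i x @[x --> F] --> l i) ->
  \sum_(i <- r) f i x @[x --> F] --> \sum_(i <- r) l i.
Proof. by move=> FF fl; apply: cvg_big => //; exact: add_continuous. Qed.

Lemma cvg_row (T : Type) (F : set_system T) n (f : T -> 'rV[R]_n) (l : 'rV[R]_n) :
  Filter F -> (forall i, f x 0 i @[x --> F] --> l 0 i) ->
  f x @[x --> F] --> l.
Proof.
move=> FF fl; apply/(@cvgrPdist_le _ 'rV[R]_n) => e e0; near=> x.
rewrite /Num.norm/= mx_normrE (bigmax_le _ (ltW e0))//= => -[i0 i] _.
rewrite !mxE/= (ord1 i0); move: i; near: x; apply: filter_forall => i.
by move/cvgrPdist_le: (fl i); exact.
Unshelve. all: by end_near. Qed.

(** The sign of [a] is left open because it will be a coordinate of an arbitrary increment, so the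
    endpoints come in either order. *)
Lemma MVT0 (g dg : R -> R) (a : R) :
  (forall t : R, `|t| <= `|a| -> is_derive t 1 g (dg t)) ->
  exists2 c : R, `|c| <= `|a| & g a - g 0 = a * dg c.
Proof.
move=> h.
have cont (b c : R) : (forall t, t \in `[b, c] -> `|t| <= `|a|) ->
    {within `[b, c], continuous g}.
  move=> bc; apply: derivable_within_continuous => t /bc ta.
  by have [] := h t ta.
have [a0|/ltW a0] := leP 0 a.
  have le_a t : t \in `[0, a] -> `|t| <= `|a|.
    by rewrite in_itv/= => /andP[t0 ta]; rewrite !ger0_norm.
  have [||c cI E] := @MVT_segment R g dg 0 a a0.
  - by move=> t /subset_itv_oo_cc /le_a /h.
  - exact: cont.
  - by exists c; [exact: le_a|rewrite E subr0 mulrC].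
have le_a t : t \in `[a, 0] -> `|t| <= `|a|.
  by rewrite in_itv/= => /andP[t0 ta]; rewrite !ler0_norm// lerN2.
have [||c cI E] := @MVT_segment R g dg a 0 a0.
- by move=> t /subset_itv_oo_cc /le_a /h.
- exact: cont.
- by exists c; [exact: le_a|rewrite -opprB E sub0r; ring].
Qed.

Lemma is_derive_line n (F : 'rV[R]_n -> R) (z v : 'rV[R]_n) (t : R) :
  derivable F (t *: v + z) v ->
  is_derive t 1 (fun s : R => F (s *: v + z)) ('D_v F (t *: v + z)).
Proof.
have E : (fun h : R => h^-1 *: (F ((h *: 1 + t) *: v + z) - F (t *: v + z))) =
         (fun h : R => h^-1 *: (F (h *: v + (t *: v + z)) - F (t *: v + z))).
  by apply/funext => h; rewrite scalerDl addrA /GRing.scale/= mulr1.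
move=> d; apply: DeriveDef; last by rewrite /derive /= E.
by rewrite /derivable /= E.
Qed.

(** The points [trunc d k] lead from [0] to [d] along coordinate directions, so that an increment of
    [F] telescopes into one-variable increments. *)
Definition trunc n (d : 'rV[R]_n) (k : nat) : 'rV[R]_n :=
  \row_j (if (j < k)%N then d 0 j else 0).

Lemma trunc_norm n (d : 'rV[R]_n) (c : R) (i : 'I_n) : `|c| <= `|d 0 i| ->
  `|c *: 'e_i + trunc d i| <= `|d|.
Proof.
move=> ci; rewrite {1}/Num.norm/= mx_normrE; apply: bigmax_le => //= -[i0 j] _/=.
rewrite !mxE /= (ord1 i0) eqxx/=.
have [->|_] := eqVneq j i; first by rewrite ltnn mulr1 addr0 (le_trans ci) // norm_rV_coord.
by rewrite mulr0 add0r; case: ifP => _; rewrite ?normr0 ?norm_rV_coord.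
Qed.

Lemma truncS n (d : 'rV[R]_n) (i : 'I_n) :
  trunc d i.+1 = d 0 i *: 'e_i + trunc d i.
Proof.
apply/rowP => j; rewrite !mxE eqxx/= ltnS.
have [->|ji] := eqVneq j i; first by rewrite leqnn ltnn mulr1 addr0.
by rewrite mulr0 add0r leq_eqVlt (negPf (_ : nat_of_ord j != i)).
Qed.

Lemma trunc0 n (d : 'rV[R]_n) : trunc d 0 = 0.
Proof. by apply/rowP => j; rewrite !mxE. Qed.

Lemma trunc_full n (d : 'rV[R]_n) : trunc d n = d.
Proof. by apply/rowP => j; rewrite !mxE ltn_ord. Qed.

(** This takes the place of total differentiability. Each one-coordinate increment is [d 0 k] times
    a mean-value slope, and continuity of the partials makes the slopes converge. The identity is
    exact, with no remainder term to estimate. *)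
Lemma partial_slopes n (F : 'rV[R]_n -> R) (x : 'rV[R]_n) :
  (forall k : 'I_n, \forall z \near x, derivable F z 'e_k) ->
  (forall k : 'I_n, {for x, continuous (fun z => 'D_('e_k) F z)}) ->
  exists r : 'I_n -> 'rV[R]_n -> R,
    (forall k, r k d @[d --> (0 : 'rV[R]_n)] --> 'D_('e_k) F x) /\
    forall d, F (d + x) - F x = \sum_k d 0 k * r k d.
Proof.
move=> dF cF.
(* When [d 0 k = 0] the k-th increment is zero whatever the slope is; the limit value is chosen so
   that convergence is not spoilt. *)
pose r (k : 'I_n) (d : 'rV[R]_n) := if d 0 k == 0 then 'D_('e_k) F x
  else (d 0 k)^-1 * (F (trunc d k.+1 + x) - F (trunc d k + x)).
exists r; split=> [k|d]; last first.
  have <- : \sum_(0 <= k < n) (F (trunc d k.+1 + x) - F (trunc d k + x)) =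
            F (d + x) - F x.
    by rewrite telescope_sumr// trunc_full trunc0 add0r.
  rewrite big_mkord; apply: eq_bigr => k _; rewrite /r.
  case: eqP => [dk|/eqP dk]; last by rewrite mulVKf.
  by rewrite truncS dk scale0r add0r subrr mul0r.
apply/(@cvgrPdist_le _ _ _ (nbhs (0 : 'rV[R]_n))) => e e0.
have : \forall z \near x, derivable F z 'e_k /\
    `|'D_('e_k) F x - 'D_('e_k) F z| <= e.
  near=> z; split; first by near: z; exact: dF.
  by near: z; move/cvgrPdist_le : (cF k) => /(_ e e0).
move=> /nbhs_ballP[dl /= dl0 Bx].
near=> d; rewrite /r; case: eqP => [_|/eqP dk].
  by rewrite subrr normr0 ltW.
have dd : `|d| < dl.
  by near: d; apply: (@nbhs0_lt R ('rV[R]_n)).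
(* All points of the k-th segment stay in the ball where derivability and the estimate hold, by
   [trunc_norm]. *)
have inB (c : R) : `|c| <= `|d 0 k| -> ball x dl (c *: 'e_k + (trunc d k + x)).
  move=> cd; rewrite -ball_normE/= -opprB normrN addrA addrK.
  exact: le_lt_trans (trunc_norm cd) dd.
have [c cd E] := @MVT0 (fun s => F (s *: 'e_k + (trunc d k + x)))
  (fun s => 'D_('e_k) F (s *: 'e_k + (trunc d k + x))) (d 0 k) (fun t td =>
   is_derive_line (proj1 (Bx _ (inB t td)))).
rewrite truncS -addrA; move: E; rewrite scale0r add0r => ->.
rewrite mulKf//; exact: (proj2 (Bx _ (inB c cd))).
Unshelve. all: by end_near. Qed.

(** Evaluating the slopes of [F] at the increment of [c] along [v] turns the difference quotient
    into a finite sum of products whose factors have known limits. *)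
Lemma is_derive_comp n m (F : 'rV[R]_m -> R) (c : 'rV[R]_n -> 'rV[R]_m)
    (x v : 'rV[R]_n) :
  (forall k : 'I_m, \forall z \near c x, derivable F z 'e_k) ->
  (forall k : 'I_m, {for c x, continuous (fun z => 'D_('e_k) F z)}) ->
  {for x, continuous c} ->
  (forall k : 'I_m, derivable (fun z => c z 0 k) x v) ->
  is_derive x v (F \o c)
    (\sum_k 'D_('e_k) F (c x) * 'D_v (fun z => c z 0 k) x).
Proof.
move=> dF cF cc dc.
have [r [rl rE]] := partial_slopes dF cF.
have H : (fun h : R => h^-1 *: (F (c (h *: v + x)) - F (c x))) @ 0^' -->
   \sum_k 'D_('e_k) F (c x) * 'D_v (fun z => c z 0 k) x.
  have -> : (fun h : R => h^-1 *: (F (c (h *: v + x)) - F (c x))) =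
    (fun h => \sum_k r k (c (h *: v + x) - c x) *
                     (h^-1 *: (c (h *: v + x) 0 k - c x 0 k))).
    apply/funext => h; rewrite -[c (h *: v + x) in LHS](subrK (c x)) rE.
    rewrite /GRing.scale/= mulr_sumr; apply: eq_bigr => k _; rewrite !mxE.
    by ring.
  have xl : (h *: v + x) @[h --> (0 : R)^'] --> x.
    apply: cvg_within_filter.
    have : (h *: v + x) @[h --> (0 : R)] --> (0 *: v + x).
      by apply: cvgD; [apply: cvgZr_tmp; exact: cvg_id|exact: cvg_cst].
    by rewrite scale0r add0r.
  have cl : (c (h *: v + x) - c x) @[h --> (0 : R)^'] --> (0 : 'rV[R]_m).
    have : (c (h *: v + x) - c x) @[h --> (0 : R)^'] --> (c x - c x).
      apply: cvgB; last exact: cvg_cst.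
      exact: (cvg_comp _ _ xl cc).
    by rewrite subrr.
  apply: cvg_sumr => k; apply: cvgM; last exact: dc.
  exact: (cvg_comp _ _ cl (rl k)).
apply: DeriveDef; first by apply/cvg_ex; eexists; exact: H.
exact: (cvg_lim _ H).
Qed.

End PartialDerivatives.

(** * C^r functions on an open set, by recursion on the order *)

Section Cr.
Context {R : realType}.

(** The recursion differentiates [F] itself first, so the product, inverse and chain rules reduce
    order [r.+1] to order [r]. In [Cinfty_on] the recursion adds the outermost derivative, which
    does not match these rules. *)
Fixpoint Cr n (r : nat) (U : set 'rV[R]_n) (F : 'rV[R]_n -> R) : Prop :=
  (forall x, U x -> {for x, continuous F}) /\
  if r is r'.+1 then
    forall i : 'I_n, (forall x, U x -> derivable F x 'e_i) /\ Cr r' U ('D_('e_i) F)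
  else True.

Lemma Cr_continuous n r (U : set 'rV[R]_n) F x :
  Cr r U F -> U x -> {for x, continuous F}.
Proof. by case: r => [|r] [cF _]; exact: cF. Qed.

Lemma iter_partial_rcons n s (i : 'I_n) (F : 'rV[R]_n -> R) :
  iter_partial (rcons s i) F = iter_partial s ('D_('e_i) F).
Proof. by rewrite /iter_partial foldr_rcons. Qed.

Lemma Cinfty_on_partial n (U : set 'rV[R]_n) F (i : 'I_n) :
  Cinfty_on U F -> Cinfty_on U ('D_('e_i) F).
Proof. by move=> FU s x Ux; have := FU (rcons s i) x Ux; rewrite iter_partial_rcons. Qed.

Lemma Cinfty_on_continuous n (U : set 'rV[R]_n) F x :
  Cinfty_on U F -> U x -> {for x, continuous F}.
Proof. by move=> FU Ux; have [] := FU [::] x Ux. Qed.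

Lemma Cinfty_on_derivable n (U : set 'rV[R]_n) F x (i : 'I_n) :
  Cinfty_on U F -> U x -> derivable F x 'e_i.
Proof. by move=> FU Ux; have [_] := FU [::] x Ux. Qed.

(** Words of partials are read from the right: [rcons] exposes the innermost derivative, the one
    that [Cr] unfolds. *)
Lemma Cinfty_onP n (U : set 'rV[R]_n) F : Cinfty_on U F <-> forall r, Cr r U F.
Proof.
split=> [FU r|FU s].
  elim: r F FU => [|r IH] F FU; (split; first by
    move=> x Ux; exact: Cinfty_on_continuous Ux) => // i.
  split=> [x Ux|]; first exact: Cinfty_on_derivable Ux.
  exact/IH/Cinfty_on_partial.
(* One order per letter of the word, and one more for the derivability of the result. *)
have {}FU : Cr (size s).+1 U F by exact: FU.
elim/last_ind: s F FU => [|s i IH] F; last first.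
  by rewrite size_rcons iter_partial_rcons => -[_ /(_ i)[_]]; exact: IH.
move=> [cF dF] x Ux; split; first exact: cF.
by move=> i; have [+ _] := dF i; exact.
Qed.

Lemma Cinfty_on_sub n (U V : set 'rV[R]_n) F :
  V `<=` U -> Cinfty_on U F -> Cinfty_on V F.
Proof. by move=> VU FU s x /VU; exact: FU. Qed.

Lemma CrW n r (U : set 'rV[R]_n) F : Cr r.+1 U F -> Cr r U F.
Proof.
elim: r F => [|r IH] F [cF dF]; split=> // i.
by have [? ?] := dF i; split=> //; exact: IH.
Qed.

(** The rules of differentiation hold only at points of [U], so the inductions below keep replacing
    a function by one that agrees with it on [U]. Openness turns this into agreement near each
    point, which derivatives respect. *)
Lemma Cr_congr n r (U : set 'rV[R]_n) F G : open U ->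
  (forall x, U x -> F x = G x) -> Cr r U F -> Cr r U G.
Proof.
move=> oU; have near_eq x H K : U x -> (forall y, U y -> H y = K y) ->
    \forall y \near x, H y = K y :> R.
  by move=> Ux HK; apply: filterS HK _; exact: open_nbhs_nbhs.
have cont (H K : 'rV[R]_n -> R) : (forall x, U x -> H x = K x) ->
    (forall x, U x -> {for x, continuous H}) ->
    (forall x, U x -> {for x, continuous K}).
  move=> HK cH x Ux; rewrite /prop_for /continuous_at -HK//.
  have nHK : {near nbhs x, H =1 K} by exact: near_eq.
  exact: cvg_trans (near_eq_cvg nHK) (cH x Ux).
elim: r F G => [|r IH] F G FG [cF dF]; (split; first exact: cont cF) => // i.
have [dFi FiC] := dF i; split=> [x Ux|].
  exact: near_eq_derivable (near_eq _ _ _ Ux FG) (dFi x Ux).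
apply: IH FiC => x Ux; apply: near_eq_derive.
by have := near_eq _ _ _ Ux FG; apply.
Qed.

Lemma Cr_cst n r (U : set 'rV[R]_n) (c : R) : Cr r U (fun=> c).
Proof.
elim: r c => [|r IH] c; (split; first by move=> x _; exact: cst_continuous) => // i.
split=> [x _|]; first exact: derivable_cst.
have -> : 'D_('e_i) (fun _ : 'rV[R]_n => c) = (fun _ : 'rV[R]_n => 0).
  by apply/funext => x; rewrite derive_cst.
exact: IH.
Qed.

Lemma is_derive_coord n (i : 'I_n) (x v : 'rV[R]_n) :
  is_derive x v (fun y => y 0 i : R) (v 0 i).
Proof.
have E : (fun h : R => h^-1 *: ((h *: v + x) 0 i - x 0 i)) @ 0^' --> v 0 i.
  apply: cvg_near_cst; near=> h.
  rewrite !mxE addrK /GRing.scale/= mulKf//.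
  by near: h; exact: nbhs_dnbhs_neq.
by apply: DeriveDef; [apply/cvg_ex; exists (v 0 i)|exact: (cvg_lim _ E)].
Unshelve. all: by end_near. Qed.

Lemma Cr_coord n r (U : set 'rV[R]_n) (i : 'I_n) : Cr r U (fun x => x 0 i).
Proof.
case: r => [|r]; (split; first by move=> x _; exact: coord_continuous) => // j.
split=> [x _|]; first by have [] := is_derive_coord i x 'e_j.
have -> : 'D_('e_j) (fun x : 'rV[R]_n => x 0 i) = (fun _ : 'rV[R]_n => ('e_j : 'rV[R]_n) 0 i).
  by apply/funext => x; have [_] := is_derive_coord i x 'e_j.
exact: Cr_cst.
Qed.

Lemma CrD n r (U : set 'rV[R]_n) F G : open U ->
  Cr r U F -> Cr r U G -> Cr r U (fun x => F x + G x).
Proof.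
move=> oU; elim: r F G => [|r IH] F G [cF dF] [cG dG].
  by split=> // x Ux; exact: (continuousD (cF x Ux) (cG x Ux)).
split=> [x Ux|i]; first exact: (continuousD (cF x Ux) (cG x Ux)).
have [dFi FC] := dF i; have [dGi GC] := dG i.
split=> [x Ux|]; first exact: (derivableD (dFi x Ux) (dGi x Ux)).
apply: (Cr_congr oU _ (IH _ _ FC GC)) => x Ux.
by rewrite -(deriveD (dFi x Ux) (dGi x Ux)).
Qed.

Lemma CrM n r (U : set 'rV[R]_n) F G : open U ->
  Cr r U F -> Cr r U G -> Cr r U (fun x => F x * G x).
Proof.
move=> oU; elim: r F G => [|r IH] F G FC GC.
  by split=> // x Ux; exact: (continuousM (FC.1 x Ux) (GC.1 x Ux)).
have [cF dF] := FC; have [cG dG] := GC.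
split=> [x Ux|i]; first exact: (continuousM (cF x Ux) (cG x Ux)).
have [dFi FiC] := dF i; have [dGi GiC] := dG i.
split=> [x Ux|]; first exact: (derivableM (dFi x Ux) (dGi x Ux)).
apply: (Cr_congr oU _ (CrD oU (IH _ _ (CrW FC) GiC) (IH _ _ (CrW GC) FiC))).
by move=> x Ux; rewrite -(deriveM (dFi x Ux) (dGi x Ux)).
Qed.

Lemma Cr_sum n r (U : set 'rV[R]_n) (I : Type) (s : seq I)
    (F : I -> 'rV[R]_n -> R) : open U ->
  (forall i, Cr r U (F i)) -> Cr r U (fun x => \sum_(i <- s) F i x).
Proof.
move=> oU FC; elim: s => [|i s IH].
  by apply: (Cr_congr oU _ (Cr_cst r U 0)) => x _; rewrite big_nil.
by apply: (Cr_congr oU _ (CrD oU (FC i) IH)) => x _; rewrite big_cons.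
Qed.

Lemma CrV n r (U : set 'rV[R]_n) F : open U -> (forall x, U x -> F x != 0) ->
  Cr r U F -> Cr r U (fun x => (F x)^-1).
Proof.
move=> oU F0; have cV x : U x -> {for x, continuous F} ->
    {for x, continuous (fun x => (F x)^-1)}.
  by move=> Ux cF; exact: (continuousV (F0 x Ux) cF).
elim: r => [|r IH] FC; first by split=> // x Ux; exact/cV/FC.1.
split=> [x Ux|i]; first by apply: cV => //; exact: FC.1.
have [dFi FiC] := FC.2 i; have {}IH := IH (CrW FC).
split=> [x Ux|]; first exact: (derivableV (F0 x Ux) (dFi x Ux)).
apply: (Cr_congr oU _ (CrM oU (CrM oU (Cr_cst r U (-1)) FiC) (CrM oU IH IH))).
move=> x Ux; rewrite (deriveV (F0 x Ux) (dFi x Ux)) /GRing.scale/=.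
by rewrite -exprVn; ring.
Qed.

Lemma Cr_comp n m r (U : set 'rV[R]_n) (V : set 'rV[R]_m) F
    (c : 'rV[R]_n -> 'rV[R]_m) : open U -> open V ->
  (forall x, U x -> V (c x)) -> (forall j, Cr r U (fun x => c x 0 j)) ->
  Cr r V F -> Cr r U (F \o c).
Proof.
move=> oU oV cUV; have cc r' : (forall j, Cr r' U (fun x => c x 0 j)) ->
    forall x, U x -> {for x, continuous c}.
  by move=> cC x Ux; apply: (@cvg_row _ _ (nbhs x)) => j; exact: (Cr_continuous (cC j) Ux).
elim: r F => [|r IH] F cC FC.
  split=> // x Ux; apply: continuous_comp; first exact: cc Ux.
  exact: (Cr_continuous FC (cUV _ Ux)).
split=> [x Ux|i].
  apply: continuous_comp; first exact: cc Ux.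
  exact: (Cr_continuous FC (cUV _ Ux)).
have D x : U x -> is_derive x 'e_i (F \o c)
    (\sum_k 'D_('e_k) F (c x) * 'D_('e_i) (fun z => c z 0 k) x).
  move=> Ux; apply: is_derive_comp => [k|k||k].
  - have := open_nbhs_nbhs (conj oV (cUV _ Ux)); apply: filterS => z Vz.
    exact: (FC.2 k).1.
  - exact: (Cr_continuous (FC.2 k).2 (cUV _ Ux)).
  - exact: cc Ux.
  - exact: ((cC k).2 i).1.
split=> [x Ux|]; first by have [] := D x Ux.
have S : Cr r U (fun x =>
    \sum_k ('D_('e_k) F \o c) x * 'D_('e_i) (fun z => c z 0 k) x).
  apply: Cr_sum => // k; apply: CrM => //; last exact: ((cC k).2 i).2.
  by apply: IH; [move=> j; exact/CrW/cC|exact: (FC.2 k).2].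
by apply: (Cr_congr oU _ S) => x Ux; have [_ <-] := D x Ux.
Qed.

End Cr.

(** * Closure properties of C^infinity, and a smooth step function *)

Section CinftyClosure.
Context {R : realType}.

Section Operations.
Variables (n : nat) (U : set 'rV[R]_n).
Hypothesis oU : open U.

Lemma Cinfty_on_congr F G :
  (forall x, U x -> F x = G x) -> Cinfty_on U F -> Cinfty_on U G.
Proof. by rewrite !Cinfty_onP => FG FC r; exact: Cr_congr oU FG (FC r). Qed.

Lemma Cinfty_on_cst (c : R) : Cinfty_on U (fun=> c).
Proof. by rewrite Cinfty_onP => r; exact: Cr_cst. Qed.

Lemma Cinfty_on_coord (i : 'I_n) : Cinfty_on U (fun x => x 0 i).
Proof. by rewrite Cinfty_onP => r; exact: Cr_coord. Qed.

Lemma Cinfty_onD F G :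
  Cinfty_on U F -> Cinfty_on U G -> Cinfty_on U (fun x => F x + G x).
Proof. by rewrite !Cinfty_onP => FC GC r; exact: CrD. Qed.

Lemma Cinfty_onM F G :
  Cinfty_on U F -> Cinfty_on U G -> Cinfty_on U (fun x => F x * G x).
Proof. by rewrite !Cinfty_onP => FC GC r; exact: CrM. Qed.

Lemma Cinfty_onB F G :
  Cinfty_on U F -> Cinfty_on U G -> Cinfty_on U (fun x => F x - G x).
Proof.
move=> FC GC; have := Cinfty_onD FC (Cinfty_onM (Cinfty_on_cst (-1)) GC).
by apply: Cinfty_on_congr => x _; rewrite mulN1r.
Qed.

Lemma Cinfty_on_prod (I : Type) (s : seq I) (F : I -> 'rV[R]_n -> R) :
  (forall i, Cinfty_on U (F i)) -> Cinfty_on U (fun x => \prod_(i <- s) F i x).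
Proof.
move=> FC; elim: s => [|i s IH].
  by apply: Cinfty_on_congr (Cinfty_on_cst 1) => x _; rewrite big_nil.
by apply: Cinfty_on_congr (Cinfty_onM (FC i) IH) => x _; rewrite big_cons.
Qed.

Lemma Cinfty_onV F : (forall x, U x -> F x != 0) ->
  Cinfty_on U F -> Cinfty_on U (fun x => (F x)^-1).
Proof. by rewrite !Cinfty_onP => F0 FC r; exact: CrV. Qed.

Lemma Cinfty_on_comp m (V : set 'rV[R]_m) F (c : 'rV[R]_n -> 'rV[R]_m) :
  open V -> (forall x, U x -> V (c x)) ->
  (forall j, Cinfty_on U (fun x => c x 0 j)) ->
  Cinfty_on V F -> Cinfty_on U (F \o c).
Proof.
move=> oV cUV cC; rewrite !Cinfty_onP => FC r.
by apply: (@Cr_comp _ _ _ r U V F c) => // j; have /Cinfty_onP := cC j.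
Qed.

Lemma Cinfty_on_comp1 (h : R -> R) F :
  Cinfty_on setT (fun y : 'rV[R]_1 => h (y 0 0)) -> Cinfty_on U F ->
  Cinfty_on U (fun x => h (F x)).
Proof.
move=> hC FC; have cC (j : 'I_1) : Cinfty_on U (fun x => (\row__ F x : 'rV[R]_1) 0 j).
  by apply: Cinfty_on_congr FC => x _; rewrite mxE.
have := Cinfty_on_comp openT (fun _ _ => I) cC hC.
by apply: Cinfty_on_congr => x _ /=; rewrite mxE.
Qed.

End Operations.

(* t^-k exp(-1/t): these functions are permuted, up to sums, by derivation. *)
Definition flat_exp (k : nat) (t : R) : R :=
  if 0 < t then t^-1 ^+ k * expR (- t^-1) else 0.

Lemma flat_exp_ge0 k t : 0 <= flat_exp k t.
Proof.
rewrite /flat_exp; case: ifP => // t0.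
by rewrite mulr_ge0 ?expR_ge0// exprn_ge0// invr_ge0 ltW.
Qed.

(** From [exp u >= u^(k+2) / (k+2)!] at [u = 1/t]: the two powers beyond [t^-k] leave a factor
    [t^2], and this quadratic bound makes the derivative at [0] vanish. *)
Lemma flat_exp_le k t : flat_exp k t <= (k.+2)`!%:R * t ^+ 2.
Proof.
rewrite /flat_exp; case: ifP => [t0|_]; last by rewrite mulr_ge0 ?sqr_ge0.
rewrite expRN ler_pdivrMr ?expR_gt0// -mulrA.
have ut0 : 0 <= t^-1 by rewrite invr_ge0 ltW.
have := expR_ge1Dxn k.+1 ut0.
have f0 : (0 : R) < (k.+2)`!%:R by rewrite ltr0n fact_gt0.
move=> h; have {h} : t^-1 ^+ k.+2 / (k.+2)`!%:R <= expR t^-1.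
  by apply: le_trans h; rewrite lerDr.
rewrite -(ler_pM2l f0) mulrCA divff ?gt_eqF// mulr1 => h.
have t20 : 0 <= t ^+ 2 by exact: sqr_ge0.
rewrite [leRHS]mulrCA; apply: le_trans (ler_wpM2l t20 h).
by rewrite -(addn2 k) exprD mulrCA -exprMn mulfV ?gt_eqF// expr1n mulr1.
Qed.

Lemma flat_exp_pos_derive k (t : R) : 0 < t ->
  is_derive t 1 (fun s : R => s^-1 ^+ k * expR (- s^-1))
    (- k%:R * flat_exp k.+1 t + flat_exp k.+2 t).
Proof.
move=> t0; have tn0 : t != 0 by rewrite gt_eqF.
have V : is_derive t 1 (fun s : R => s^-1) (- t^-2).
  apply: is_derive_eq; first exact: (is_deriveV tn0).
  by rewrite /GRing.scale/= mulr1.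
have E : is_derive t 1 (fun s : R => expR (- s^-1)) (expR (- t^-1) * t^-2).
  have N : is_derive t 1 (fun s : R => - s^-1) (t^-2).
    by apply: is_derive_eq; rewrite opprK.
  exact: (is_derive1_comp (is_derive_expR _) N).
have X : is_derive t 1 (fun s : R => s^-1 ^+ k) (- k%:R * t^-1 ^+ k.+1).
  have -> : (fun s : R => s^-1 ^+ k) = (fun s : R => s^-1) ^+ k.
    by rewrite exprfctE.
  apply: (is_derive_eq (is_deriveX k V)).
  rewrite /GRing.scale/=; case: k => [|k]; first by rewrite mul0r oppr0 !mul0r.
  by rewrite -exprVn !exprS expr0; ring.
apply: (is_derive_eq (is_deriveM X E)).
by rewrite /GRing.scale/= /flat_exp t0 -exprVn !exprS expr0; ring.
Qed.

Lemma flat_exp_derive k (t : R) :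
  is_derive t 1 (flat_exp k) (- k%:R * flat_exp k.+1 t + flat_exp k.+2 t).
Proof.
have [t0|t0|<-] := ltgtP 0 t.
- apply: near_eq_is_derive (flat_exp_pos_derive k t0).
  by near=> s; rewrite /flat_exp ifT//; near: s; exact: lt_nbhsr.
- apply: (@near_eq_is_derive _ _ _ (fun=> 0)).
    near=> s; rewrite /flat_exp ifF//; apply/negbTE; rewrite -leNgt.
    by apply/ltW; near: s; exact: lt_nbhsl.
  rewrite /flat_exp !ifF ?mulr0 ?addr0; try by rewrite ltNge ltW.
  exact: is_derive_cst.
rewrite /flat_exp ltxx mulr0 addr0 -/(flat_exp k).
have E : (fun h : R => h^-1 *: (flat_exp k (h *: 1 + 0) - flat_exp k 0)) @ 0^' --> (0 : R).
  apply/cvgrPdist_le => e e0; near=> h.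
  have h0 : h != 0 by near: h; exact: nbhs_dnbhs_neq.
  rewrite sub0r normrN /GRing.scale/= mulr1 addr0 {2}/flat_exp ltxx subr0 normrM.
  rewrite (ger0_norm (flat_exp_ge0 _ _)) normfV.
  rewrite ler_pdivrMl ?normr_gt0//; apply: (le_trans (flat_exp_le _ _)).
  rewrite -real_normK ?num_real// expr2 mulrA mulrC ler_wpM2l//.
  rewrite -ler_pdivlMl ?ltr0n ?fact_gt0//.
  near: h; apply: dnbhs0_le.
  by rewrite mulr_gt0// invr_gt0 ltr0n fact_gt0.
by apply: DeriveDef; [apply/cvg_ex; exists 0|exact: (cvg_lim _ E)].
Unshelve. all: by end_near. Qed.

Lemma is_derive_rV1 (h : R -> R) (x : 'rV[R]_1) (i : 'I_1) d :
  is_derive (x 0 0) 1 h d -> is_derive x 'e_i (fun y : 'rV[R]_1 => h (y 0 0)) d.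
Proof.
have E : (fun s : R => s^-1 *: (h ((s *: 'e_i + x) 0 0) - h (x 0 0))) =
         (fun s : R => s^-1 *: (h (s *: 1 + x 0 0) - h (x 0 0))).
  by apply/funext => s; rewrite !mxE (ord1 i) !eqxx.
case=> dh <-; apply: DeriveDef; last by rewrite /derive /= E.
by rewrite /derivable /= E.
Qed.

Lemma Cinfty_flat_exp k : Cinfty_on setT (fun y : 'rV[R]_1 => flat_exp k (y 0 0)).
Proof.
apply/Cinfty_onP => r; have cont j (x : 'rV[R]_1) :
    {for x, continuous (fun y : 'rV[R]_1 => flat_exp j (y 0 0))}.
  apply: (@continuous_comp _ _ _ (fun y : 'rV[R]_1 => y 0 0) (flat_exp j)).
    exact: coord_continuous.
  apply/differentiable_continuous/derivable1_diffP.
  by have [] := flat_exp_derive j (x 0 0).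
elim: r k => [|r IH] k; (split; first by move=> x _; exact: cont) => // i.
split=> [x _|]; first by have [] := is_derive_rV1 i (flat_exp_derive k (x 0 0)).
have := CrD openT (CrM openT (Cr_cst r setT (- k%:R)) (IH k.+1)) (IH k.+2).
apply: (Cr_congr openT) => x _.
by have [_ ->] := is_derive_rV1 i (flat_exp_derive k (x 0 0)).
Qed.

(** The denominator is positive because [t] and [1 - t] are never both nonpositive; for [t >= 1] its
    second summand is zero, which gives the plateau. *)
Definition smooth_step (t : R) : R :=
  flat_exp 0 t / (flat_exp 0 t + flat_exp 0 (1 - t)).

Lemma flat_exp_gt0 k t : 0 < t -> 0 < flat_exp k t.
Proof. by move=> t0; rewrite /flat_exp t0 mulr_gt0 ?expR_gt0// exprn_gt0// invr_gt0. Qed.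

Lemma smooth_step0 t : t <= 0 -> smooth_step t = 0.
Proof. by move=> t0; rewrite /smooth_step {1}/flat_exp ltNge t0 mul0r. Qed.

Lemma smooth_step1 t : 1 <= t -> smooth_step t = 1.
Proof.
move=> t1; rewrite /smooth_step {3}/flat_exp subr_gt0 ltNge t1 addr0 divff//.
by rewrite gt_eqF// flat_exp_gt0// (lt_le_trans ltr01).
Qed.

Lemma Cinfty_smooth_step : Cinfty_on setT (fun y : 'rV[R]_1 => smooth_step (y 0 0)).
Proof.
have C1 : Cinfty_on setT (fun y : 'rV[R]_1 => flat_exp 0 (1 - y 0 0)).
  apply: (Cinfty_on_comp1 openT (h := flat_exp 0)); first exact: Cinfty_flat_exp.
  exact: (Cinfty_onB openT (Cinfty_on_cst 1) (Cinfty_on_coord 0)).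
have C0 := Cinfty_flat_exp 0.
apply: (Cinfty_onM openT C0); apply: (Cinfty_onV openT); last exact: (Cinfty_onD openT C0 C1).
move=> y _; rewrite gt_eqF//; have [y0|y0] := ltP 0 (y 0 0).
  by rewrite ltr_wpDr ?flat_exp_ge0// flat_exp_gt0.
rewrite ltr_wpDl ?flat_exp_ge0// flat_exp_gt0// subr_gt0.
exact: le_lt_trans y0 ltr01.
Qed.

Lemma Cinfty_on_step n (U : set 'rV[R]_n) F : open U ->
  Cinfty_on U F -> Cinfty_on U (fun x => smooth_step (F x)).
Proof. by move=> oU; apply: (Cinfty_on_comp1 oU (h := smooth_step)); exact: Cinfty_smooth_step. Qed.

End CinftyClosure.

(** * Hadamard's lemma, by averaging along rays *)

Section Hadamard.
Context {R : realType}.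
Local Notation mu := (@lebesgue_measure R).
Local Notation "\I f" := (\int[mu]_(s in `[0%R, 1%R]) f s) (at level 10).

Lemma continuous_integrable01 (f : R -> R) : continuous f ->
  mu.-integrable `[0%R, 1%R] (EFin \o f).
Proof.
move=> cf; apply: continuous_compact_integrable; first exact: segment_compact.
exact: continuous_subspaceT.
Qed.

Lemma Rintegral01_derive (f F : R -> R) : continuous f ->
  (forall s : R, is_derive s 1 F (f s)) -> \I f = F 1 - F 0.
Proof.
move=> cf dF; have cF : continuous F.
  move=> s; apply/differentiable_continuous/derivable1_diffP.
  by have [] := dF s.
rewrite /Rintegral (@continuous_FTC2 _ f F 0 1 ltr01)//.
- exact: continuous_subspaceT.
- split; first by move=> s _; have [] := dF s.
  + exact: (cvg_at_right_filter (cF 0)).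
  + exact: (cvg_at_left_filter (cF 1)).
- by move=> s _; rewrite derive1E; have [_] := dF s.
Qed.

Lemma Rintegral01_cst (c : R) : \I (fun=> c) = c.
Proof.
have D (s : R) : is_derive s 1 (fun s => c * s) c.
  by apply: is_derive_eq; rewrite /GRing.scale/= mulr1.
rewrite (Rintegral01_derive _ D) ?mulr1 ?mulr0 ?subr0// => s.
exact: cst_continuous.
Qed.

Lemma Rintegral01_norm_le (f : R -> R) (e : R) : continuous f ->
  (forall s, 0 <= s <= 1 -> `|f s| <= e) -> `|\I f| <= e.
Proof.
move=> cf fe; have fI := continuous_integrable01 cf.
apply: (@le_trans _ _ (\I (fun s => `|f s|))); first exact: le_normr_Rintegral.
rewrite -[leRHS]Rintegral01_cst.
apply: le_Rintegral => //.
- apply: (@continuous_integrable01 (fun s => `|f s|)) => s.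
  by apply: cvg_norm; exact: cf.
- by apply: continuous_integrable01 => s; exact: cst_continuous.
Qed.

Lemma Rintegral01_sum (I : Type) (r : seq I) (f : I -> R -> R) :
  (forall i, continuous (f i)) ->
  \I (fun s => \sum_(i <- r) f i s) = \sum_(i <- r) \I (f i).
Proof.
move=> cf; elim: r => [|i r IH].
  by under eq_Rintegral do rewrite big_nil; rewrite big_nil Rintegral01_cst.
under eq_Rintegral do rewrite big_cons.
rewrite big_cons -IH RintegralD//; first exact: continuous_integrable01.
by apply: continuous_integrable01 => s; apply: cvg_sumr => j; exact: cf.
Qed.

Variables (n : nat) (a : 'rV[R]_n).
Implicit Types (G : 'rV[R]_n -> R) (y : 'rV[R]_n).

(** The weight [s ^+ k] is there because each partial derivative in [y] brings out one factor [s]: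
    the family is closed under differentiation, [k] growing by one. *)
Definition ray_average (k : nat) G y : R :=
  \I (fun s => s ^+ k * G (s *: (y - a) + a)).

Lemma ray_continuous (x : R * 'rV[R]_n) :
  {for x, continuous (fun x : R * 'rV[R]_n => x.1 *: (x.2 - a) + a)}.
Proof.
apply: cvgD; last exact: cvg_cst.
apply: cvgZ; first exact: cvg_fst.
by apply: cvgB; [exact: cvg_snd|exact: cvg_cst].
Qed.

Lemma integrand_continuous k G : continuous G ->
  continuous (fun x : R * 'rV[R]_n => x.1 ^+ k * G (x.1 *: (x.2 - a) + a)).
Proof.
move=> cG x; apply: cvgM.
  apply: (@continuous_comp _ _ _ (fun x : R * 'rV[R]_n => x.1) (fun s => s ^+ k)).
    exact: cvg_fst.
  exact: exprn_continuous.
apply: (@continuous_comp _ _ _ (fun x : R * 'rV[R]_n => x.1 *: (x.2 - a) + a) G).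
  exact: ray_continuous.
exact: cG.
Qed.

Lemma integrand_continuousl k G y : continuous G ->
  continuous (fun s : R => s ^+ k * G (s *: (y - a) + a)).
Proof.
move=> cG s; apply: (@continuous_comp _ _ _ (fun s : R => (s, y))
  (fun x : R * 'rV[R]_n => x.1 ^+ k * G (x.1 *: (x.2 - a) + a))).
  exact: (cvg_pair cvg_id (cvg_cst y)).
exact: integrand_continuous.
Qed.

(** The integrand is jointly continuous, and compactness of the unit interval makes its variation in
    [y] uniform in [s]. *)
Lemma ray_average_continuous k G : continuous G -> continuous (ray_average k G).
Proof.
move=> cG y; apply/(@cvgrPdist_le _ _ _ (nbhs y)) => e e0.
have e20 : 0 < e / 2 by rewrite divr_gt0.
have /compact_near_coveringP cov := @segment_compact R 0 1.
pose g (s : R) z := s ^+ k * G (s *: (z - a) + a).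
have near_g : \forall z \near nbhs y, `[0, 1] `<=` (fun s => `|g s y - g s z| <= e).
  apply: (cov _ (nbhs y)) => s _.
  have /cvgrPdist_le/(_ _ e20) := @integrand_continuous k G cG (s, y).
  move=> [[A B] [/= nA nB] AB]; exists (A, B) => // -[t z] [/= At Bz].
  rewrite -(subrKA (g s y)) (le_trans (ler_normD _ _))// (splitr e) lerD//.
    by rewrite distrC; apply: (AB (t, y)); split => //; exact: nbhs_singleton.
  by apply: (AB (t, z)).
near=> z; have ez : `[0, 1] `<=` (fun s => `|g s y - g s z| <= e) by near: z.
rewrite /ray_average -RintegralB//;
  try by apply: continuous_integrable01; exact: integrand_continuousl.
apply: Rintegral01_norm_le => [s|s s01].
  by apply: cvgB; exact: integrand_continuousl.
by apply: ez; rewrite /= in_itv.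
Unshelve. all: by end_near. Qed.

Lemma continuous_bounded_ball G (r : R) : 0 <= r -> continuous G ->
  exists M, forall z, `|z - a| <= r -> `|G z| <= M.
Proof.
move=> r0 cG; pose A := [set z : 'rV[R]_n | `|z - a| <= r].
have cA : compact A by exact: closed_ball_compact.
have A0 : A !=set0 by exists a; rewrite /A/= subrr normr0.
have [|c _ cM] := @EVT_max_rV R n (fun z => `|G z|) A A0 cA.
  by apply: continuous_subspaceT => z; exact: (continuous_comp (cG z) (@norm_continuous _ _ _)).
by exists `|G c| => z Az; apply: cM; rewrite inE.
Qed.

Lemma ray_average_derive k G (i : 'I_n) y : continuous G ->
    (forall z, derivable G z 'e_i) -> continuous ('D_('e_i) G) ->
  is_derive y 'e_i (ray_average k G) (ray_average k.+1 ('D_('e_i) G) y).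
Proof.
move=> cG dG cDG.
pose f (x s : R) := s ^+ k * G (s *: (x *: 'e_i + y - a) + a).
have df (x s : R) : is_derive x 1 (f^~ s)
    (s ^+ k.+1 * 'D_('e_i) G (s *: (x *: 'e_i + y - a) + a)).
  have E z : s *: (z *: 'e_i + y - a) + a =
      (s * z) *: 'e_i + (s *: (y - a) + a).
    by rewrite -addrA scalerDr scalerA addrA.
  have D := is_derive_line (dG ((s * x) *: 'e_i + (s *: (y - a) + a))).
  have L : is_derive x 1 (fun z : R => s * z) s.
    by apply: is_derive_eq; rewrite /GRing.scale/= mulr1.
  have -> : f^~ s = (fun=> s ^+ k) *
      ((fun z => G (z *: 'e_i + (s *: (y - a) + a))) \o (fun z : R => s * z)).
    by apply/funext => z; rewrite /f E.
  apply: (is_derive_eq (is_deriveM _ (is_derive1_comp D L))).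
  by rewrite E /GRing.scale/= mulr0 addr0 exprS; ring.
(* For steps of size at most [1] and [s] in the unit interval the ray stays within this distance of
   [a], so the constant [M] dominates the derivative of the integrand. *)
have [M GM] := @continuous_bounded_ball _ (`|'e_i : 'rV[R]_n| + `|y - a|)
  (addr_ge0 (normr_ge0 _) (normr_ge0 _)) cDG.
have M0 : 0 <= M by apply: le_trans (GM a _); rewrite ?subrr ?normr0 ?addr_ge0.
have p1 x s : partial1of2 f x s =
    s ^+ k.+1 * 'D_('e_i) G (s *: (x *: 'e_i + y - a) + a).
  by rewrite partial1of2E; have [_] := df x s.
have C := @cvg_differentiation_under_integral R _ _ mu f `[0%R, 1%R] _ 0 (-1) 1
  _ _ _ (fun=> M) _ _ _.
have H : (fun h : R => h^-1 *: (ray_average k G (h *: 'e_i + y) - ray_average k G y))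
   @ 0^' --> ray_average k.+1 ('D_('e_i) G) y.
  have -> : ray_average k.+1 ('D_('e_i) G) y = \I (partial1of2 f 0).
    by apply: eq_Rintegral => s _; rewrite p1 scale0r add0r.
  have -> : (fun h : R => h^-1 *: (ray_average k G (h *: 'e_i + y) - ray_average k G y)) =
    (fun h => h^-1 *: (\I (f (h + 0)) - \I (f 0))).
    apply/funext => h; rewrite addr0.
    have E (z : R) : ray_average k G (z *: 'e_i + y) = \I (f z) by [].
    by rewrite E -[in LHS](add0r y) -{1}(scale0r 'e_i) E.
  apply: C.
  - exact: measurable_itv.
  - by rewrite /= in_itv/= ltrN10 ltr01.
  - by move=> x _; apply: continuous_integrable01; exact: integrand_continuousl.
  - by move=> x s _ _; have [] := df x s.
  - by move=> ?.
  - by apply: continuous_integrable01 => s; exact: cst_continuous.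
  - move=> x s /=; rewrite !in_itv/= => /andP[x1 x2] /andP[s0 s1].
    rewrite p1 normrM -[leRHS]mul1r ler_pM//.
      by rewrite ger0_norm ?exprn_ge0// exprn_ile1.
    apply: GM; rewrite addrK normrZ (ger0_norm s0) -addrA.
    rewrite -[leRHS]mul1r ler_pM// (le_trans (ler_normD _ _))// lerD2r normrZ.
    by rewrite -[leRHS]mul1r ler_pM// ler_norml !ltW.
by apply: DeriveDef; [apply/cvg_ex; eexists; exact: H|exact: (cvg_lim _ H)].
Qed.

Lemma Cinfty_ray_average k G : Cinfty_on setT G -> Cinfty_on setT (ray_average k G).
Proof.
have cont G' : Cinfty_on setT G' -> continuous G'.
  by move=> GC x; exact: (Cinfty_on_continuous GC).
move=> GC; apply/Cinfty_onP => r; elim: r k G GC => [|r IH] k G GC;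
  (split; first by move=> x _; apply: ray_average_continuous; exact: cont) => // i.
have D y : is_derive y 'e_i (ray_average k G) (ray_average k.+1 ('D_('e_i) G) y).
  apply: ray_average_derive => [|z|]; first exact: cont.
  - exact: (Cinfty_on_derivable GC).
  - exact/cont/Cinfty_on_partial.
split=> [x _|]; first by have [] := D x.
apply: (Cr_congr openT _ (IH k.+1 _ (Cinfty_on_partial i GC))) => x _.
by have [_ ->] := D x.
Qed.

(** [G y - G a] is the integral of the derivative of [G] along the segment from [a] to [y]; the
    coordinate differences come out of the integral and averages of the partials remain. *)
Lemma hadamard G : Cinfty_on setT G ->
  exists2 H : 'I_n -> 'rV[R]_n -> R, forall i, Cinfty_on setT (H i) &
    forall y, G y = G a + \sum_i (y 0 i - a 0 i) * H i y.
Proof.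
move=> GC; exists (fun i => ray_average 0 ('D_('e_i) G)) => [i|y].
  exact/Cinfty_ray_average/Cinfty_on_partial.
have cont G' : Cinfty_on setT G' -> continuous G'.
  by move=> GC' x; exact: (Cinfty_on_continuous GC').
have cDG i : continuous ('D_('e_i) G) by exact/cont/Cinfty_on_partial.
have cray i : continuous (fun s : R => 'D_('e_i) G (s *: (y - a) + a)).
  move=> s; have := @integrand_continuousl 0 _ y (cDG i) s.
  by under eq_fun do rewrite expr0 mul1r.
rewrite /ray_average.
have -> : \sum_i (y 0 i - a 0 i) *
    (\I (fun s => s ^+ 0 * 'D_('e_i) G (s *: (y - a) + a))) =
  \I (fun s => \sum_i (y 0 i - a 0 i) * 'D_('e_i) G (s *: (y - a) + a)).
  rewrite Rintegral01_sum; last first.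
    by move=> i s; apply: cvgM; [exact: cvg_cst|exact: cray].
  apply: eq_bigr => i _; rewrite RintegralZl//; last exact: continuous_integrable01.
  by congr (_ * _); apply: eq_Rintegral => s _; rewrite expr0 mul1r.
have D (s : R) : is_derive s 1 (fun s => G (s *: (y - a) + a))
    (\sum_i (y 0 i - a 0 i) * 'D_('e_i) G (s *: (y - a) + a)).
  have dG : derivable G (s *: (y - a) + a) (y - a) /\ 'D_(y - a) G (s *: (y - a) + a) =
     \sum_i (y 0 i - a 0 i) * 'D_('e_i) G (s *: (y - a) + a).
    (* The chain rule with the identity as inner map expands a directional derivative into
       partials. *)
    have [||||d e] := @is_derive_comp R n n G id (s *: (y - a) + a) (y - a).
    - move=> i; apply: (@filterE _ (nbhs (s *: (y - a) + a))) => z.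
      exact: (Cinfty_on_derivable GC).
    - by move=> i; exact: cDG.
    - exact: cvg_id.
    - by move=> i; have [] := is_derive_coord i (s *: (y - a) + a) (y - a).
    split=> //; apply: (etrans e); apply: eq_bigr => i _.
    have [_ ->] := is_derive_coord i (s *: (y - a) + a) (y - a).
    by rewrite !mxE mulrC.
  by rewrite -dG.2; exact: is_derive_line dG.1.
rewrite (Rintegral01_derive _ D).
  by rewrite scale1r subrK scale0r add0r addrC subrK.
by move=> s; apply: cvg_sumr => i; apply: cvgM; [exact: cvg_cst|exact: cray].
Qed.

End Hadamard.

(** * Extension of smooth germs to the whole of R^n *)

Section Extension.
Context {R : realType} {n : nat}.

Lemma step_sqr_near (t : R) (e : R) : 0 < e -> `|t| <= e ->
  smooth_step (2 - (t / e) ^+ 2) = 1.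
Proof.
move=> e0 te; apply: smooth_step1.
have h : (t / e) ^+ 2 <= 1.
  rewrite -real_normK ?num_real// expr_le1// normrM normfV (gtr0_norm e0).
  by rewrite ler_pdivrMr// mul1r.
by move: h; set x := (_ ^+ 2) => h; lra.
Qed.

Lemma step_sqr_far (t : R) (e : R) : 0 < e -> 2 * e <= `|t| ->
  smooth_step (2 - (t / e) ^+ 2) = 0.
Proof.
move=> e0 te; apply: smooth_step0.
rewrite subr_le0 -real_normK ?num_real//.
have h : 2 <= `|t / e| by rewrite normrM normfV (gtr0_norm e0) ler_pdivlMr.
by move: h; set x := `|_| => h; nra.
Qed.

(** Charts and inverses yield functions that are smooth on an open set only, whereas [smooth_at]
    asks for one on all of [R^k]. A product of one-variable steps cuts [F] off inside [V] and leaves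
    its germ at [a] alone. *)
Lemma Cinfty_extend (V : set 'rV[R]_n) (a : 'rV[R]_n) (F : 'rV[R]_n -> R) :
  open V -> V a -> Cinfty_on V F ->
  exists2 F', Cinfty_on setT F' & \forall y \near a, F' y = F y.
Proof.
move=> oV Va FC; have := open_nbhs_nbhs (conj oV Va).
move=> /nbhs_ballP[d /= d0]; rewrite -ball_normE => dV.
(* The cutoff is [1] when all coordinates are within [e] of [a], and [0] once some coordinate is
   [2 * e] away. As [2 * e < d], the set [V] and the exterior [W] of the closed ball of radius
   [2 * e] cover the space. *)
pose e := d / 4; have e0 : 0 < e by rewrite divr_gt0.
have de : d = 4 * e by rewrite /e; field.
pose chi (y : 'rV[R]_n) := \prod_i smooth_step (2 - ((y 0 i - a 0 i) / e) ^+ 2).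
have chiC : Cinfty_on setT chi.
  apply: (Cinfty_on_prod openT) => i; apply: (Cinfty_on_step openT).
  have C := Cinfty_onM openT (Cinfty_onB openT (Cinfty_on_coord i)
    (Cinfty_on_cst (a 0 i))) (Cinfty_on_cst e^-1).
  exact: (Cinfty_onB openT (Cinfty_on_cst 2) (Cinfty_onM openT C C)).
pose F' y := if pselect (V y) then chi y * F y else 0.
have FV : Cinfty_on V F'.
  apply: (Cinfty_on_congr oV _ (Cinfty_onM oV (Cinfty_on_sub _ chiC) FC)) => //.
  by move=> x Vx; rewrite /F'; case: pselect.
pose W := [set y : 'rV[R]_n | ~ closed_ball_ Num.norm a (2 * e) y].
have oW : open W.
  by rewrite -[W]/(~` closed_ball_ Num.norm a (2 * e)) openC; exact: closed_closed_ball_.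
have FW : Cinfty_on W F'.
  apply: (Cinfty_on_congr oW _ (Cinfty_on_cst 0)) => y Wy.
  rewrite /F'; case: pselect => // Vy; suff -> : chi y = 0 by rewrite mul0r.
  have [/existsP[i yi]|/existsPn far] := boolP [exists i, 2 * e <= `|y 0 i - a 0 i|].
    by rewrite /chi (bigD1 i)//= step_sqr_far// mul0r.
  exfalso; apply: Wy; rewrite /closed_ball_/= distrC ltW// norm_rV_lt// ?mulr_gt0//.
  by move=> i; rewrite !mxE ltNge.
exists F'.
  move=> s y _; have [Vy|nVy] := pselect (V y); first exact: FV.
  apply: FW => yB; apply: nVy; apply: dV; apply: le_lt_trans yB _.
  by rewrite de ltr_pM2r// ltr_nat.
have aB : nbhs a (ball a e) by exact: nbhsx_ballx.
apply: filterS aB => y; rewrite -ball_normE/= => ye.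
have Vy : V y by apply: dV; rewrite /= (lt_le_trans ye)// de ler_peMl ?ltW// ltr1n.
rewrite /F'; case: pselect => // ?; rewrite /chi big1 ?mul1r// => i _.
rewrite step_sqr_near//; apply: le_trans (ltW ye); rewrite [leRHS]distrC.
by have := norm_rV_coord (y - a) i; rewrite !mxE.
Qed.

End Extension.

(** * Smooth spaces and derivations *)

Section SpaceTopology.
Context {R : realType} {T : Type} (S : set (T -> R)).

Lemma space_of_continuous (g : T -> R) : S g -> continuous (g : space_of S -> R).
Proof.
move=> Sg x; pose i : {g : T -> R | S g} := exist _ g Sg.
have c1 := @initial_continuous {classic T} {ptws {g : T -> R | S g} -> R}
  (eval_gens (S := S)) x.
have c2 : (fun f : {ptws {g : T -> R | S g} -> R} => f i) @
    (nbhs (eval_gens (S := S) x)) --> eval_gens (S := S) x i.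
  have /cvg_sup/(_ i) h : nbhs (eval_gens (S := S) x) --> eval_gens (S := S) x by exact: cvg_id.
  move=> A nA; apply: h.
  apply: (@initial_continuous _ R (fun f : (forall _ : {g : T -> R | S g}, R) => f i)).
  exact: nA.
exact: (cvg_comp _ _ c1 c2).
Qed.

Lemma space_of_cvg (F : set_system T) (p : space_of S) : Filter F ->
  (forall g, S g -> g x @[x --> F] --> g p) -> F --> (p : space_of S).
Proof.
move=> FF cF A [_ [[B oB <-] Bp BA]].
have : (eval_gens (S := S) @ F) --> eval_gens (S := S) p.
  apply/cvg_sup => -[g Sg] C [_ [[D oD <-] Dp DC]].
  have := cF g Sg D (open_nbhs_nbhs (conj oD Dp)).
  by move=> FD; apply: (@filterS _ F FF _ _ _ FD) => x Dx; apply: DC.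
move=> /(_ B (open_nbhs_nbhs (conj oB Bp))).
by move=> FB; exact: (@filterS _ _ FF _ _ BA FB).
Qed.
End SpaceTopology.

Section SmoothFunctions.
Context {R : realType} {T : Type} (S : set (T -> R)).
Local Notation X := (space_of S).
Implicit Types (f g h : T -> R) (p x : T) (U : set X).

Lemma smooth_atP f p : smooth_at S f p <->
  exists (k : nat) (g : 'I_k -> T -> R) (F : 'rV[R]_k -> R),
    [/\ forall i, S (g i), Cinfty_on setT F &
        \forall x \near (p : X), f x = F (\row_i g i x)].
Proof.
split=> [[U [k [g [F [[oU Up] Sg FC E]]]]]|[k [g [F [Sg FC]]]]].
  exists k, g, F; split=> //; apply: filterS (open_nbhs_nbhs (conj oU Up)).
  by move=> x; exact: E.
move=> [U [oU Up] UE]; exists U, k, g, F; split=> //; exact: UE.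
Qed.

Lemma smooth_at_congr f g p : (\forall x \near (p : X), f x = g x) ->
  smooth_at S f p -> smooth_at S g p.
Proof.
move=> fg /smooth_atP[k [u [F [Su FC E]]]]; apply/smooth_atP.
exists k, u, F; split=> //; near=> x.
by rewrite -(near fg x)//; near: x.
Unshelve. all: by end_near. Qed.

Lemma smooth_at_continuous f p : smooth_at S f p -> {for p, continuous (f : X -> R)}.
Proof.
move=> /smooth_atP[k [g [F [Sg FC E]]]].
have c1 : {for p, continuous (fun x : X => \row_i g i x)}.
  apply: (@cvg_row _ _ (nbhs (p : X))) => i; rewrite mxE.
  under eq_fun do rewrite mxE.
  by apply: space_of_continuous.
have c2 := continuous_comp c1 (Cinfty_on_continuous FC I).
rewrite /prop_for /continuous_at (nbhs_singleton E).
have nE : {near nbhs (p : X), F \o (fun x : X => \row_i g i x) =1 f}.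
  by apply: filterS E => x xE; rewrite /= xE.
exact: cvg_trans (near_eq_cvg nE) c2.
Qed.

(** The source of the closure properties of smooth functions. Each [u i] is locally a function of
    finitely many generators; pooling these over [i] exhibits [h] as a function of a single finite
    family. *)
Lemma smooth_at_comp_near k (u : 'I_k -> T -> R) (V : set 'rV[R]_k) F h p :
  (forall i, smooth_at S (u i) p) -> open V -> V (\row_i u i p) -> Cinfty_on V F ->
  (\forall x \near (p : X), h x = F (\row_i u i x)) -> smooth_at S h p.
Proof.
move=> us oV Vp FC hF.
have [F' F'C FF'] := Cinfty_extend oV Vp FC.
have cu : {for p, continuous (fun x : X => \row_i u i x)}.
  apply: (@cvg_row _ _ (nbhs (p : X))) => i; rewrite mxE.
  under eq_fun do rewrite mxE.
  exact: smooth_at_continuous.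
have {}hF : \forall x \near (p : X), h x = F' (\row_i u i x).
  have := cu _ FF'; rewrite /= => FF; near=> x.
  by rewrite (near hF x)//; apply/esym; near: x.
have /choice[D HD] i : exists D : {k : nat & ('I_k -> T -> R) * ('rV[R]_k -> R)}%type,
    [/\ forall j, S ((projT2 D).1 j), Cinfty_on setT (projT2 D).2 &
        \forall x \near (p : X), u i x = (projT2 D).2 (\row_j (projT2 D).1 j x)].
  by have /smooth_atP[l [g [G [Sg GC E]]]] := us i; exists (existT _ l (g, G)).
(* A pooled generator is a pair of an index [i] and a generator used by [u i]; [sel i] extracts the
   block of [i] from the pooled coordinates. *)
pose I := {i : 'I_k & 'I_(projT1 (D i))}.
pose g (e : 'I_#|{: I}|) := (projT2 (D (tag (enum_val e)))).1 (tagged (enum_val e)).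
pose sel i (y : 'rV[R]_#|{: I}|) : 'rV[R]_(projT1 (D i)) :=
  \row_j y 0 (enum_rank (Tagged (fun i => 'I_(projT1 (D i))) j)).
pose G (y : 'rV[R]_#|{: I}|) := F' (\row_i (projT2 (D i)).2 (sel i y)).
have selC i : Cinfty_on setT (fun y => (projT2 (D i)).2 (sel i y)).
  have [_ DC _] := HD i.
  apply: (Cinfty_on_comp openT openT) DC => // j.
  apply: (Cinfty_on_congr openT _ (Cinfty_on_coord _)) => y _.
  by rewrite mxE.
apply/smooth_atP; exists #|{: I}|, g, G; split.
- by move=> e; have [+ _ _] := HD (tag (enum_val e)); exact.
- apply: (Cinfty_on_comp openT openT) F'C => // i.
  by apply: (Cinfty_on_congr openT _ (selC i)) => y _; rewrite mxE.
have uE : \forall x \near (p : X), forall i, u i x = (projT2 (D i)).2 (\row_j (projT2 (D i)).1 j x).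
  by apply: (@filter_forall _ _ _ (nbhs (p : X))) => i; have [] := HD i.
near=> x; rewrite (near hF x)// /G; congr (F' _); apply/rowP => i; rewrite !mxE.
rewrite (near uE x)//; congr ((projT2 (D i)).2 _); apply/rowP => j; rewrite !mxE.
by rewrite /g enum_rankK.
Unshelve. all: by end_near. Qed.

Lemma smooth_at_comp k (u : 'I_k -> T -> R) (V : set 'rV[R]_k) F p :
  (forall i, smooth_at S (u i) p) -> open V -> V (\row_i u i p) -> Cinfty_on V F ->
  smooth_at S (fun x => F (\row_i u i x)) p.
Proof.
move=> us oV Vp FC; apply: (smooth_at_comp_near us oV Vp FC).
exact: filterE.
Qed.

Lemma smooth_at_gen g p : S g -> smooth_at S g p.
Proof.
move=> Sg; apply/smooth_atP; exists 1, (fun=> g), (fun y => y 0 0); split=> //.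
  exact: Cinfty_on_coord.
by apply: filterE => x; rewrite mxE.
Qed.

Lemma smooth_at_cst (c : R) p : smooth_at S (fun=> c) p.
Proof.
apply/smooth_atP; exists 0, (fun i _ => 0), (fun=> c); split=> [[]||]//.
  exact: Cinfty_on_cst.
exact: filterE.
Qed.

Lemma smooth_atD f g p : smooth_at S f p -> smooth_at S g p ->
  smooth_at S (fun x => f x + g x) p.
Proof.
move=> fp gp; pose u (i : 'I_2) := if i == 0 then f else g.
have H := Cinfty_onD openT (@Cinfty_on_coord R 2 setT 0) (@Cinfty_on_coord R 2 setT 1).
apply: (@smooth_at_comp_near _ u setT _ _ _ _ openT I H).
  by move=> i; rewrite /u; case: ifP.
by apply: filterE => x; rewrite !mxE.
Qed.

Lemma smooth_atM f g p : smooth_at S f p -> smooth_at S g p ->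
  smooth_at S (fun x => f x * g x) p.
Proof.
move=> fp gp; pose u (i : 'I_2) := if i == 0 then f else g.
have H := Cinfty_onM openT (@Cinfty_on_coord R 2 setT 0) (@Cinfty_on_coord R 2 setT 1).
apply: (@smooth_at_comp_near _ u setT _ _ _ _ openT I H).
  by move=> i; rewrite /u; case: ifP.
by apply: filterE => x; rewrite !mxE.
Qed.

Lemma smooth_atV f p : f p != 0 -> smooth_at S f p -> smooth_at S (fun x => (f x)^-1) p.
Proof.
move=> f0 fp; pose V := [set y : 'rV[R]_1 | y 0 0 != 0].
have oV : open V.
  rewrite -[V]/((fun y : 'rV[R]_1 => y 0 0) @^-1` [set t | t != 0]).
  by apply: open_comp; [move=> y _; exact: coord_continuous|exact: open_neq].
have H : Cinfty_on V (fun y => (y 0 0)^-1).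
  by apply: Cinfty_onV => //; exact: Cinfty_on_coord.
apply: (@smooth_at_comp_near _ (fun=> f) V _ _ _ _ oV _ H) => //.
  by rewrite /V/= mxE.
by apply: filterE => x; rewrite !mxE.
Qed.

Lemma smooth_at_sum (I : Type) (s : seq I) (f : I -> T -> R) p :
  (forall i, smooth_at S (f i) p) -> smooth_at S (fun x => \sum_(i <- s) f i x) p.
Proof.
move=> fp; elim: s => [|i s IH].
  by under eq_fun do rewrite big_nil; exact: smooth_at_cst.
by under eq_fun do rewrite big_cons; exact: smooth_atD.
Qed.

Lemma smooth_at_prod (I : Type) (s : seq I) (f : I -> T -> R) p :
  (forall i, smooth_at S (f i) p) -> smooth_at S (fun x => \prod_(i <- s) f i x) p.
Proof.
move=> fp; elim: s => [|i s IH].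
  by under eq_fun do rewrite big_nil; exact: smooth_at_cst.
by under eq_fun do rewrite big_cons; exact: smooth_atM.
Qed.

Lemma smooth_gen g : S g -> smooth S g.
Proof. by move=> Sg p; exact: smooth_at_gen. Qed.

Lemma smooth_cst (c : R) : smooth S (fun=> c).
Proof. by move=> p; exact: smooth_at_cst. Qed.

Lemma smoothD f g : smooth S f -> smooth S g -> smooth S (fun x => f x + g x).
Proof. by move=> fs gs p; exact: smooth_atD. Qed.

Lemma smoothM f g : smooth S f -> smooth S g -> smooth S (fun x => f x * g x).
Proof. by move=> fs gs p; exact: smooth_atM. Qed.

Lemma smooth_sum (I : Type) (s : seq I) (f : I -> T -> R) :
  (forall i, smooth S (f i)) -> smooth S (fun x => \sum_(i <- s) f i x).
Proof. by move=> fs p; apply: smooth_at_sum => i; exact: fs. Qed.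

Lemma smoothB f g : smooth S f -> smooth S g -> smooth S (fun x => f x - g x).
Proof.
move=> fs gs; have := smoothD fs (smoothM (smooth_cst (-1)) gs).
by under eq_fun do rewrite mulN1r.
Qed.

Lemma smooth_comp k (u : 'I_k -> T -> R) F :
  (forall i, smooth S (u i)) -> Cinfty_on setT F -> smooth S (fun x => F (\row_i u i x)).
Proof. by move=> us FC p; exact: (smooth_at_comp (fun i => us i p) openT I FC). Qed.

Lemma smooth_continuous f : smooth S f -> continuous (f : X -> R).
Proof. by move=> fs p; exact: smooth_at_continuous. Qed.

(** The supersets of such boxes form a filter along which every generator converges to its value at
    [p]; in the initial topology that is convergence to [p], so each neighbourhood contains a
    box. *)
Lemma nbhs_gens p (U : set X) : nbhs (p : X) U ->
  exists (k : nat) (g : 'I_k -> T -> R) (e : R), [/\ 0 < e, forall i, S (g i) &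
    forall x, (forall i, `|g i x - g i p| < e) -> U x].
Proof.
pose F : set_system T := [set A | exists (k : nat) (g : 'I_k -> T -> R) (e : R),
  [/\ 0 < e, forall i, S (g i) & forall x, (forall i, `|g i x - g i p| < e) -> A x]].
have FF : Filter F.
  split.
  - by exists 0, (fun i _ => 0), 1; split=> // -[].
  - move=> A B [k1 [g1 [e1 [e10 Sg1 H1]]]] [k2 [g2 [e2 [e20 Sg2 H2]]]].
    pose g (i : 'I_(k1 + k2)) := match fintype.split i with inl j => g1 j | inr j => g2 j end.
    exists (k1 + k2)%N, g, (Num.min e1 e2); split.
    + by rewrite lt_min e10.
    + by move=> i; rewrite /g; case: fintype.split.
    + move=> x gx; split; [apply: H1 => i|apply: H2 => i].
        have := gx (lshift k2 i); rewrite /g (unsplitK (inl i)).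
        by rewrite lt_min => /andP[].
      have := gx (rshift k1 i); rewrite /g (unsplitK (inr i)).
      by rewrite lt_min => /andP[].
  - move=> A B AB [k [g [e [e0 Sg H]]]]; exists k, g, e; split=> // x /H.
    exact: AB.
apply: (@space_of_cvg _ _ S F p FF) => g Sg; apply/cvgrPdist_lt => e e0.
exists 1, (fun=> g), e; split=> // x /(_ 0).
by rewrite distrC.
Qed.

(** Made from generators alone, hence available on spaces without charts. The last clause is what
    keeps the product with [chi] of something smooth on [U] smooth after extension by zero. *)
Lemma smooth_bump p (U : set X) : nbhs (p : X) U ->
  exists chi : T -> R, [/\ smooth S chi, \forall x \near (p : X), chi x = 1 &
    forall x, U x \/ \forall y \near (x : X), chi y = 0].
Proof.
move=> /nbhs_gens[k [g [d [d0 Sg dU]]]].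
(* Outside the box some generator is off by at least [3 * e]; nearby points lose at most [e] and
   keep [2 * e], where the step is zero. *)
pose e := d / 3; have e0 : 0 < e by rewrite divr_gt0.
pose F i (t : R) := smooth_step (2 - ((t - g i p) / e) ^+ 2).
pose chi x := \prod_i F i (g i x).
have cg i : continuous (g i : X -> R) by exact: space_of_continuous.
exists chi; split.
- move=> x; apply: smooth_at_prod => i.
  have FC : Cinfty_on setT (fun y : 'rV[R]_1 => F i (y 0 0)).
    apply: (Cinfty_on_step openT).
    have C := Cinfty_onM openT (Cinfty_onB openT (@Cinfty_on_coord _ 1 setT 0)
      (Cinfty_on_cst (g i p))) (Cinfty_on_cst e^-1).
    exact: (Cinfty_onB openT (Cinfty_on_cst 2) (Cinfty_onM openT C C)).
  apply: (smooth_at_comp_near (u := fun=> g i)) FC _ => //.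
  - by move=> _; exact: smooth_at_gen.
  - exact: openT.
  - by apply: filterE => y; rewrite mxE.
- have near_g : \forall x \near (p : X), forall i, `|g i p - g i x| < e.
    apply: (@filter_forall _ _ _ (nbhs (p : X))) => i.
    by move/cvgrPdist_lt : (cg i p); exact.
  apply: filterS near_g => x gx; rewrite /chi big1// => i _.
  by rewrite /F step_sqr_near// distrC ltW.
- move=> x; have [/dU|] := pselect (forall i, `|g i x - g i p| < d); first by left.
  move=> /existsNP[i /negP]; rewrite -leNgt => gi; right.
  have : \forall y \near (x : X), `|g i x - g i y| < e.
    by move/cvgrPdist_lt : (cg i x); exact.
  apply: filterS => y gy; rewrite /chi (bigD1 i)//= /F step_sqr_far ?mul0r//.
  have := ler_normD (g i x - g i y) (g i y - g i p); rewrite subrKA => h.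
  have de : d = 3 * e by rewrite /e; field.
  by lra.
Qed.

Lemma smooth_globalize f p : smooth_at S f p ->
  exists2 f', smooth S f' & \forall x \near (p : X), f' x = f x.
Proof.
move=> /smooth_atP[k [g [F [Sg FC E]]]].
exists (fun x => F (\row_i g i x)); last by apply: filterS E => x ->.
by apply: smooth_comp FC => i; exact: smooth_gen.
Qed.

End SmoothFunctions.

Section DefiniteDescription.

Lemma the_unique (T : Type) (x0 : T) (P : set T) (a : T) :
  P a -> (forall b, P b -> b = a) -> the x0 P = a.
Proof. by move=> Pa uP; apply: uP; exact: (@xgetPex {classic T} x0 P (ex_intro _ a Pa)). Qed.

Lemma the_ind (T : Type) (x0 : T) (P : set T) : (exists x, P x) -> P (the x0 P).
Proof. by move=> Px; exact: (@xgetPex {classic T} x0 P Px). Qed.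

Lemma the_cases (T : Type) (x0 : T) (P : set T) : P (the x0 P) \/ the x0 P = x0.
Proof.
have [Px|nP] := pselect (exists x, P x); [left; exact: the_ind|right].
by apply: (@xgetPN {classic T}) => x Px; apply: nP; exists x.
Qed.

End DefiniteDescription.

(** * Derivations, vector fields and exterior derivatives of one-forms *)

Section TangentVectors.
Context {R : realType} {T : Type} (S : set (T -> R)).
Local Notation X := (space_of S).
Implicit Types (f g h : T -> R) (p q : T) (u v w : vec (R := R) T).

Section Derivation.
Variables (p : T) (v : vec (R := R) T).
Hypothesis Tv : tangent S p v.

Lemma tangentD f g : smooth S f -> smooth S g -> v (fun x => f x + g x) = v f + v g.
Proof.
move=> fs gs; have [_ lin _] := Tv; have := lin 1 f g fs gs.
by under eq_fun do rewrite mul1r; rewrite mul1r.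
Qed.

Lemma tangentM f g : smooth S f -> smooth S g ->
  v (fun x => f x * g x) = v f * g p + f p * v g.
Proof. by have [_ _] := Tv; exact. Qed.

Lemma tangent_cst (c : R) : v (fun=> c) = 0.
Proof.
have [_ lin lei] := Tv.
have v1 : v (fun=> 1) = 0.
  have := lei (fun=> 1) (fun=> 1) (smooth_cst S 1) (smooth_cst S 1).
  by under eq_fun do rewrite mul1r; move=> h; lra.
have v0 : v (fun=> 0) = 0.
  have := lin 1 (fun=> 0) (fun=> 0) (smooth_cst S 0) (smooth_cst S 0).
  by under eq_fun do rewrite mul1r addr0; move=> h; lra.
have := lin c (fun=> 1) (fun=> 0) (smooth_cst S 1) (smooth_cst S 0).
by under eq_fun do rewrite mulr1 addr0; rewrite v1 v0 => ->; ring.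
Qed.

Lemma tangentZ (c : R) f : smooth S f -> v (fun x => c * f x) = c * v f.
Proof.
move=> fs; rewrite tangentM//; last exact: smooth_cst.
by rewrite tangent_cst mul0r add0r.
Qed.

Lemma tangentB f g : smooth S f -> smooth S g -> v (fun x => f x - g x) = v f - v g.
Proof.
move=> fs gs; have [_ lin _] := Tv; have := lin (-1) g f gs fs.
by under eq_fun do rewrite mulN1r addrC; rewrite mulN1r addrC.
Qed.

Lemma tangent_sum (I : Type) (s : seq I) (f : I -> T -> R) : (forall i, smooth S (f i)) ->
  v (fun x => \sum_(i <- s) f i x) = \sum_(i <- s) v (f i).
Proof.
move=> fs; elim: s => [|i s IH].
  by under eq_fun do rewrite big_nil; rewrite big_nil tangent_cst.
under eq_fun do rewrite big_cons; rewrite big_cons tangentD ?IH//.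
exact: smooth_sum.
Qed.

(** With [chi] supported where [f = g] and equal to [1] at [p], the product [chi * (f - g)] is
    identically zero, and the Leibniz rule at [p] leaves [v (f - g)]. *)
Lemma tangent_local f g : smooth S f -> smooth S g ->
  (\forall x \near (p : X), f x = g x) -> v f = v g.
Proof.
move=> fs gs fg; have [chi [chis chi1 chi0]] := smooth_bump fg.
have hs := smoothB fs gs.
have E : (fun x => chi x * (f x - g x)) = fun=> 0.
  apply/funext => x; case: (chi0 x) => [->|/nbhs_singleton ->].
    by rewrite subrr mulr0.
  by rewrite mul0r.
have := tangentM chis hs; rewrite E tangent_cst tangentB//.
by rewrite (nbhs_singleton chi1) (nbhs_singleton fg) subrr => h; lra.
Qed.

(* Hadamard's lemma reduces the chain rule for derivations to the Leibniz rule. *)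
Lemma tangent_chain k (u : 'I_k -> T -> R) (V : set 'rV[R]_k) F h :
  (forall i, smooth S (u i)) -> smooth S h -> open V -> V (\row_i u i p) ->
  Cinfty_on V F -> (\forall x \near (p : X), h x = F (\row_i u i x)) ->
  v h = \sum_i 'D_('e_i) F (\row_i u i p) * v (u i).
Proof.
move=> us hs oV Vp FC hF; have [F' F'C FF'] := Cinfty_extend oV Vp FC.
set a := \row_i u i p.
have cu : {for p, continuous (fun x : X => \row_i u i x)}.
  apply: (@cvg_row _ _ (nbhs (p : X))) => i; rewrite mxE.
  by under eq_fun do rewrite mxE; exact: smooth_continuous.
have {}hF : \forall x \near (p : X), h x = F' (\row_i u i x).
  have := cu _ FF'; rewrite /= => FF; near=> x.
  by rewrite (near hF x)//; apply/esym; near: x.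
have DF i : 'D_('e_i) F a = 'D_('e_i) F' a.
  by apply: near_eq_derive; apply: filterS FF' => y ->.
have [H HC HE] := hadamard a F'C.
have H's i : smooth S (fun x => H i (\row_j u j x)) by exact: smooth_comp.
have uas i : smooth S (fun x => u i x - a 0 i) by apply: smoothB => //; exact: smooth_cst.
have Ha i : 'D_('e_i) F' a = H i a.
  have -> : F' = (fun y : 'rV[R]_k => F' a + \sum_j (y 0 j - a 0 j) * H j y).
    by apply/funext => y; exact: HE.
  have D j : is_derive a 'e_i (fun y : 'rV[R]_k => (y 0 j - a 0 j) * H j y) ((j == i)%:R * H i a).
    have D1 : is_derive a 'e_i (fun y : 'rV[R]_k => y 0 j - a 0 j) (j == i)%:R.
      have Dc := is_derive_coord j a 'e_i.
      by apply: is_derive_eq; rewrite !mxE subr0 eqxx.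
    have D2 : is_derive a 'e_i (H j) ('D_('e_i) (H j) a).
      by apply: DeriveDef => //; exact: (Cinfty_on_derivable (HC j)).
    apply: (is_derive_eq (is_deriveM D1 D2)).
    by rewrite subrr scale0r add0r /GRing.scale/= mulrC; case: eqP => [->|]; rewrite ?mul0r.
  have -> : (fun y : 'rV[R]_k => F' a + \sum_j (y 0 j - a 0 j) * H j y) =
      cst (F' a) + \sum_j (fun y : 'rV[R]_k => (y 0 j - a 0 j) * H j y).
    by apply/funext => y; rewrite /= !fctE; congr (_ + _); rewrite fct_sumE.
  have dS : derivable (\sum_j (fun y : 'rV[R]_k => (y 0 j - a 0 j) * H j y)) a 'e_i.
    by apply: derivable_sum => j; have [] := D j.
  rewrite (deriveD (derivable_cst _ _ _) dS).
  rewrite derive_cst add0r derive_sum; last by move=> j; have [] := D j.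
  rewrite (bigD1 i)//= big1; last by move=> j ji; have [_ ->] := D j; rewrite (negPf ji) mul0r.
  by have [_ ->] := D i; rewrite eqxx mul1r addr0.
have -> : v h = v (fun x => F' a + \sum_i (u i x - a 0 i) * H i (\row_j u j x)).
  apply: tangent_local => //.
    apply: smoothD; first exact: smooth_cst.
    by apply: smooth_sum => i; exact: smoothM.
  apply: filterS hF => x ->; rewrite HE; congr (_ + _).
  by apply: eq_bigr => i _; rewrite mxE.
have Ms i := smoothM (uas i) (H's i).
rewrite tangentD; [|exact: smooth_cst|exact: smooth_sum].
rewrite tangent_cst add0r tangent_sum//; apply: eq_bigr => i _.
rewrite tangentM// tangentB//; last exact: smooth_cst.
by rewrite tangent_cst mxE subrr mul0r !addr0 subr0 DF Ha mulrC.
Unshelve. all: by end_near. Qed.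

End Derivation.

Lemma tangent_ext p u v : tangent S p u -> tangent S p v ->
  (forall f, smooth S f -> u f = v f) -> u = v.
Proof.
move=> [u0 _ _] [v0 _ _] uv; apply/funext => f.
by have [/uv//|nf] := pselect (smooth S f); rewrite u0// v0.
Qed.

Lemma tangent_gens p u v : tangent S p u -> tangent S p v ->
  (forall g, S g -> u g = v g) -> u = v.
Proof.
move=> Tu Tv uv; apply: (tangent_ext Tu Tv) => f fs.
have /smooth_atP[k [g [F [Sg FC E]]]] := fs p.
have gs i := smooth_gen (Sg i).
rewrite (tangent_chain Tu gs fs openT I FC E) (tangent_chain Tv gs fs openT I FC E).
by apply: eq_bigr => i _; rewrite uv.
Qed.

Lemma tangent0 p : tangent S p 0.
Proof.
split=> [//|a f g _ _|f g _ _].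
- by transitivity (a * 0 + 0); first by rewrite mulr0 addr0.
- by transitivity (0 * g p + f p * 0); first by rewrite mul0r mulr0 addr0.
Qed.

Lemma tangent_lin p a u v : tangent S p u -> tangent S p v -> tangent S p (a *: u + v).
Proof.
move=> [u0 ul ud] [v0 vl vd]; split=> [f nf|b f g fs gs|f g fs gs]; rewrite !fctE.
- by rewrite u0// v0// scaler0 addr0.
- by rewrite ul// vl// /GRing.scale/=; ring.
- by rewrite ud// vd// /GRing.scale/=; ring.
Qed.

Lemma tangent_add p u v : tangent S p u -> tangent S p v -> tangent S p (u + v).
Proof. by move=> Tu Tv; rewrite -(scale1r u); exact: tangent_lin. Qed.

Lemma tangent_scale p a u : tangent S p u -> tangent S p (a *: u).
Proof. by move=> Tu; rewrite -(addr0 (a *: u)); apply: tangent_lin => //; exact: tangent0. Qed.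

Lemma tangent_sub p u v : tangent S p u -> tangent S p v -> tangent S p (u - v).
Proof. by move=> Tu Tv; rewrite addrC -scaleN1r; exact: tangent_lin. Qed.

Lemma tangent_sumv p (I : Type) (s : seq I) (w : I -> vec (R := R) T) :
  (forall i, tangent S p (w i)) -> tangent S p (\sum_(i <- s) w i).
Proof.
move=> Tw; elim: s => [|i s IH]; first by rewrite big_nil; exact: tangent0.
by rewrite big_cons; exact: tangent_add.
Qed.

Lemma vec_addE u v f : (u + v) f = u f + v f.
Proof. by []. Qed.

Lemma vec_scaleE (c : R) v f : (c *: v) f = c * v f.
Proof. by []. Qed.

Lemma vec_sumE (I : Type) (s : seq I) (w : I -> vec (R := R) T) f :
  (\sum_(i <- s) w i) f = \sum_(i <- s) w i f.
Proof. by elim/big_rec2: _ => // i a b _ <-. Qed.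

Lemma vfield_tangent (V : T -> vec (R := R) T) p : vfield S V -> tangent S p (V p).
Proof. by case=> + _; exact. Qed.

Lemma vfield_smooth (V : T -> vec (R := R) T) f :
  vfield S V -> smooth S f -> smooth S (fun p => V p f).
Proof. by case=> _; exact. Qed.

Lemma vfield_sum (I : Type) (s : seq I) (a : I -> T -> R) (V : I -> T -> vec (R := R) T) :
  (forall i, smooth S (a i)) -> (forall i, vfield S (V i)) ->
  vfield S (fun p => \sum_(i <- s) a i p *: V i p).
Proof.
move=> as_ Vs; split=> [p|f fs].
  by apply: tangent_sumv => i; apply: tangent_scale; exact: vfield_tangent.
under eq_fun do rewrite vec_sumE.
by apply: smooth_sum => i; apply: smoothM => //; exact: vfield_smooth.
Qed.

Lemma vbracketE V W p f : smooth S f ->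
  vbracket S V W p f = V p (fun q => W q f) - W p (fun q => V q f).
Proof. by move=> fs; rewrite /vbracket /on_smooth asboolT. Qed.

Lemma vbracket_tangent V W p : vfield S V -> vfield S W ->
  tangent S p (vbracket S V W p).
Proof.
move=> Vv Wv; have Vs f := @vfield_smooth V f Vv; have Ws f := @vfield_smooth W f Wv.
have VT q := vfield_tangent q Vv; have WT q := vfield_tangent q Wv.
split=> [f nf|a f g fs gs|f g fs gs].
- by rewrite /vbracket /on_smooth asboolF.
- have afg : smooth S (fun x => a * f x + g x).
    by apply: smoothD => //; apply: smoothM => //; exact: smooth_cst.
  rewrite !vbracketE//.
  have E U : (forall q, tangent S q (U q)) ->
      (fun q => U q (fun x => a * f x + g x)) = (fun q => a * U q f + U q g).
    by move=> UT; apply/funext => q; have [_ UTl _] := UT q; exact: UTl.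
  have [_ VTl _] := VT p; have [_ WTl _] := WT p.
  rewrite !E// (VTl _ _ _ (Ws _ fs) (Ws _ gs)) (WTl _ _ _ (Vs _ fs) (Vs _ gs)).
  by ring.
- have fg := smoothM fs gs; rewrite !vbracketE//.
  have E U : (forall q, tangent S q (U q)) ->
      (fun q => U q (fun x => f x * g x)) = (fun q => U q f * g q + f q * U q g).
    by move=> UT; apply/funext => q; have [_ _ UTm] := UT q; exact: UTm.
  have EV U U' : tangent S p U -> (forall h, smooth S h -> smooth S (fun q => U' q h)) ->
      U (fun q => U' q f * g q + f q * U' q g) =
      U (fun q => U' q f) * g p + U' p f * U g + (U f * U' p g + f p * U (fun q => U' q g)).
    move=> UT U's; have h1 := smoothM (U's _ fs) gs; have h2 := smoothM fs (U's _ gs).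
    by rewrite (tangentD UT h1 h2) !(tangentM UT)//; exact: U's.
  by rewrite !E// EV// EV//; ring.
Qed.

(** The shape [sum_i a_i d(b_i)], with globally smooth coefficients, serves as coordinate expression
    of a one-form and makes sense without charts. *)
Definition local_form (theta : T -> vec (R := R) T -> R) (p : T) k
    (a b : 'I_k -> T -> R) : Prop :=
  [/\ forall i, smooth S (a i), forall i, smooth S (b i) &
      \forall q \near (p : X), forall w, tangent S q w ->
        theta q w = \sum_i a i q * w (b i)].

Definition smooth_form theta : Prop :=
  forall p, exists k (a b : 'I_k -> T -> R), local_form theta p a b.

Lemma smooth_form_apply theta V : smooth_form theta -> vfield S V ->
  smooth S (fun q => theta q (V q)).
Proof.
move=> th VV p; have [k [a [b [as_ bs E]]]] := th p.
apply: (smooth_at_congr (f := fun q => \sum_i a i q * V q (b i))).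
  by apply: filterS E => q -> //; exact: vfield_tangent.
apply: smooth_at_sum => i; apply: smooth_atM; first exact: as_.
exact: vfield_smooth.
Qed.

(** In Cartan's formula the second derivatives of the [b i] cancel against the bracket. What remains
    is [sum_i da_i ^ db_i], which no longer depends on the extensions, so the definite description
    is unambiguous; one extension of each argument makes it nonempty. *)
Lemma extdE theta p u v k (a b : 'I_k -> T -> R) :
  smooth_form theta -> local_form theta p a b ->
  (exists2 U, vfield S U & U p = u) -> (exists2 V, vfield S V & V p = v) ->
  extd S theta p u v = \sum_i (u (a i) * v (b i) - v (a i) * u (b i)).
Proof.
move=> th [as_ bs E] [U UU Up] [V VV Vp].
have val U' V' : vfield S U' -> vfield S V' ->
    U' p (fun q => theta q (V' q)) = \sum_i (U' p (a i) * V' p (b i) +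
       a i p * U' p (fun q => V' q (b i))).
  move=> UU' VV'; have V's i := vfield_smooth VV' (bs i).
  have Ts := smooth_form_apply th VV'.
  have Ms i := smoothM (as_ i) (V's i).
  have UT := vfield_tangent p UU'.
  rewrite (@tangent_local p (U' p) UT _ (fun q => \sum_i a i q * V' q (b i)) Ts
    (smooth_sum _ Ms)); last first.
    by apply: filterS E => q -> //; exact: vfield_tangent.
  by rewrite (tangent_sum UT)//; apply: eq_bigr => i _; rewrite (tangentM UT).
apply: the_unique; [exists U, V; split=> //|move=> r [U' [V' [[UU' VV'] U'p V'p ->]]]];
  rewrite !val// (nbhs_singleton E) ?Up ?Vp ?U'p ?V'p; try exact: vbracket_tangent.
  rewrite -!sumrB; apply: eq_bigr => i _; rewrite vbracketE// Up Vp; ring.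
rewrite -!sumrB; apply: eq_bigr => i _; rewrite vbracketE// U'p V'p; ring.
Qed.

End TangentVectors.

(** * Tangent maps, products, and the symmetry of mixed derivatives *)

Section SmoothMaps.
Context {R : realType}.

Lemma smooth_map_comp T1 T2 T3 (S1 : set (T1 -> R)) (S2 : set (T2 -> R))
    (S3 : set (T3 -> R)) (phi : T1 -> T2) (psi : T2 -> T3) :
  smooth_map S1 S2 phi -> smooth_map S2 S3 psi -> smooth_map S1 S3 (psi \o phi).
Proof. by move=> h1 h2 f fs; exact: (h1 _ (h2 f fs)). Qed.

Lemma smooth_map_continuous T1 T2 (S1 : set (T1 -> R)) (S2 : set (T2 -> R))
    (phi : T1 -> T2) : (forall g, S2 g -> smooth S1 (g \o phi)) ->
  continuous (phi : space_of S1 -> space_of S2).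
Proof.
move=> gs p; apply: (@space_of_cvg R T2 S2 (phi @ nbhs (p : space_of S1)) (phi p)).
by move=> g Sg; exact: (smooth_continuous (gs g Sg)).
Qed.

Lemma smooth_map_gens T1 T2 (S1 : set (T1 -> R)) (S2 : set (T2 -> R))
    (phi : T1 -> T2) :
  (forall g, S2 g -> smooth S1 (g \o phi)) -> smooth_map S1 S2 phi.
Proof.
move=> gs f fs p; have /smooth_atP[k [g [F [Sg FC E]]]] := fs (phi p).
have cphi := smooth_map_continuous gs.
apply: (smooth_at_comp_near (u := fun i => g i \o phi)) openT I FC _.
  by move=> i; exact: gs.
exact: (cphi p _ E).
Qed.

Lemma smooth_map_cvg T1 T2 (S1 : set (T1 -> R)) (S2 : set (T2 -> R))
    (phi : T1 -> T2) (p : T1) : smooth_map S1 S2 phi ->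
  {for p, continuous (phi : space_of S1 -> space_of S2)}.
Proof. by move=> h; apply: smooth_map_continuous => g Sg; exact: h _ (smooth_gen Sg). Qed.

Lemma tmapE T1 T2 (S2 : set (T2 -> R)) (phi : T1 -> T2) (v : vec T1) f :
  smooth S2 f -> tmap S2 phi v f = v (f \o phi).
Proof. by move=> fs; rewrite /tmap /on_smooth asboolT. Qed.

Lemma tmap_lin T1 T2 (S2 : set (T2 -> R)) (phi : T1 -> T2) a (u v : vec T1) :
  tmap S2 phi (a *: u + v) = a *: tmap S2 phi u + tmap S2 phi v.
Proof.
apply/funext => f; rewrite !fctE /tmap /on_smooth; case: ifP => // _.
by rewrite scaler0 addr0.
Qed.

Lemma tmap0 T1 T2 (S2 : set (T2 -> R)) (phi : T1 -> T2) : tmap S2 phi 0 = 0.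
Proof. by apply/funext => f; rewrite /tmap /on_smooth; case: ifP. Qed.

Lemma tmap_add T1 T2 (S2 : set (T2 -> R)) (phi : T1 -> T2) (u v : vec T1) :
  tmap S2 phi (u + v) = tmap S2 phi u + tmap S2 phi v.
Proof. by have := tmap_lin S2 phi 1 u v; rewrite !scale1r. Qed.

Lemma tmap_scale T1 T2 (S2 : set (T2 -> R)) (phi : T1 -> T2) a (u : vec T1) :
  tmap S2 phi (a *: u) = a *: tmap S2 phi u.
Proof. by have := tmap_lin S2 phi a u 0; rewrite tmap0 !addr0. Qed.

Lemma tmap_sub T1 T2 (S2 : set (T2 -> R)) (phi : T1 -> T2) (u v : vec T1) :
  tmap S2 phi (u - v) = tmap S2 phi u - tmap S2 phi v.
Proof. by rewrite tmap_add -scaleN1r tmap_scale scaleN1r. Qed.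

Lemma tmap_sum T1 T2 (S2 : set (T2 -> R)) (phi : T1 -> T2) (I : Type) (s : seq I)
    (u : I -> vec T1) : tmap S2 phi (\sum_(i <- s) u i) = \sum_(i <- s) tmap S2 phi (u i).
Proof. by apply: (big_morph _ (tmap_add _ _) (tmap0 _ _)). Qed.

Lemma tmap_tangent T1 T2 (S1 : set (T1 -> R)) (S2 : set (T2 -> R)) (phi : T1 -> T2) p
    (v : vec T1) : smooth_map S1 S2 phi -> tangent S1 p v ->
  tangent S2 (phi p) (tmap S2 phi v).
Proof.
move=> h [v0 vl vd]; split=> [f nf|a f g fs gs|f g fs gs].
- by rewrite /tmap /on_smooth asboolF.
- have afg : smooth S2 (fun x => a * f x + g x).
    by apply: smoothD => //; apply: smoothM => //; exact: smooth_cst.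
  by rewrite !tmapE//; exact: (vl a _ _ (h f fs) (h g gs)).
- by rewrite !tmapE//; [exact: (vd _ _ (h f fs) (h g gs))|exact: smoothM].
Qed.

Lemma tmap_comp T1 T2 T3 (S2 : set (T2 -> R)) (S3 : set (T3 -> R)) (phi : T1 -> T2)
    (psi : T2 -> T3) (v : vec T1) : smooth_map S2 S3 psi ->
  tmap S3 psi (tmap S2 phi v) = tmap S3 (psi \o phi) v.
Proof.
move=> h; apply/funext => f; have [fs|nf] := pselect (smooth S3 f).
  by rewrite !tmapE//; exact: h.
by rewrite /tmap /on_smooth !asboolF.
Qed.

Lemma tmap_id T (S : set (T -> R)) p (v : vec T) : tangent S p v -> tmap S id v = v.
Proof.
move=> [v0 _ _]; apply/funext => f; have [fs|nf] := pselect (smooth S f).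
  by rewrite tmapE.
by rewrite /tmap /on_smooth asboolF// v0.
Qed.

Lemma smooth_sub T (S : set (T -> R)) (P : set T) :
  smooth_map (sub_structure (P := P) S) S sval.
Proof. by apply: smooth_map_gens => g Sg; apply: smooth_gen; exists g. Qed.

Section Products.
Context {T1 T2 : Type} (S1 : set (T1 -> R)) (S2 : set (T2 -> R)).
Local Notation SP := (prod_structure S1 S2).

Lemma smooth_fst : smooth_map SP S1 fst.
Proof. by apply: smooth_map_gens => g Sg; apply: smooth_gen; left; exists g. Qed.

Lemma smooth_snd : smooth_map SP S2 snd.
Proof. by apply: smooth_map_gens => g Sg; apply: smooth_gen; right; exists g. Qed.

Lemma smooth_pair T (S : set (T -> R)) (a : T -> T1) (b : T -> T2) :
  smooth_map S S1 a -> smooth_map S S2 b -> smooth_map S SP (fun x => (a x, b x)).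
Proof.
move=> ha hb; apply: smooth_map_gens => _ [[f Sf ->]|[f Sf ->]].
  exact: (ha _ (smooth_gen Sf)).
exact: (hb _ (smooth_gen Sf)).
Qed.

Lemma smooth_pairl (b : T2) : smooth_map S1 SP (fun a => (a, b)).
Proof. by apply: smooth_pair => // f fs; exact: smooth_cst. Qed.

Lemma smooth_pairr (a : T1) : smooth_map S2 SP (fun b => (a, b)).
Proof. by apply: smooth_pair => // f fs; exact: smooth_cst. Qed.

(** The generators of a product are of this kind, and the mixed second derivative of such a function
    is zero. *)
Definition separated (E : T1 * T2 -> R) : Prop :=
  (exists2 u, smooth S1 u & E = u \o fst) \/ (exists2 w, smooth S2 w & E = w \o snd).

Lemma separated_smooth E : separated E -> smooth SP E.
Proof.
by case=> -[u us ->]; [exact: (smooth_fst us)|exact: (smooth_snd us)].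
Qed.

Lemma separated_gen g : SP g -> separated g.
Proof. by case=> -[u Su ->]; [left|right]; exists u => //; exact: smooth_gen. Qed.

Lemma near_slicer (P : set (space_of SP)) a b : (\forall z \near ((a, b) : space_of SP), P z) ->
  \forall b' \near (b : space_of S2), P (a, b').
Proof. by move=> nP; exact: (@smooth_map_cvg _ _ _ _ _ b (smooth_pairr a) _ nP). Qed.

Lemma near_slicel (P : set (space_of SP)) a b : (\forall z \near ((a, b) : space_of SP), P z) ->
  \forall a' \near (a : space_of S1), P (a', b).
Proof. by move=> nP; exact: (@smooth_map_cvg _ _ _ _ _ a (smooth_pairl b) _ nP). Qed.

(** Differentiating a separated function in the second factor gives something independent of the
    first. The formula therefore moves all the dependence on [z.1] into the smooth coefficients
    [c i], which is how derivatives in one factor are seen to be smooth. *)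
Lemma partial_tangent_formula (Phi : T1 * T2 -> R) z0 : smooth SP Phi ->
  exists (k : nat) (g c : 'I_k -> T1 * T2 -> R),
    [/\ forall i, separated (g i), forall i, smooth SP (c i) &
      \forall z \near (z0 : space_of SP), forall x, tangent S2 z.2 x ->
        x (fun b => Phi (z.1, b)) = \sum_i c i z * x (fun b => g i (z.1, b))].
Proof.
move=> Ps; have [U [k [g [F [[oU Uz0] Sg FC E]]]]] := Ps z0.
exists k, g, (fun i z => 'D_('e_i) F (\row_j g j z)); split.
- by move=> i; exact: separated_gen.
- move=> i; apply: smooth_comp (Cinfty_on_partial i FC) => j.
  exact: smooth_gen.
apply: filterS (open_nbhs_nbhs (conj oU Uz0)) => -[a b] Uab x Tx /=.
have nU := near_slicer (open_nbhs_nbhs (conj oU Uab)).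
have gs i : smooth S2 (fun b => g i (a, b)) by exact: (smooth_pairr _ (smooth_gen (Sg i))).
apply: (tangent_chain Tx gs (smooth_pairr _ Ps) openT I FC).
by apply: filterS nU => b' /E.
Qed.

Lemma smooth_partial (Phi : T1 * T2 -> R) (V : T2 -> vec T2) : smooth SP Phi -> vfield S2 V ->
  smooth SP (fun z => V z.2 (fun b => Phi (z.1, b))).
Proof.
move=> Ps VV z0; have [k [g [c [gsep cs E]]]] := partial_tangent_formula z0 Ps.
apply: (smooth_at_congr (f := fun z => \sum_i c i z * V z.2 (fun b => g i (z.1, b)))).
  by apply: filterS E => z ->//; exact: vfield_tangent.
apply: smooth_at_sum => i; apply: smooth_atM; first exact: cs.
have [[u us ->]|[w ws ->]] := gsep i.
  have -> : (fun z : T1 * T2 => V z.2 (fun b => (u \o fst) (z.1, b))) = fun=> 0.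
    by apply/funext => z; exact: (tangent_cst (vfield_tangent z.2 VV) (u z.1)).
  exact: smooth_at_cst.
exact: (smooth_snd (vfield_smooth VV ws)).
Qed.

Lemma smooth_partial_vec (Phi : T1 * T2 -> R) (b0 : T2) (x : vec T2) : smooth SP Phi ->
  tangent S2 b0 x -> smooth S1 (fun a => x (fun b => Phi (a, b))).
Proof.
move=> Ps Tx a0; have [k [g [c [gsep cs E]]]] := partial_tangent_formula (a0, b0) Ps.
apply: (smooth_at_congr (f := fun a => \sum_i c i (a, b0) * x (fun b => g i (a, b)))).
  by apply: filterS (near_slicel E) => a ->.
apply: smooth_at_sum => i; apply: smooth_atM; first exact: (smooth_pairl _ (cs i)).
have [[u us ->]|[w ws ->]] := gsep i.
  have -> : (fun a : T1 => x (fun b => (u \o fst) (a, b))) = fun=> 0.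
    by apply/funext => z; exact: (tangent_cst Tx (u z)).
  exact: smooth_at_cst.
exact: (@smooth_at_cst _ _ S1 (x w) a0).
Qed.

(** Each [E i] vanishes at the base point and has no mixed derivative, so only products of first
    derivatives survive. The resulting sum treats the two factors alike. *)
Lemma mixed_tangent (Phi : T1 * T2 -> R) a0 b0 (ka : vec T1) (x : vec T2) (C : R) k
    (E G : 'I_k -> T1 * T2 -> R) :
  tangent S1 a0 ka -> tangent S2 b0 x -> smooth SP Phi ->
  (forall i, separated (E i)) -> (forall i, E i (a0, b0) = 0) -> (forall i, smooth SP (G i)) ->
  (\forall z \near ((a0, b0) : space_of SP), Phi z = C + \sum_i E i z * G i z) ->
  ka (fun a => x (fun b => Phi (a, b))) =
  \sum_i (x (fun b => E i (a0, b)) * ka (fun a => G i (a, b0)) +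
          ka (fun a => E i (a, b0)) * x (fun b => G i (a0, b))).
Proof.
move=> Tk Tx Ps Esep E0 Gs HE.
have Es i := separated_smooth (Esep i).
have sE i a : smooth S2 (fun b => E i (a, b)) by exact: (smooth_pairr _ (Es i)).
have sG i a : smooth S2 (fun b => G i (a, b)) by exact: (smooth_pairr _ (Gs i)).
have sEl i b : smooth S1 (fun a => E i (a, b)) by exact: (smooth_pairl _ (Es i)).
have sGl i b : smooth S1 (fun a => G i (a, b)) by exact: (smooth_pairl _ (Gs i)).
have xE i a : x (fun b => E i (a, b)) = x (fun b => E i (a0, b)).
  by have [[u us ->]|[w ws ->]] := Esep i;
    [rewrite (tangent_cst Tx (u a)) (tangent_cst Tx (u a0))|].
pose h a := \sum_i (x (fun b => E i (a0, b)) * G i (a, b0) +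
                    E i (a, b0) * x (fun b => G i (a, b))).
have sx i : smooth S1 (fun a => x (fun b => G i (a, b))).
  exact: (smooth_partial_vec (Gs i) Tx).
have t1 i := smoothM (smooth_cst S1 (x (fun b => E i (a0, b)))) (sGl i b0).
have t2 i := smoothM (sEl i b0) (sx i).
have hs : smooth S1 h by apply: smooth_sum => i; exact: smoothD (t1 i) (t2 i).
have -> : ka (fun a => x (fun b => Phi (a, b))) = ka h.
  apply: (tangent_local Tk _ hs); first exact: (smooth_partial_vec Ps Tx).
  have := near_slicel (nbhs_interior HE); apply: filterS => a nPa.
  have /= nb := near_slicer nPa.
  rewrite (tangent_local Tx (smooth_pairr _ Ps)
    (g := fun b => C + \sum_i E i (a, b) * G i (a, b)) _ nb); last first.
    apply: smoothD; first exact: smooth_cst.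
    by apply: smooth_sum => i; exact: smoothM.
  have sEG i := smoothM (sE i a) (sG i a).
  rewrite (tangentD Tx (smooth_cst _ _) (smooth_sum _ sEG)) (tangent_cst Tx) add0r.
  rewrite (tangent_sum Tx)//; apply: eq_bigr => i _.
  by rewrite (tangentM Tx)// xE.
rewrite /h (tangent_sum Tk); last by move=> i; exact: smoothD (t1 i) (t2 i).
apply: eq_bigr => i _; rewrite (tangentD Tk (t1 i) (t2 i)) (tangentZ Tk)//.
by rewrite (tangentM Tk)// E0 mul0r addr0.
Qed.

End Products.
(** Hadamard's lemma applied to the function of the generators supplies the decomposition that
    [mixed_tangent] requires; evaluating it once more with the factors swapped gives the same
    sum. *)
Lemma tangent_commute T1 T2 (S1 : set (T1 -> R)) (S2 : set (T2 -> R))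
    (Phi : T1 * T2 -> R) a0 b0 (ka : vec T1) (x : vec T2) :
  smooth (prod_structure S1 S2) Phi -> tangent S1 a0 ka -> tangent S2 b0 x ->
  ka (fun a => x (fun b => Phi (a, b))) = x (fun b => ka (fun a => Phi (a, b))).
Proof.
move=> Ps Tk Tx; have /smooth_atP[k [g [F [Sg FC HF]]]] := Ps (a0, b0).
pose c := \row_i g i (a0, b0); have [H HC HE] := hadamard c FC.
pose E (i : 'I_k) z := g i z - c 0 i.
pose G (i : 'I_k) z := H i (\row_j g j z).
have Gs i : smooth (prod_structure S1 S2) (G i).
  by apply: smooth_comp (HC i) => j; exact: smooth_gen.
have Esep i : separated S1 S2 (E i).
  have cs T (S : set (T -> R)) u : smooth S u -> smooth S (fun a => u a - c 0 i).
    by move=> us; apply: smoothB => //; exact: smooth_cst.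
  by rewrite /E; case: (separated_gen (Sg i)) => -[u /cs us ->]; [left|right];
    exists (fun a => u a - c 0 i).
have E0 i : E i (a0, b0) = 0 by rewrite /E mxE subrr.
have PE : \forall z \near ((a0, b0) : space_of (prod_structure S1 S2)),
    Phi z = F c + \sum_i E i z * G i z.
  apply: filterS HF => z ->; rewrite HE; congr (_ + _).
  by apply: eq_bigr => i _; rewrite [in LHS]mxE.
rewrite (mixed_tangent Tk Tx Ps Esep E0 Gs PE).
pose sw (z : T2 * T1) := (z.2, z.1).
have sws : smooth_map (prod_structure S2 S1) (prod_structure S1 S2) sw.
  by apply: smooth_pair; [exact: smooth_snd|exact: smooth_fst].
have Esep' i : separated S2 S1 (E i \o sw).
  by case: (Esep i) => -[u us ->]; [right|left]; exists u.
have PE' := @smooth_map_cvg _ _ _ _ _ (b0, a0) sws _ PE.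
rewrite (@mixed_tangent _ _ S2 S1 (Phi \o sw) b0 a0 x ka (F c) k (fun i => E i \o sw)
  (fun i => G i \o sw) Tx Tk (sws _ Ps) Esep' E0 (fun i => sws _ (Gs i)) PE').
by apply: eq_bigr => i _; rewrite /sw /= addrC.
Qed.

End SmoothMaps.

(** * Coordinate frames from charts *)

Section Charts.
Context {R : realType} {T : Type} (S : set (T -> R)) (n : nat).
Local Notation X := (space_of S).
Variables (U : set X) (phi : T -> 'rV[R]_n).
Hypothesis Uphi : chart U phi.

Let oU : open U. Proof. by case: Uphi => -[]. Qed.
Let oV : open [set phi x | x in U]. Proof. by case: Uphi => -[]. Qed.
Let nU x : U x -> nbhs (x : X) U. Proof. by move=> Ux; exact: open_nbhs_nbhs. Qed.

Lemma chart_coord_smooth x i : U x -> smooth_at S (fun x => phi x 0 i) x.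
Proof. by case: Uphi => _ _ h _; exact: h. Qed.

Lemma chart_rep f : smooth S f ->
  exists2 F, Cinfty_on [set phi x | x in U] F & forall x, U x -> f x = F (phi x).
Proof. by case: Uphi => _ _ _ h fs; apply: h => x _; exact: fs. Qed.

(** Continuity of the inverse chart is hidden in the last clause of [chart]: a bump function
    supported in [P] has a continuous coordinate representation equal to [1] at [phi x], hence
    nonzero nearby. *)
Lemma chart_nbhs x (P : set X) : U x -> nbhs (x : X) P ->
  \forall y \near phi x, exists2 x', P x' /\ U x' & phi x' = y.
Proof.
move=> Ux nP; have [chi [chis chi1 chi0]] := smooth_bump nP.
have [F FC FE] := chart_rep chis.
have Vx : [set phi x | x in U] (phi x) by exists x.
have cF := Cinfty_on_continuous FC Vx.
have F1 : F (phi x) = 1 by rewrite -FE// (nbhs_singleton chi1).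
have near1 : \forall y \near phi x, F y != 0.
  have : \forall t \near F (phi x), t != 0.
    by apply: open_nbhs_nbhs; split; [exact: open_neq|rewrite /= F1 oner_neq0].
  exact: cF.
apply: (filterS2 _ _ near1 (open_nbhs_nbhs (conj oV Vx))) => y Fy [x' Ux' x'y].
exists x' => //; split=> //; case: (chi0 x') => // /nbhs_singleton chi_x'.
by move: Fy; rewrite -x'y -FE// chi_x' eqxx.
Qed.

Definition chart_fun f : 'rV[R]_n -> R :=
  the (fun=> 0) [set F | Cinfty_on [set phi x | x in U] F /\ forall x, U x -> f x = F (phi x)].

Lemma chart_funP f : smooth S f -> Cinfty_on [set phi x | x in U] (chart_fun f) /\
  forall x, U x -> f x = chart_fun f (phi x).
Proof.
move=> fs; apply: (@the_ind _ _ [set F | Cinfty_on [set phi x | x in U] F /\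
  forall x, U x -> f x = F (phi x)]).
by have [F ? ?] := chart_rep fs; exists F.
Qed.

Lemma chart_fun_near f F x (P : set X) : smooth S f -> U x -> nbhs (x : X) P ->
  (forall x, P x -> U x -> f x = F (phi x)) ->
  \forall y \near phi x, chart_fun f y = F y.
Proof.
move=> fs Ux nP fF; apply: filterS (chart_nbhs Ux nP) => y [x' [Px' Ux'] <-].
by rewrite -(chart_funP fs).2// fF.
Qed.

Lemma chart_fun_derivable f x i : smooth S f -> U x -> derivable (chart_fun f) (phi x) 'e_i.
Proof. by move=> fs Ux; apply: (Cinfty_on_derivable (chart_funP fs).1); exists x. Qed.

Definition chart_vec (i : 'I_n) (x : T) : vec (R := R) T :=
  on_smooth S (fun f => 'D_('e_i) (chart_fun f) (phi x)).

Lemma chart_vecE i x f : smooth S f -> chart_vec i x f = 'D_('e_i) (chart_fun f) (phi x).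
Proof. by move=> fs; rewrite /chart_vec /on_smooth asboolT. Qed.

Lemma chart_vec_tangent i x : U x -> tangent S x (chart_vec i x).
Proof.
move=> Ux; split=> [f nf|a f g fs gs|f g fs gs].
- by rewrite /chart_vec /on_smooth asboolF.
- have hs : smooth S (fun x => a * f x + g x).
    by apply: smoothD => //; apply: smoothM => //; exact: smooth_cst.
  rewrite !chart_vecE//.
  have -> : 'D_('e_i) (chart_fun (fun x => a * f x + g x)) (phi x) =
            'D_('e_i) (a *: chart_fun f + chart_fun g) (phi x).
    apply: near_eq_derive; apply: (chart_fun_near hs Ux (nU Ux)) => x' _ Ux'.
    by rewrite !fctE -!(chart_funP _).2.
  have df := @chart_fun_derivable f x i fs Ux; have dg := @chart_fun_derivable g x i gs Ux.
  by rewrite deriveD ?deriveZ//; exact: derivableZ.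
- have hs := smoothM fs gs; rewrite !chart_vecE//.
  have -> : 'D_('e_i) (chart_fun (fun x => f x * g x)) (phi x) =
            'D_('e_i) (chart_fun f * chart_fun g) (phi x).
    apply: near_eq_derive; apply: (chart_fun_near hs Ux (nU Ux)) => x' _ Ux'.
    by rewrite !fctE -!(chart_funP _).2.
  have df := @chart_fun_derivable f x i fs Ux; have dg := @chart_fun_derivable g x i gs Ux.
  by rewrite deriveM// -!(chart_funP _).2// /GRing.scale/=; ring.
Qed.

Lemma chart_vec_smooth_at i x f : U x -> smooth S f -> smooth_at S (fun x => chart_vec i x f) x.
Proof.
move=> Ux fs; have C := Cinfty_on_partial i (chart_funP fs).1.
apply: (smooth_at_comp_near (u := fun j x => phi x 0 j) _ oV _ C).
- by move=> j; exact: chart_coord_smooth.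
- by exists x => //; apply/rowP => j; rewrite mxE.
- apply: filterE => x'; rewrite chart_vecE//; congr ('D_('e_i) (chart_fun f) _).
  by apply/rowP => j; rewrite mxE.
Qed.

(** Bump functions make the coordinates and the coordinate fields global, as [smooth] and [vfield]
    require; duality and the expansion of vectors are then claimed near [p] only. *)
Lemma local_frame p : U p -> exists (q : 'I_n -> T -> R) (V : 'I_n -> T -> vec (R := R) T),
  [/\ forall j, smooth S (q j), forall j, vfield S (V j) &
   \forall x \near (p : X), [/\ U x, forall i j, V i x (q j) = (i == j)%:R,
     forall j, q j x = phi x 0 j &
     forall v, tangent S x v -> v = \sum_j v (q j) *: V j x]].
Proof.
move=> Up; have [chi [chis chi1 chi0]] := smooth_bump (nU Up).
have /choice[q qP] (j : 'I_n) : exists q, smooth S q /\ \forall x \near (p : X), q x = phi x 0 j.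
  by have [q' ? ?] := smooth_globalize (chart_coord_smooth j Up); exists q'.
pose V j x : vec (R := R) T := if pselect (U x) then chi x *: chart_vec j x else 0.
have VT j x : tangent S x (V j x).
  rewrite /V; case: pselect => [Ux|?]; last exact: tangent0.
  by apply: tangent_scale; exact: chart_vec_tangent.
exists q, V; split=> [j|j|]; first exact: (qP j).1.
  split=> // f fs x; case: (chi0 x) => [Ux|cx].
    apply: (smooth_at_congr (f := fun x => chi x * chart_vec j x f)).
      by apply: filterS (nU Ux) => y Uy; rewrite /V; case: pselect.
    by apply: smooth_atM; [exact: chis|exact: chart_vec_smooth_at].
  apply: (smooth_at_congr (f := fun=> 0)); last exact: smooth_at_cst.
  apply: filterS cx => y cy; rewrite /V; case: pselect => // Uy.
  by rewrite cy scale0r.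
have qn : \forall x \near (p : X), forall j, q j x = phi x 0 j.
  by apply: (@filter_forall _ _ _ (nbhs (p : X))) => j; exact: (qP j).2.
apply: (filterS3 _ _ (nbhs_interior qn) (nU Up) chi1) => x qx Ux chix.
have qE j := nbhs_singleton qx j.
have qs j := (qP j).1.
have VE j : V j x = chart_vec j x by rewrite /V; case: pselect => //; rewrite chix scale1r.
split=> // [i j|v Tv].
  rewrite VE chart_vecE// (_ : 'D_('e_i) _ _ = 'D_('e_i) (fun y : 'rV[R]_n => y 0 j) (phi x)).
    by have [_ ->] := is_derive_coord j (phi x) 'e_i; rewrite mxE eqxx eq_sym.
  by apply: near_eq_derive; apply: (chart_fun_near (qs j) Ux qx) => y yq _; exact: yq.
have phiE : \row_j q j x = phi x by apply/rowP => j; rewrite mxE.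
apply: (tangent_ext Tv) => [|f fs].
  by apply: tangent_sumv => j; exact: tangent_scale.
rewrite vec_sumE (tangent_chain Tv qs fs oV _ (chart_funP fs).1); last 2 first.
- by rewrite phiE; exists x.
- apply: filterS2 qx (nU Ux) => y qy Uy; rewrite (chart_funP fs).2//; congr (chart_fun f _).
  by apply/rowP => j; rewrite mxE qy.
by apply: eq_bigr => j _; rewrite VE phiE mulrC -chart_vecE.
Qed.

End Charts.

(** * Cotangent bundles *)

Lemma manifold_frame (R : realType) n (T : Type) (S : set (T -> R)) (p : T) : manifold n S ->
  exists (q : 'I_n -> T -> R) (V : 'I_n -> T -> vec (R := R) T) (N : set (space_of S)),
  [/\ forall j, smooth S (q j), forall j, vfield S (V j),
   nbhs (p : space_of S) N,
   forall x, N x -> (forall i j, V i x (q j) = (i == j)%:R) /\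
     (forall v, tangent S x v -> v = \sum_j v (q j) *: V j x) &
   forall x y, N x -> N y -> (forall j, q j x = q j y) -> x = y].
Proof.
move=> [_ _ /(_ p)[U Up [phi Uphi]]].
have [q [V [qs VV near_p]]] := local_frame Uphi Up.
exists q, V, [set x | [/\ U x, forall i j, V i x (q j) = (i == j)%:R,
  forall j, q j x = phi x 0 j &
  forall v, tangent S x v -> v = \sum_j v (q j) *: V j x]].
split; [exact: qs|exact: VV|exact: near_p| |].
  by move=> x [].
move=> x y [Ux _ qx _] [Uy _ qy _] qxy; have [_ inj _ _] := Uphi.
by apply: inj => //; apply/rowP => j; rewrite -qx -qy.
Qed.

Section Cotangent.
Context {R : realType} {T : Type} (S : set (T -> R)).
Local Notation ST := (cotangent_structure S).
Local Notation vecT := (vec (R := R) T).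

Lemma cotangent_ext (x y : cotangent S) :
  base x = base y -> cov x = cov y -> x = y.
Proof.
case: x y => [[b a] H] [[b' a'] H']; rewrite /base /cov /= => bb aa.
by case: _ / bb in H' *; case: _ / aa in H' *; congr exist; exact: Prop_irrelevance.
Qed.

Lemma cov_lin (x : cotangent S) (c : R) (u v : vecT) : tangent S (base x) u ->
  tangent S (base x) v -> cov x (c *: u + v) = c * cov x u + cov x v.
Proof. by have [_ h] := svalP x; exact: h. Qed.

Lemma cov_out (x : cotangent S) (v : vecT) : ~ tangent S (base x) v -> cov x v = 0.
Proof. by have [h _] := svalP x; exact: h. Qed.

Lemma cov0 (x : cotangent S) : cov x 0 = 0.
Proof.
have := @cov_lin x 1 0 0 (tangent0 S _) (tangent0 S _).
by rewrite scale1r addr0 mul1r => h; lra.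
Qed.

Lemma cov_sub (x : cotangent S) (u v : vecT) : tangent S (base x) u ->
  tangent S (base x) v -> cov x (u - v) = cov x u - cov x v.
Proof. by move=> Tu Tv; rewrite addrC -scaleN1r cov_lin// mulN1r addrC. Qed.

Lemma cov_sum (x : cotangent S) (I : Type) (s : seq I) (c : I -> R) (u : I -> vecT) :
  (forall i, tangent S (base x) (u i)) ->
  cov x (\sum_(i <- s) c i *: u i) = \sum_(i <- s) c i * cov x (u i).
Proof.
move=> Tu; elim: s => [|i s IH]; first by rewrite !big_nil cov0.
rewrite !big_cons cov_lin ?IH//.
by apply: tangent_sumv => j; exact: tangent_scale.
Qed.

Lemma smooth_base : smooth_map ST S (@base R T S).
Proof.
by apply: smooth_map_gens => g Sg; apply: smooth_gen; left; exists g => //; exact: smooth_gen.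
Qed.

Definition momentum_fun (V : T -> vecT) (x : cotangent S) : R := cov x (V (base x)).

Lemma smooth_momentum_fun V : vfield S V -> smooth ST (momentum_fun V).
Proof. by move=> VV; apply: smooth_gen; right; exists V. Qed.

Section Frame.
Variables (n : nat) (q : 'I_n -> T -> R) (V : 'I_n -> T -> vecT) (N : set (space_of S)) (p0 : T).
Hypotheses (qs : forall j, smooth S (q j)) (VV : forall j, vfield S (V j)).
Hypothesis nN : nbhs (p0 : space_of S) N.
Hypothesis frame : forall y, N y -> (forall i j, V i y (q j) = (i == j)%:R) /\
     (forall v, tangent S y v -> v = \sum_j v (q j) *: V j y).

Let VT j y : tangent S y (V j y). Proof. exact: vfield_tangent. Qed.

Lemma cov_frame (x : cotangent S) v : N (base x) -> tangent S (base x) v ->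
  cov x v = \sum_j v (q j) * momentum_fun (V j) x.
Proof.
move=> Nx Tv; rewrite [in LHS]((frame Nx).2 v Tv) cov_sum//.
Qed.

Lemma ThetaQ_local (x : cotangent S) (w : vec (cotangent S)) : N (base x) -> tangent ST x w ->
  ThetaQ x w = \sum_j momentum_fun (V j) x * w (q j \o @base R T S).
Proof.
move=> Nx Tw; rewrite /ThetaQ cov_frame//; last exact: (tmap_tangent smooth_base Tw).
by apply: eq_bigr => j _; rewrite mulrC tmapE.
Qed.

Lemma near_base (x : cotangent S) : base x = p0 ->
  \forall y \near (x : space_of ST), N (base y).
Proof.
move=> xp; apply: (@smooth_map_cvg _ _ _ _ _ _ x smooth_base N).
by rewrite xp.
Qed.

(** Near [x] a fibrewise linear generator is a combination of the [momentum_fun (V j)] with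
    coefficients pulled back from the base, so these momenta and the base coordinates determine a
    derivation. *)
Lemma tangent_cotangent_ext (x : cotangent S) (u v : vec (cotangent S)) : base x = p0 ->
  tangent ST x u -> tangent ST x v ->
  (forall j, u (q j \o @base R T S) = v (q j \o @base R T S)) ->
  (forall j, u (momentum_fun (V j)) = v (momentum_fun (V j))) -> u = v.
Proof.
move=> xp Tu Tv uvq uvp; have Nx : N (base x) by rewrite xp; exact: (nbhs_singleton nN).
have uvb f : smooth S f -> u (f \o @base R T S) = v (f \o @base R T S).
  move=> fs; have wE w : w (f \o @base R T S) = tmap S (@base R T S) w f.
    by rewrite tmapE.
  rewrite (wE u) (wE v).
  have Tbu := tmap_tangent smooth_base Tu; have Tbv := tmap_tangent smooth_base Tv.
  rewrite ((frame Nx).2 _ Tbu) ((frame Nx).2 _ Tbv) !vec_sumE.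
  by apply: eq_bigr => j _; rewrite !tmapE// uvq.
apply: (tangent_gens Tu Tv) => _ [[f fs ->]|[Y YY ->]]; first exact: uvb.
have E w : tangent ST x w -> w (fun x => cov x (Y (base x))) =
    \sum_j (w ((fun y => Y y (q j)) \o @base R T S) * momentum_fun (V j) x +
            Y (base x) (q j) * w (momentum_fun (V j))).
  move=> Tw; have Ms j := smoothM (smooth_base (vfield_smooth YY (qs j)))
    (smooth_momentum_fun (VV j)).
  have nE : \forall y \near (x : space_of ST), momentum_fun Y y =
      \sum_j ((fun y => Y y (q j)) \o @base R T S) y * momentum_fun (V j) y.
    apply: filterS (near_base xp) => y Ny; rewrite /momentum_fun cov_frame//.
    exact: vfield_tangent.
  apply: (etrans (tangent_local Tw (smooth_momentum_fun YY) (smooth_sum _ Ms) nE)).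
  rewrite (tangent_sum Tw)//; apply: eq_bigr => j _.
  rewrite (tangentM Tw)//; first exact: (smooth_base (vfield_smooth YY (qs j))).
  exact: smooth_momentum_fun.
rewrite !E//; apply: eq_bigr => j _; rewrite uvb ?uvp//.
exact: vfield_smooth.
Qed.

Definition form_at (c : 'I_n -> R) (y : T) (v : vecT) : R :=
  if `[< tangent S y v >] then \sum_j c j * v (q j) else 0.

Lemma form_at_covector c y : covector S y (form_at c y).
Proof.
split=> [v nv|a u v Tu Tv]; first by rewrite /form_at asboolF.
rewrite /form_at !asboolT//; last exact: tangent_lin.
rewrite mulr_sumr -big_split; apply: eq_bigr => j _ /=.
by rewrite !fctE /GRing.scale/=; ring.
Qed.

Definition form_pt c y : cotangent S := exist _ (y, form_at c y) (form_at_covector c y).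

(** Moves a covector to another base point with its frame components unchanged; varying the base
    point produces horizontal vectors. *)
Definition transport (z : cotangent S * T) : cotangent S :=
  form_pt (fun j => momentum_fun (V j) z.1) z.2.

Lemma smooth_transport : smooth_map (prod_structure ST S) ST transport.
Proof.
apply: smooth_map_gens => _ [[f fs ->]|[Y YY ->]].
  by have : smooth (prod_structure ST S) (f \o snd) by exact: smooth_snd.
have -> : (fun x => cov x (Y (base x))) \o transport =
    fun z => \sum_j momentum_fun (V j) z.1 * Y z.2 (q j).
  apply/funext => z; rewrite /= /cov /= /form_at asboolT//.
  exact: vfield_tangent.
apply: smooth_sum => j; apply: smoothM.
  exact: (smooth_fst _ (smooth_momentum_fun (VV j))).
exact: (smooth_snd _ (vfield_smooth YY (qs j))).
Qed.

Lemma transport_base (x : cotangent S) : N (base x) -> transport (x, base x) = x.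
Proof.
move=> Nx; apply: cotangent_ext => //; apply/funext => v.
rewrite /transport /form_pt {1}/cov /= /form_at; case: asboolP => Tv; last by rewrite cov_out.
by rewrite cov_frame//; apply: eq_bigr => j _; rewrite mulrC.
Qed.

Lemma shift_covector j (z : cotangent S * T) : covector S (base z.1)
  (fun v => cov z.1 v + (q j z.2 - q j (base z.1)) *
     (if `[< tangent S (base z.1) v >] then v (q j) else 0)).
Proof.
split=> [v nv|a u v Tu Tv]; first by rewrite asboolF// cov_out// mulr0 addr0.
by rewrite !asboolT//; [rewrite cov_lin// !fctE /GRing.scale/=; ring|exact: tangent_lin].
Qed.

(** Adds a multiple of [dq_j] without moving the base point, the multiple being the j-th coordinate
    difference; varying [y] along [V j] produces the vertical vector dual to the j-th momentum. *)
Definition shift_cov j z : cotangent S := exist _ (base z.1, _) (shift_covector j z).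

Lemma smooth_shift_cov j : smooth_map (prod_structure ST S) ST (shift_cov j).
Proof.
apply: smooth_map_gens => _ [[f fs ->]|[Y YY ->]].
  exact: (smooth_fst _ (smooth_base fs)).
have -> : (fun x => cov x (Y (base x))) \o shift_cov j =
    fun z => momentum_fun Y z.1 + (q j z.2 - q j (base z.1)) * Y (base z.1) (q j).
  apply/funext => z; rewrite /= {1}/cov /= asboolT//.
  exact: vfield_tangent.
apply: smoothD; first exact: (smooth_fst _ (smooth_momentum_fun YY)).
apply: smoothM; last exact: (smooth_fst _ (smooth_base (vfield_smooth YY (qs j)))).
by apply: smoothB; [exact: (smooth_snd _ (qs j))|exact: (smooth_fst _ (smooth_base (qs j)))].
Qed.

Lemma shift_cov_base j (x : cotangent S) : shift_cov j (x, base x) = x.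
Proof.
apply: cotangent_ext => //; apply/funext => v.
by rewrite {1}/cov /= subrr mul0r addr0.
Qed.

(** Differentiating [phi (x, y)] in [y] at [y = base x] gives a vector at [phi (x, base x)], so it
    is tangent at [x] only where [phi] fixes [x]; elsewhere the cutoff has to vanish. *)
Lemma slice_vfield (chi : T -> R) (phi : cotangent S * T -> cotangent S) (j : 'I_n) :
  smooth S chi -> smooth_map (prod_structure ST S) ST phi ->
  (forall y, (forall x, base x = y -> phi (x, y) = x) \/
    \forall y' \near (y : space_of S), chi y' = 0) ->
  vfield ST (fun x => if pselect (phi (x, base x) = x)
                      then chi (base x) *: tmap ST (fun y => phi (x, y)) (V j (base x)) else 0).
Proof.
move=> chis phis hphi; pose W (x : cotangent S) : vec (cotangent S) :=
  if pselect (phi (x, base x) = x)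
  then chi (base x) *: tmap ST (fun y => phi (x, y)) (V j (base x)) else 0.
split=> [x|f fs].
  case: pselect => [phix|?]; last exact: tangent0.
  apply: tangent_scale.
  have := tmap_tangent (smooth_map_comp (@smooth_pairr _ _ _ ST S x) phis) (VT j (base x)).
  by rewrite /= phix.
have gs : smooth ST (fun x => chi (base x) * V j (base x) (fun y => f (phi (x, y)))).
  apply: smoothM; first exact: (smooth_base chis).
  have ids : smooth_map ST (prod_structure ST S) (fun x => (x, base x)).
    by apply: smooth_pair => //; exact: smooth_base.
  exact: (ids _ (smooth_partial (phis _ fs) (VV j))).
have E x : phi (x, base x) = x \/ chi (base x) = 0.
  by have [h|/nbhs_singleton h] := hphi (base x); [left; exact: h|right].
have -> // : (fun x => W x f) = (fun x => chi (base x) * V j (base x) (fun y => f (phi (x, y)))).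
apply/funext => x; rewrite /W; case: pselect => [?|phix].
  apply: (congr1 (fun t => chi (base x) * t)); exact: tmapE.
by have [//|->] := E x; rewrite mul0r.
Qed.

(** At [x] the horizontal fields from [transport] and the vertical ones from [shift_cov] span the
    tangent space, so a combination with constant coefficients takes any prescribed value there. *)
Lemma cotangent_extend_frame (x : cotangent S) (u : vec (cotangent S)) : base x = p0 ->
  tangent ST x u -> exists2 U, vfield ST U & U x = u.
Proof.
move=> xp Tu; have Nx : N (base x) by rewrite xp; exact: (nbhs_singleton nN).
have [chi [chis chi1 chi0]] := smooth_bump nN.
have chix : chi (base x) = 1 by rewrite xp; exact: nbhs_singleton chi1.
have Hv j : exists2 U, vfield ST U & U x = tmap ST (fun y => transport (x, y)) (V j (base x)).
  eexists; first (apply: (@slice_vfield chi transport j chis smooth_transport) => y).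
    by have [Ny|] := chi0 y; [left => z zy; rewrite -zy transport_base// zy|right].
  by rewrite /=; case: pselect => [?|]; rewrite ?transport_base// chix scale1r.
have Vv j : exists2 U, vfield ST U & U x = tmap ST (fun y => shift_cov j (x, y)) (V j (base x)).
  eexists; first apply: (@slice_vfield (fun=> 1) (shift_cov j) j (smooth_cst _ _)
    (smooth_shift_cov j)).
    by move=> y; left => z zy; rewrite -zy shift_cov_base.
  by rewrite /=; case: pselect => [?|]; rewrite ?shift_cov_base// scale1r.
have /choice[H HP] j : exists U, vfield ST U /\
    U x = tmap ST (fun y => transport (x, y)) (V j (base x)).
  by have [U ? ?] := Hv j; exists U.
have /choice[K KP] j : exists U, vfield ST U /\
    U x = tmap ST (fun y => shift_cov j (x, y)) (V j (base x)).
  by have [U ? ?] := Vv j; exists U.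
have HT j : tangent ST x (H j x) by apply: vfield_tangent; exact: (HP j).1.
have KT j : tangent ST x (K j x) by apply: vfield_tangent; exact: (KP j).1.
have qb i : smooth ST (q i \o @base R T S) by exact: smooth_base.
have Hq j i : H j x (q i \o @base R T S) = (j == i)%:R.
  by rewrite (HP j).2 tmapE//; exact: (frame Nx).1.
have Kq j i : K j x (q i \o @base R T S) = 0.
  rewrite (KP j).2 tmapE//.
  exact: (tangent_cst (VT j (base x)) (q i (base x))).
have Kp j i : K j x (momentum_fun (V i)) = (i == j)%:R.
  rewrite (KP j).2 tmapE//; last exact: smooth_momentum_fun.
  have -> : momentum_fun (V i) \o (fun y => shift_cov j (x, y)) =
      fun y => momentum_fun (V i) x + (q j y - q j (base x)) * (i == j)%:R.
    apply/funext => y; rewrite /= {1}/momentum_fun {1}/cov /= asboolT; last exact: VT.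
    by rewrite (frame Nx).1.
  have VTx := VT j (base x); have cs c := smooth_cst S c.
  rewrite (tangentD VTx)//; last by apply: smoothM => //; exact: smoothB.
  rewrite (tangent_cst VTx) add0r (tangentM VTx)//; last exact: smoothB.
  rewrite (tangentB VTx)// !(tangent_cst VTx) (frame Nx).1 eqxx subr0 mulr0 addr0 mul1r.
  by [].
(* The horizontal part may already change the momenta; the vertical coefficients supply only the
   difference. *)
pose c j := u (momentum_fun (V j)) - \sum_i u (q i \o @base R T S) * H i x (momentum_fun (V j)).
exists (fun y => \sum_j (u (q j \o @base R T S) *: H j y) + \sum_j (c j *: K j y)).
  have VH := @vfield_sum _ _ ST _ (index_enum 'I_n) (fun j _ => u (q j \o @base R T S)) H
    (fun j => smooth_cst _ _) (fun j => (HP j).1).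
  have VK := @vfield_sum _ _ ST _ (index_enum 'I_n) (fun j _ => c j) K
    (fun j => smooth_cst _ _) (fun j => (KP j).1).
  split=> [y|f fs]; first exact: tangent_add (vfield_tangent y VH) (vfield_tangent y VK).
  exact: smoothD (vfield_smooth VH fs) (vfield_smooth VK fs).
apply: (tangent_cotangent_ext xp _ Tu).
- by apply: tangent_add; apply: tangent_sumv => j; exact: tangent_scale.
- move=> i; rewrite /= vec_addE !vec_sumE (bigD1 i)//= big1 => [|j ji]; last first.
    by rewrite vec_scaleE Hq (negPf ji) mulr0.
  rewrite vec_scaleE Hq eqxx big1 => [|j _]; last by rewrite vec_scaleE Kq mulr0.
  by rewrite !addr0 mulr1.
move=> i; rewrite /= vec_addE !vec_sumE [X in _ + X](bigD1 i)//=.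
rewrite [X in _ + (_ + X)]big1 => [|j ji]; last first.
  by rewrite vec_scaleE Kp eq_sym (negPf ji) mulr0.
rewrite vec_scaleE Kp eqxx addr0 /c mulr1.
under eq_bigr do rewrite vec_scaleE.
by rewrite addrCA subrr addr0.
Qed.

End Frame.
End Cotangent.

(** * The canonical forms in a frame *)

Section CotangentForms.
Context {R : realType} {n : nat} {T : Type} (S : set (T -> R)).
Hypothesis mS : manifold n S.
Local Notation ST := (cotangent_structure S).

Lemma cotangent_extend (x : cotangent S) u : tangent ST x u -> exists2 U, vfield ST U & U x = u.
Proof.
have [q [V [N [qs VV nN frame _]]]] := manifold_frame (base x) mS.
exact: (cotangent_extend_frame qs VV nN frame).
Qed.

Lemma ThetaQ_smooth_form : smooth_form ST (@ThetaQ R T S).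
Proof.
move=> x; have [q [V [N [qs VV nN frame _]]]] := manifold_frame (base x) mS.
exists n, (fun j => momentum_fun (V j)), (fun j => q j \o @base R T S); split.
- by move=> j; exact: smooth_momentum_fun.
- by move=> j; exact: smooth_base.
- apply: filterS (near_base nN erefl) => y Ny w Tw.
  exact: (ThetaQ_local qs VV frame Ny Tw).
Qed.

(** Near [x] Theta is [sum p_j dq_j] with [p_j = momentum_fun (V j)], so this is the expression
    [sum dq_j ^ dp_j] of Omega. *)
Lemma OmegaQ_frame (q : 'I_n -> T -> R) (V : 'I_n -> T -> vec (R := R) T)
    (N : set (space_of S)) (x : cotangent S) u v :
  (forall j, smooth S (q j)) -> (forall j, vfield S (V j)) ->
  nbhs (base x : space_of S) N ->
  (forall y, N y -> (forall i j, V i y (q j) = (i == j)%:R) /\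
     (forall v, tangent S y v -> v = \sum_j v (q j) *: V j y)) ->
  tangent ST x u -> tangent ST x v ->
  OmegaQ x u v = \sum_j (v (momentum_fun (V j)) * u (q j \o @base R T S) -
                         u (momentum_fun (V j)) * v (q j \o @base R T S)).
Proof.
move=> qs VV nN frame Tu Tv; rewrite /OmegaQ.
have loc : local_form ST (@ThetaQ R T S) x (fun j => momentum_fun (V j))
    (fun j => q j \o @base R T S).
  split=> [j|j|]; [exact: smooth_momentum_fun|exact: smooth_base|].
  apply: filterS (near_base nN erefl) => y Ny w Tw.
  exact: (ThetaQ_local qs VV frame Ny Tw).
rewrite (extdE ThetaQ_smooth_form loc (cotangent_extend Tu) (cotangent_extend Tv)).
by rewrite -sumrN; apply: eq_bigr => j _; rewrite opprB.
Qed.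

Lemma OmegaQ_anti (x : cotangent S) u v : tangent ST x u -> tangent ST x v ->
  OmegaQ x u v = - OmegaQ x v u.
Proof.
have [q [V [N [qs VV nN frame _]]]] := manifold_frame (base x) mS.
move=> Tu Tv; rewrite !(OmegaQ_frame qs VV nN frame)//.
by rewrite -sumrN; apply: eq_bigr => j _; ring.
Qed.

Lemma OmegaQ_subl (x : cotangent S) u u' v : tangent ST x u -> tangent ST x u' ->
  tangent ST x v -> OmegaQ x (u - u') v = OmegaQ x u v - OmegaQ x u' v.
Proof.
have [q [V [N [qs VV nN frame _]]]] := manifold_frame (base x) mS.
move=> Tu Tu' Tv; rewrite !(OmegaQ_frame qs VV nN frame)//; last exact: tangent_sub.
rewrite -sumrB; apply: eq_bigr => j _.
have E f : (u - u') f = u f - u' f by [].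
by rewrite !E; ring.
Qed.

End CotangentForms.

(** * Free actions *)

Section InvariantForm.
Context {R : realType} {G P : Type} (SG : set (G -> R)) (SP : set (P -> R)).
Variables (a : G -> P -> P) (e : G).
Hypotheses (as_ : smooth_map (prod_structure SG SP) SP (fun z => a z.1 z.2))
  (ae : forall x, a e x = x).

Lemma orbit_smooth x : smooth_map SG SP (fun g => a g x).
Proof. exact: (smooth_map_comp (@smooth_pairl _ _ _ SG SP x) as_). Qed.

Lemma act_map_smooth g : smooth_map SP SP (a g).
Proof. exact: (smooth_map_comp (@smooth_pairr _ _ _ SG SP g) as_). Qed.

(* At a point where the local one-form [\sum_i A i * d(B i)] takes a constant value along
   the action on the transported vector [u], Cartan's formula loses its Lie derivative term. *)
Lemma invariant_form_extd k (A B : 'I_k -> P -> R) (p : P)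
    (u : vec (R := R) P) (ka : vec (R := R) G) :
  (forall i, smooth SP (A i)) -> (forall i, smooth SP (B i)) ->
  tangent SP p u -> tangent SG e ka ->
  (exists C, \forall g \near (e : space_of SG),
     \sum_i A i (a g p) * u (fun x => B i (a g x)) = C) ->
  let v x := tmap SP (fun g => a g x) ka in
  \sum_i (u (A i) * v p (B i) - v p (A i) * u (B i)) =
  u (fun x => \sum_i A i x * v x (B i)).
Proof.
move=> As Bs Tu Tk [C HC] v.
have Phis i : smooth (prod_structure SG SP) (fun z => B i (a z.1 z.2)) by exact: as_ (Bs i).
have Avs i : smooth SG (fun g => A i (a g p)) by exact: orbit_smooth (As i).
have uBs i : smooth SG (fun g => u (fun x => B i (a g x))).
  exact: (smooth_partial_vec (Phis i) Tu).
have swap : smooth_map (prod_structure SP SG) (prod_structure SG SP) (fun z => (z.2, z.1)).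
  by apply: smooth_pair; [exact: smooth_snd|exact: smooth_fst].
have vB x i : v x (B i) = ka (fun g => B i (a g x)) by rewrite /v tmapE.
have vA x i : v x (A i) = ka (fun g => A i (a g x)) by rewrite /v tmapE.
have vBs i : smooth SP (fun x => v x (B i)).
  under eq_fun do rewrite vB.
  exact: (smooth_partial_vec (swap _ (Phis i)) Tk).
(* Differentiating the constant along [ka] expresses the vanishing Lie derivative; [tangent_commute]
   then moves [u] outside, where it acts on [v x (B i)]. *)
have key : \sum_i (v p (A i) * u (B i) + A i p * u (fun x => v x (B i))) = 0.
  have Ms i := smoothM (Avs i) (uBs i).
  have := tangent_local Tk (smooth_sum _ Ms) (smooth_cst SG C) HC.
  rewrite (tangent_cst Tk) (tangent_sum Tk)// => H; rewrite -[RHS]H.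
  apply: eq_bigr => i _; rewrite (tangentM Tk)// ae vA; congr (_ * u _ + _ * _).
    by apply/funext => x; rewrite ae.
  rewrite (tangent_commute (Phis i) Tk Tu); congr (u _).
  by apply/funext => x; rewrite vB.
have Ms i := smoothM (As i) (vBs i).
rewrite (tangent_sum Tu)// -[LHS]addr0 -[X in _ + X]key -big_split/=.
apply: eq_bigr => i _; rewrite (tangentM Tu)//; ring.
Qed.

End InvariantForm.

Section InteriorMin.
Context {R : realType} {n : nat}.

Lemma sphere_compact (a : 'rV[R]_n) (e : R) : compact [set y : 'rV[R]_n | `|y - a| = e].
Proof.
have cN : continuous (fun y : 'rV[R]_n => `|y - a|).
  move=> z; have cB : {for z, continuous (fun w : 'rV[R]_n => w - a : 'rV[R]_n)}.
    by apply: continuousB; [exact: cvg_id|exact: cst_continuous].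
  exact: (continuous_comp cB (@norm_continuous _ _ _)).
apply: (subclosed_compact _ (@closed_ball_compact _ _ a e)) => [|y /= ->//].
rewrite -[X in closed X]/((fun y : 'rV[R]_n => `|y - a|) @^-1` [set e]).
by apply: preimage_closed => [z _|]; [exact: cN|exact: closed_eq].
Qed.

Lemma interior_min_partial (F : 'rV[R]_n -> R) (c : 'rV[R]_n) (i : 'I_n) (d : R) : 0 < d ->
  (forall y, `|y - c| < d -> derivable F y 'e_i /\ F c <= F y) -> 'D_('e_i) F c = 0.
Proof.
move=> d0 cF.
have near_c (t : R) : `|t| < d -> `|t *: 'e_i + c - c| < d.
  by move=> td; rewrite addrK normrZ norm_delta_rV mulr1.
have dl (t : R) : t \in `]-d, d[ -> is_derive t 1 (fun s : R => F (s *: 'e_i + c))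
    ('D_('e_i) F (t *: 'e_i + c)).
  rewrite in_itv/= -ltr_norml => td; apply: is_derive_line.
  by have [] := cF _ (near_c t td).
have h := @derive1_at_min R (fun s : R => F (s *: 'e_i + c)) (- d) d 0.
have [||||_ h0] := h.
- by rewrite ltW// gtrN.
- by move=> t /dl[].
- by rewrite in_itv/= oppr_lt0 d0.
- move=> t; rewrite in_itv/= -ltr_norml => td; rewrite scale0r add0r.
  by have [_] := cF _ (near_c t td).
have i0 : 0 \in `]-d, d[ by rewrite in_itv/= oppr_lt0 d0.
have [_] := dl 0 i0.
by rewrite h0 scale0r add0r.
Qed.

End InteriorMin.

(** * Infinitesimal freeness of a free action *)

Section FreeAction.
Context {R : realType} (k n : nat) (G : groupType) (SG : set (G -> R)).
Context (Q : Type) (SQ : set (Q -> R)).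
Hypotheses (GP : lie_group k SG) (QP : manifold n SQ).
Variable a : G -> Q -> Q.
Hypotheses (aP : is_action a) (as_ : smooth_map (prod_structure SG SQ) SQ (fun z => a z.1 z.2))
  (afree : free_action a).

(* If ka generated a field vanishing at q0, its left-invariant extension would kill
   g |-> f (g q0) for every f. On a small ball around 1, the function lam * d - l, where d
   measures the distance of g q0 to q0 and l increases along the field, is then decreasing
   along the field, so it has no interior minimum; but by freeness it is positive on the
   sphere for lam large, while it vanishes at the centre. *)
Lemma free_orbit_injective (ka : vec (R := R) G) (q0 : Q) : tangent SG 1%g ka ->
  tmap SQ (fun g => a g q0) ka = 0 -> ka = 0.
Proof.
move=> Tk ka0; apply: contrapT => kaN0.
have [mG mulG _] := GP; have [a1 aM] := aP.
have [lc [Vl [Nl [lcs VlV nNl framel _]]]] := manifold_frame 1%g mG.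
have [j kj] : exists j, ka (lc j) != 0.
  apply: contrapT => /forallNP kl; apply: kaN0.
  rewrite ((framel _ (nbhs_singleton nNl)).2 ka Tk) big1// => i _.
  by have /negP := kl i; rewrite negbK => /eqP ->; rewrite scale0r.
(* Scaled so that [l] grows at rate [1] along the field at the identity, hence at a positive rate
   nearby. *)
pose l g := (ka (lc j))^-1 * lc j g.
have ls : smooth SG l by apply: smoothM => //; exact: smooth_cst.
have kal : ka l = 1 by rewrite (tangentZ Tk)// mulVf.
pose Xf g := tmap SG (fun h => (g * h)%g) ka.
have mulg_smooth g : smooth_map SG SG (fun h => (g * h)%g).
  exact: (smooth_map_comp (@smooth_pairr _ _ _ SG SG g) mulG).
have XT g : tangent SG g (Xf g).
  by have := tmap_tangent (mulg_smooth g) Tk; rewrite mulg1.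
have Xls : smooth SG (fun g => Xf g l).
  have -> : (fun g => Xf g l) = (fun g => ka (fun h => l (g * h)%g)).
    by apply/funext => g; rewrite /Xf tmapE.
  exact: (smooth_partial_vec (mulG _ ls) Tk).
have X1 : Xf 1%g l = 1.
  by rewrite /Xf tmapE// -[RHS]kal; congr ka; apply/funext => h /=; rewrite mul1g.
have orbs : smooth_map SG SQ (fun g => a g q0) by exact: (orbit_smooth as_).
(* As [g * h] acts by [h] and then [g], the field at [g] differentiates [f \o a g] along the orbit
   map at the identity, whose derivative is zero by assumption. *)
have Xorb g f : smooth SQ f -> Xf g (fun h => f (a h q0)) = 0.
  move=> fs; rewrite /Xf tmapE; last exact: orbs fs.
  have fgs : smooth SQ (f \o a g) by exact: (act_map_smooth as_ g) fs.
  have := congr1 (fun w => w (f \o a g)) ka0; rewrite tmapE// => h; rewrite -[RHS]h.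
  by congr ka; apply/funext => h' /=; rewrite aM.
have [q [_ [Nq [qs _ nNq _ qinj]]]] := manifold_frame q0 QP.
pose d x := \sum_i (q i x - q i q0) ^+ 2.
have ds : smooth SQ d.
  apply: smooth_sum => i; have h : smooth SQ (fun x => q i x - q i q0).
    by apply: smoothB => //; exact: smooth_cst.
  by under eq_fun do rewrite expr2; exact: smoothM.
pose D g := d (a g q0); have Ds : smooth SG D by exact: orbs ds.
have [_ _ /(_ 1%g)[U U1 [phi Uphi]]] := mG.
have [[oU oV] inj phis _] := Uphi.
pose P := [set g : space_of SG | 0 < Xf g l /\ Nq (a g q0)].
have nP : nbhs (1%g : space_of SG) P.
  have n1 : \forall g \near (1%g : space_of SG), 0 < Xf g l.
    have : \forall t \near Xf 1%g l, 0 < t by apply: lt_nbhsr; rewrite X1.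
    exact: (smooth_continuous Xls).
  have n2 : \forall g \near (1%g : space_of SG), Nq (a g q0).
    by apply: (@smooth_map_cvg _ _ _ _ _ _ (1%g : G) orbs Nq); rewrite a1.
  exact: (filterI n1 n2).
have /nbhs_ballP[e2 /= e20 BP] := chart_nbhs Uphi U1 nP.
pose c0 := phi 1%g; pose e := e2 / 2.
have e0 : 0 < e by rewrite divr_gt0.
pose B := [set y : 'rV[R]_k | `|y - c0| <= e].
have BG y : B y -> exists g, [/\ P g, U g & phi g = y].
  move=> By; have [|g [Pg Ug] <-] := BP y; last by exists g.
  rewrite -ball_normE/= distrC (le_lt_trans By)// /e ltr_pdivrMr// ltr_pMr//.
  by rewrite (_ : 1 = 1%:R)// ltr_nat.
have BV y : B y -> [set phi x | x in U] y by move=> /BG[g [_ Ug <-]]; exists g.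
have [lC lE] := chart_funP Uphi ls; have [DC DE] := chart_funP Uphi Ds.
pose Fl := chart_fun U phi l; pose FD := chart_fun U phi D.
have cB F : Cinfty_on [set phi x | x in U] F -> {within B, continuous F}.
  move=> FC; apply: continuous_in_subspaceT => y; rewrite inE => By.
  exact: (Cinfty_on_continuous FC (BV y By)).
have D1 : D 1%g = 0 by rewrite /D a1 /d big1// => i _; rewrite subrr expr0n.
(* Freeness enters here: the coordinates separate points of [Nq], so [D g = 0] puts [g] in the
   stabiliser of [q0]. *)
have D0 g : P g -> D g = 0 -> g = 1%g.
  move=> [_ Ng] Dg; apply: (afree (q := q0)); apply: qinj => //.
    exact: (nbhs_singleton nNq).
  move=> i; apply/eqP; rewrite -subr_eq0 -sqrf_eq0; apply/eqP.
  move/eqP: Dg; rewrite psumr_eq0 => [/allP/(_ i)|? _]; rewrite ?sqr_ge0//.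
  by rewrite mem_index_enum => /(_ isT)/eqP.
pose Sph := [set y : 'rV[R]_k | `|y - c0| = e].
have SB y : Sph y -> B y by rewrite /Sph /B /= => ->.
(* The index [j] provides a coordinate direction, without which the sphere would be empty. *)
have Sph0 : Sph !=set0.
  by exists (e *: 'e_j + c0); rewrite /Sph/= addrK normrZ (gtr0_norm e0) norm_delta_rV mulr1.
have [s sS smin] := EVT_min_rV Sph0 (@sphere_compact _ _ c0 e)
  (continuous_subspaceW SB (cB _ DC)).
have m0 : 0 < FD s.
  move: sS; rewrite inE => sS; have [g [Pg Ug gs]] := BG s (SB _ sS).
  have Dge0 : 0 <= D g by apply: sumr_ge0 => i _; exact: sqr_ge0.
  rewrite -gs /FD -DE// lt_neqAle Dge0 andbT eq_sym; apply/eqP => /(D0 g Pg) g1.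
  by move: sS; rewrite /Sph /= -gs g1 subrr normr0 => /eqP; rewrite lt_eqF.
have B0 : B !=set0 by exists c0; rewrite /B /= subrr normr0 ltW.
have cB' := @closed_ball_compact _ _ c0 e.
have [t _ tmax] := EVT_max_rV B0 cB' (cB _ lC).
(* On the sphere [lam * FD] is at least [|Fl t - Fl c0| + 1], which exceeds every increase of [Fl]
   from the centre since [t] maximises [Fl]. So [F] is larger there than its central value
   [- Fl c0]. *)
pose lam := (`|Fl t - Fl c0| + 1) / FD s.
pose F y := lam * FD y - Fl y.
have FC : Cinfty_on [set phi x | x in U] F.
  by apply: Cinfty_onB => //; apply: Cinfty_onM => //; exact: Cinfty_on_cst.
have [c cIn cmin] := EVT_min_rV B0 cB' (cB _ FC).
move: cIn; rewrite inE => Bc.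
have Fc0 : F c <= - Fl c0.
  have c0B : c0 \in B by rewrite inE /B /= subrr normr0 ltW.
  by apply: le_trans (cmin c0 c0B) _; rewrite /F /FD -DE// D1 mulr0 add0r.
have cint : `|c - c0| < e.
  rewrite lt_neqAle Bc andbT; apply/eqP => Sc.
  have h1 : FD s <= FD c by apply: smin; rewrite inE.
  have h2 : Fl c <= Fl t by apply: tmax; rewrite inE.
  have h3 : `|Fl t - Fl c0| + 1 <= lam * FD c.
    by rewrite /lam mulrAC ler_pdivlMr// ler_pM2l// ltr_wpDl.
  have := ler_norm (Fl t - Fl c0); move: Fc0; rewrite /F; lra.
have [g [Pg Ug gc]] := BG c Bc.
have dF i : 'D_('e_i) F c = 0.
  apply: (@interior_min_partial _ _ F c i (e - `|c - c0|)); first by rewrite subr_gt0.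
  move=> y; rewrite ltrBrDr => yc.
  have By : B y.
    rewrite /B /= -(subrKA c) (le_trans (ler_normD _ _))// ltW//.
  split; last by apply: cmin; rewrite inE.
  exact: (Cinfty_on_derivable FC (BV y By)).
have /choice[u uP] (i : 'I_k) : exists u, smooth SG u /\
    \forall x \near (g : space_of SG), u x = phi x 0 i.
  by have [u ? ?] := smooth_globalize (phis i g Ug); exists u.
have un : \forall x \near (g : space_of SG), forall i, u i x = phi x 0 i.
  by apply: (@filter_forall _ _ _ (nbhs (g : space_of SG))) => i; exact: (uP i).2.
have us i := (uP i).1.
have ug : \row_i u i g = c.
  by apply/rowP => i; rewrite mxE (nbhs_singleton un) gc.
have hs : smooth SG (fun x => lam * D x - l x).
  by apply: smoothB => //; apply: smoothM => //; exact: smooth_cst.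
have nh : \forall x \near (g : space_of SG), lam * D x - l x = F (\row_i u i x).
  apply: filterS2 un (open_nbhs_nbhs (conj oU Ug)) => x ux Ux.
  have -> : \row_i u i x = phi x by apply/rowP => i; rewrite mxE ux.
  by rewrite /F /FD /Fl -DE// -lE.
(* The partials of [F] vanish at the interior minimum, so the field kills [lam * D - l]. It also
   kills [D], which leaves [Xf g l = 0] against its positivity on [P]. *)
have := tangent_chain (XT g) us hs oV _ FC nh.
rewrite ug => /(_ (BV c Bc)).
rewrite big1 => [|i _]; last by rewrite dF mul0r.
have lDs : smooth SG (fun x => lam * D x) by apply: smoothM => //; exact: smooth_cst.
rewrite (tangentB (XT g) lDs ls) (tangentZ (XT g))// Xorb// mulr0 sub0r.
by move=> /eqP; rewrite oppr_eq0 gt_eqF//; exact: Pg.1.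
Qed.

End FreeAction.

Section OrbitFields.
Context {R : realType} {G P : Type} (SG : set (G -> R)) (SP : set (P -> R)).
Variables (a : G -> P -> P) (e : G).
Hypotheses (as_ : smooth_map (prod_structure SG SP) SP (fun z => a z.1 z.2))
  (ae : forall x, a e x = x).

Lemma orbit_vfield (ka : vec (R := R) G) : tangent SG e ka ->
  vfield SP (fun x => tmap SP (fun g => a g x) ka).
Proof.
move=> Tk; split=> [x|f fs].
  by have := tmap_tangent (orbit_smooth as_ x) Tk; rewrite ae.
have -> : (fun x => tmap SP (fun g => a g x) ka f) = (fun x => ka (fun g => f (a g x))).
  by apply/funext => x; rewrite tmapE.
have swap : smooth_map (prod_structure SP SG) (prod_structure SG SP) (fun z => (z.2, z.1)).
  by apply: smooth_pair; [exact: smooth_snd|exact: smooth_fst].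
exact: (smooth_partial_vec (swap _ (as_ fs)) Tk).
Qed.

End OrbitFields.

Lemma distribution_tangent (R : realType) r T (S : set (T -> R)) (D : T -> set (vec T)) q :
  Defs.distribution r S D -> D q `<=` tangent S q.
Proof.
move=> /(_ q)[U [_ Uq] [X XV DX]] v.
rewrite (DX q Uq).1 => -[c _ <-]; apply: tangent_sumv => i.
by apply: tangent_scale; exact: vfield_tangent.
Qed.

Lemma distribution_lin (R : realType) r T (S : set (T -> R)) (D : T -> set (vec T)) q (c : R) u v :
  Defs.distribution r S D -> D q u -> D q v -> D q (c *: u + v).
Proof.
move=> /(_ q)[U [_ Uq] [X XV DX]]; rewrite (DX q Uq).1 => -[a _ <-] [b _ <-].
exists (fun i => c * a i + b i) => //.
rewrite scaler_sumr -big_split/=; apply: eq_bigr => i _.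
by rewrite scalerDl scalerA.
Qed.

Lemma distribution_sum (R : realType) r T (S : set (T -> R)) (D : T -> set (vec T)) q
    (I : Type) (s : seq I) (c : I -> R) (u : I -> vec (R := R) T) :
  Defs.distribution r S D -> (forall i, D q (u i)) -> D q (\sum_(i <- s) c i *: u i).
Proof.
move=> dD Du; elim: s => [|i s IH]; last by rewrite big_cons; apply: distribution_lin dD (Du i) IH.
rewrite big_nil; have [U [_ Uq] [X XV DX]] := dD q; rewrite (DX q Uq).1.
by exists (fun=> 0) => //; rewrite big1// => i _; rewrite scale0r.
Qed.

(** * Nonholonomic systems with symmetry *)

Section Metric.
Context {R : realType} (N : nh_system R).
Local Notation Q := (conf N).
Local Notation SQ := (conf_str N).
Local Notation vecQ := (vec (R := R) Q).
Implicit Types (q : Q) (u v w : vecQ).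

Lemma metric_lin q (c : R) u v w : tangent SQ q u -> tangent SQ q v -> tangent SQ q w ->
  metric q (c *: u + v) w = c * metric q u w + metric q v w.
Proof. by have [/(_ q)[h _ _] _] := metricP N; exact: h. Qed.

Lemma metric_sym q u v : tangent SQ q u -> tangent SQ q v -> metric q u v = metric q v u.
Proof. by have [/(_ q)[_ h _] _] := metricP N; exact: h. Qed.

Lemma metric_pos q u : tangent SQ q u -> u != 0 -> 0 < metric q u u.
Proof. by have [/(_ q)[_ _ h] _] := metricP N; exact: h. Qed.

Lemma metric_add q u v w : tangent SQ q u -> tangent SQ q v -> tangent SQ q w ->
  metric q (u + v) w = metric q u w + metric q v w.
Proof. by move=> Tu Tv Tw; rewrite -[u]scale1r metric_lin// scale1r mul1r. Qed.

Lemma metric0 q w : tangent SQ q w -> metric q 0 w = 0.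
Proof.
move=> Tw; have := metric_add (tangent0 SQ q) (tangent0 SQ q) Tw.
by rewrite addr0 => h; lra.
Qed.

Lemma flat_covector q v : tangent SQ q v -> covector SQ q (flat q v).
Proof.
move=> Tv; split=> [w nw|c u w Tu Tw]; first by rewrite /flat asboolF.
have Tl := tangent_lin c Tu Tw; rewrite /flat !asboolT//.
rewrite (metric_sym Tv Tl) metric_lin//.
by rewrite (metric_sym Tu Tv) (metric_sym Tw Tv).
Qed.

Lemma flatE q v w : tangent SQ q w -> flat q v w = metric q v w.
Proof. by move=> Tw; rewrite /flat asboolT. Qed.

Lemma sharp_flat q v : tangent SQ q v -> sharp q (flat q v) = v.
Proof.
move=> Tv; apply: the_unique => [//|u [Tu fuv]].
have Tuv := tangent_sub Tu Tv.
have E : metric q (u - v) (u - v) = 0.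
  have := congr1 (fun f => f (u - v)) fuv; rewrite !flatE// => h.
  rewrite addrC -scaleN1r in Tuv h *.
  by rewrite metric_lin// h; ring.
apply: contrapT => /eqP; rewrite -subr_eq0 => /(metric_pos Tuv).
by rewrite E ltxx.
Qed.

Lemma HM_flat (m : cmfd N) v : dist (tauM m) v -> cov (iotaM m) = flat (tauM m) v ->
  HM N m = metric (tauM m) v v - lagrangian (tauM m) v.
Proof.
move=> Dv mv; have Tv := distribution_tangent (@distP R N) Dv.
by rewrite /HM /hamiltonian -/(tauM m) mv sharp_flat// flatE.
Qed.

Lemma cmfd_ext (m m' : cmfd N) : tauM m = tauM m' ->
  (forall w, tangent SQ (tauM m') w -> cov (iotaM m) w = cov (iotaM m') w) -> m = m'.
Proof.
move=> tt cc; have : iotaM m = iotaM m'.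
  apply: cotangent_ext => //; apply/funext => w.
  have [Tw|nTw] := pselect (tangent SQ (tauM m') w); first exact: cc.
  by rewrite !cov_out// -/(tauM m) tt.
rewrite /iotaM; case: m m' {tt cc} => [x Hx] [y Hy] /= xy.
by case: _ / xy in Hy *; congr exist; exact: Prop_irrelevance.
Qed.

Lemma smooth_iotaM : smooth_map (cmfd_str N) (cotangent_structure SQ) (@iotaM R N).
Proof. exact: smooth_sub. Qed.

Lemma smooth_tauM : smooth_map (cmfd_str N) SQ (@tauM R N).
Proof. exact: (smooth_map_comp smooth_iotaM (@smooth_base _ _ SQ)). Qed.

Lemma ThetaM_E (m : cmfd N) (u : vec (R := R) (cmfd N)) :
  ThetaM m u = cov (iotaM m) (tmap SQ (@tauM R N) u).
Proof. by rewrite /ThetaM /ThetaQ (tmap_comp _ _ (@smooth_base _ _ SQ)). Qed.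

End Metric.

(** * The lifted action on the constraint submanifold *)

Section SymmetryFacts.
Context {R : realType} {N : nh_system R} (Y : symmetry N).
Local Notation Q := (conf N).
Local Notation SQ := (conf_str N).
Local Notation M := (cmfd N).
Local Notation SM := (cmfd_str N).
Local Notation G := (grp Y).
Local Notation SG := (grp_str Y).
Local Notation ST := (cotangent_structure SQ).
Local Notation vecQ := (vec (R := R) Q).
Local Notation vecM := (vec (R := R) M).
Local Notation vecG := (vec (R := R) G).
Implicit Types (g : G) (q : Q) (m : M).

Lemma act1 q : act Y 1%g q = q. Proof. by have [] := act_action Y. Qed.
Lemma actA g h q : act Y (g * h)%g q = act Y g (act Y h q).
Proof. by have [] := act_action Y. Qed.
Lemma actK g q : act Y g^-1%g (act Y g q) = q.
Proof. by rewrite -actA mulVg act1. Qed.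
Lemma actVK g q : act Y g (act Y g^-1%g q) = q.
Proof. by rewrite -actA mulgV act1. Qed.

Lemma smooth_act g : smooth_map SQ SQ (act Y g).
Proof. exact: (act_map_smooth (@act_smooth R N Y)). Qed.

Lemma tangent_act g q (v : vecQ) : tangent SQ q v -> tangent SQ (act Y g q) (tmap SQ (act Y g) v).
Proof. by move=> Tv; exact: (tmap_tangent (@smooth_act g)). Qed.

Lemma tangent_actV g q (v : vecQ) : tangent SQ (act Y g q) v ->
  tangent SQ q (tmap SQ (act Y g^-1%g) v).
Proof. by move=> Tv; rewrite -[q](actK g); exact: tangent_act. Qed.

Lemma tmap_actK g q (v : vecQ) : tangent SQ q v ->
  tmap SQ (act Y g^-1%g) (tmap SQ (act Y g) v) = v.
Proof.
move=> Tv; rewrite (tmap_comp _ _ (@smooth_act g^-1%g)).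
have -> : act Y g^-1%g \o act Y g = id by apply/funext => x; exact: actK.
exact: tmap_id Tv.
Qed.

Lemma tmap_actVK g q (v : vecQ) : tangent SQ q v ->
  tmap SQ (act Y g) (tmap SQ (act Y g^-1%g) v) = v.
Proof.
move=> Tv; rewrite (tmap_comp _ _ (@smooth_act g)).
have -> : act Y g \o act Y g^-1%g = id by apply/funext => x; exact: actVK.
exact: tmap_id Tv.
Qed.

Lemma dist_act g q (v : vecQ) : dist q v -> dist (act Y g q) (tmap SQ (act Y g) v).
Proof. by move=> Dv; rewrite -act_dist; exists v. Qed.

(** Invariance of the Lagrangian on the zero vector isolates the potential. *)
Lemma potential_act g q : potential (act Y g q) = potential q.
Proof.
have T0 := tangent0 SQ q; have := act_lagrangian g T0.
rewrite /lagrangian tmap0 !metric0//; last exact: tangent0.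
by move=> h; lra.
Qed.

(** Polarisation: once the potential is removed, invariance of the Lagrangian is invariance of the
    quadratic form. *)
Lemma metric_act g q (u v : vecQ) : tangent SQ q u -> tangent SQ q v ->
  metric (act Y g q) (tmap SQ (act Y g) u) (tmap SQ (act Y g) v) = metric q u v.
Proof.
have quad w : tangent SQ q w ->
    metric (act Y g q) (tmap SQ (act Y g) w) (tmap SQ (act Y g) w) = metric q w w.
  by move=> Tw; have := act_lagrangian g Tw; rewrite /lagrangian potential_act => h; lra.
have expand x (a b : vecQ) : tangent SQ x a -> tangent SQ x b ->
    metric x (a + b) (a + b) = metric x a a + 2 * metric x a b + metric x b b.
  move=> Ta Tb; have Tab := tangent_add Ta Tb.
  rewrite metric_add// (metric_sym Ta Tab) (metric_sym Tb Tab) !metric_add//.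
  by rewrite (metric_sym Tb Ta); ring.
move=> Tu Tv; have := quad _ (tangent_add Tu Tv).
rewrite tmap_add expand ?expand//; try exact: tangent_act.
by rewrite !quad// => h; lra.
Qed.

Lemma cmfd_flat m : exists2 v, dist (tauM m) v & cov (iotaM m) = flat (tauM m) v.
Proof. exact: (svalP m). Qed.

Lemma cmfd_make q (v : vecQ) : dist q v -> exists2 m : M, tauM m = q & cov (iotaM m) = flat q v.
Proof.
move=> Dv; have Tv := distribution_tangent (@distP R N) Dv.
pose x : cotangent SQ := exist _ (q, flat q v) (flat_covector Tv).
have Hx : in_constraint x by exists v.
by exists (exist _ x Hx).
Qed.

(** If [m] is the flat of [v] in D, the flat of the translate of [v] has the required values because
    the action is isometric, and it lies in the constraint because the action preserves D. *)
Lemma actM_spec g m : tauM (actM g m) = act Y g (tauM m) /\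
  forall w, tangent SQ (tauM (actM g m)) w ->
    cov (iotaM (actM g m)) w = cov (iotaM m) (tmap SQ (act Y g^-1%g) w).
Proof.
apply: (@the_ind _ m [set m' | tauM m' = act Y g (tauM m) /\
    forall w, tangent SQ (tauM m') w ->
      cov (iotaM m') w = cov (iotaM m) (tmap SQ (act Y g^-1%g) w)]).
have [v Dv mv] := cmfd_flat m; have Tv := distribution_tangent (@distP R N) Dv.
have [m' tm' cm'] := cmfd_make (dist_act g Dv).
exists m'; split=> // w; rewrite tm' => Tw.
rewrite cm' mv !flatE//; last exact: tangent_actV.
by rewrite -(metric_act g Tv (tangent_actV Tw)) (tmap_actVK g Tw).
Qed.

Lemma tauM_actM g m : tauM (actM g m) = act Y g (tauM m).
Proof. by have [] := actM_spec g m. Qed.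

Lemma cov_actM g m w : tangent SQ (act Y g (tauM m)) w ->
  cov (iotaM (actM g m)) w = cov (iotaM m) (tmap SQ (act Y g^-1%g) w).
Proof. by have [t h] := actM_spec g m; rewrite -t; exact: h. Qed.

Lemma actM1 m : actM (Y := Y) 1%g m = m.
Proof.
have t := tauM_actM 1%g m; rewrite act1 in t; apply: (cmfd_ext t) => w Tw.
have E : act Y 1%g = id by apply/funext => x; rewrite act1.
by rewrite cov_actM ?act1// invg1 E (tmap_id Tw).
Qed.

Lemma HM_actM g m : HM N (actM g m) = HM N m.
Proof.
have [v Dv mv] := cmfd_flat m; have Tv := distribution_tangent (@distP R N) Dv.
have cg : cov (iotaM (actM g m)) = flat (tauM (actM g m)) (tmap SQ (act Y g) v).
  apply/funext => w; rewrite tauM_actM.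
  have [Tw|nTw] := pselect (tangent SQ (act Y g (tauM m)) w); last first.
    by rewrite cov_out; [rewrite /flat asboolF|rewrite -/(tauM _) tauM_actM].
  rewrite cov_actM// mv !flatE//; last exact: tangent_actV.
  by rewrite -(metric_act g Tv (tangent_actV Tw)) (tmap_actVK g Tw).
rewrite (HM_flat _ cg); last by rewrite tauM_actM; exact: dist_act.
by rewrite (HM_flat Dv mv) /lagrangian tauM_actM metric_act// potential_act.
Qed.

(** A momentum function at [actM g m] pairs [m] with a vector pulled back by the inverse of [g].
    Expanding that vector in a frame separates coefficients smooth in [g] and the base point from
    the momenta of [m]. *)
Lemma actM_smooth : smooth_map (prod_structure SG SM) SM (fun z => actM z.1 z.2).
Proof.
have [_ _ invs] := grpP Y.
have base_s : smooth_map (prod_structure SG SM) SQ (fun z => act Y z.1 (tauM z.2)).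
  apply: (smooth_map_comp (S2 := prod_structure SG SQ) _ (@act_smooth R N Y)
    (phi := fun z => (z.1, tauM z.2))).
  apply: smooth_pair; first exact: smooth_fst.
  exact: (smooth_map_comp (@smooth_snd _ _ _ SG SM) (@smooth_tauM R N)).
apply: smooth_map_gens => _ [_ [[f fs ->]|[V VV ->]] <-].
  have -> : (f \o @base R Q SQ) \o sval \o (fun z => actM z.1 z.2) =
      f \o (fun z : G * M => act Y z.1 (tauM z.2)).
    by apply/funext => z; rewrite /= -tauM_actM.
  exact: base_s fs.
move=> z0; have [q [F [U [qs FV nU frame _]]]] := manifold_frame (tauM z0.2) (conf_manifold N).
pose c j (z : G * M) := V (act Y z.1 (tauM z.2)) (fun b => q j (act Y z.1^-1%g b)).
have cs j : smooth (prod_structure SG SM) (c j).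
  have Phis : smooth (prod_structure SG SQ) (fun z => q j (act Y z.1^-1%g z.2)).
    have h : smooth_map (prod_structure SG SQ) (prod_structure SG SQ) (fun z => (z.1^-1%g, z.2)).
      apply: smooth_pair; last exact: smooth_snd.
      exact: (smooth_map_comp (@smooth_fst _ _ _ SG SQ) invs).
    exact: (smooth_map_comp h (@act_smooth R N Y) (qs j)).
  have h : smooth_map (prod_structure SG SM) (prod_structure SG SQ)
      (fun z => (z.1, act Y z.1 (tauM z.2))).
    by apply: smooth_pair; [exact: smooth_fst|exact: base_s].
  exact: (h _ (smooth_partial Phis VV)).
have ps j : smooth (prod_structure SG SM) (momentum_fun (F j) \o @iotaM R N \o snd).
  exact: (smooth_map_comp (@smooth_snd _ _ _ SG SM) (@smooth_iotaM R N)
    (smooth_momentum_fun (FV j))).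
apply: (smooth_at_congr (f := fun z => \sum_j c j z * (momentum_fun (F j) \o @iotaM R N \o snd) z)).
  have nz : \forall z \near (z0 : space_of (prod_structure SG SM)), U (tauM z.2).
    by apply: (@smooth_map_cvg _ _ _ _ _ _ z0
      (smooth_map_comp (@smooth_snd _ _ _ SG SM) (@smooth_tauM R N)) U).
  apply: filterS nz => z Uz; rewrite /=.
  have -> : base (sval (actM z.1 z.2)) = act Y z.1 (tauM z.2) by rewrite -tauM_actM.
  have TV := vfield_tangent (act Y z.1 (tauM z.2)) VV.
  rewrite [RHS](cov_actM TV) (cov_frame FV frame Uz)//; last exact: tangent_actV.
  by apply: eq_bigr => j _; rewrite tmapE.
by apply: smooth_at_sum => j; apply: smooth_atM; [exact: cs|exact: ps].
Qed.

End SymmetryFacts.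

(** * Infinitesimal generators and their momenta *)

Section Generators.
Context {R : realType} {N : nh_system R} (Y : symmetry N).
Local Notation Q := (conf N).
Local Notation SQ := (conf_str N).
Local Notation M := (cmfd N).
Local Notation SM := (cmfd_str N).
Local Notation G := (grp Y).
Local Notation SG := (grp_str Y).
Local Notation ST := (cotangent_structure SQ).
Local Notation vecQ := (vec (R := R) Q).
Local Notation vecM := (vec (R := R) M).
Local Notation vecG := (vec (R := R) G).
Implicit Types (g : G) (q : Q) (m : M) (ka : vecG).

Lemma lie_alg_sub ka ka' : lie_alg ka -> lie_alg ka' -> lie_alg (ka - ka').
Proof. exact: tangent_sub. Qed.

Lemma lie_alg_sum (I : Type) (s : seq I) (c : I -> R) (ka : I -> vecG) :
  (forall i, lie_alg (ka i)) -> lie_alg (\sum_(i <- s) c i *: ka i).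
Proof. by move=> Tk; apply: tangent_sumv => i; apply: tangent_scale; exact: Tk. Qed.

Lemma genQ_lin (c : R) ka ka' q : genQ (c *: ka + ka') q = c *: genQ ka q + genQ ka' q.
Proof. exact: tmap_lin. Qed.

Lemma genQ_sub ka ka' q : genQ (ka - ka') q = genQ ka q - genQ ka' q.
Proof. exact: tmap_sub. Qed.

Lemma genQ_sum (I : Type) (s : seq I) (c : I -> R) (ka : I -> vecG) q :
  genQ (\sum_(i <- s) c i *: ka i) q = \sum_(i <- s) c i *: genQ (ka i) q.
Proof.
rewrite /genQ tmap_sum; apply: eq_bigr => i _; exact: tmap_scale.
Qed.

Lemma genM_sub ka ka' m : genM (ka - ka') m = genM ka m - genM ka' m.
Proof. exact: tmap_sub. Qed.

Lemma genQ_vfield ka : lie_alg ka -> vfield SQ (genQ ka).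
Proof. by move=> Tk; exact: (orbit_vfield (@act_smooth R N Y) (@act1 R N Y) Tk). Qed.

Lemma genM_vfield ka : lie_alg ka -> vfield SM (genM ka).
Proof. by move=> Tk; exact: (orbit_vfield (@actM_smooth R N Y) (@actM1 R N Y) Tk). Qed.

Lemma genQ_tangent ka q : lie_alg ka -> tangent SQ q (genQ ka q).
Proof. by move=> Tk; exact: vfield_tangent q (genQ_vfield Tk). Qed.

Lemma genM_tangent ka m : lie_alg ka -> tangent SM m (genM ka m).
Proof. by move=> Tk; exact: vfield_tangent m (genM_vfield Tk). Qed.

Lemma genQ_inj ka ka' q : lie_alg ka -> lie_alg ka' -> genQ ka q = genQ ka' q -> ka = ka'.
Proof.
move=> Tk Tk' E; apply/eqP; rewrite -subr_eq0; apply/eqP.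
apply: (free_orbit_injective (grpP Y) (conf_manifold N) (act_action Y)
  (@act_smooth R N Y) (@act_free R N Y) (q0 := q)); first exact: lie_alg_sub.
by rewrite -/(genQ (ka - ka') q) genQ_sub E subrr.
Qed.

Lemma tmap_tauM_genM ka m : tmap SQ (@tauM R N) (genM ka m) = genQ ka (tauM m).
Proof.
rewrite /genM (tmap_comp _ _ (@smooth_tauM R N)) /genQ.
have -> // : @tauM R N \o (fun g => actM g m) = fun g => act Y g (tauM m).
by apply/funext => g; rewrite /= tauM_actM.
Qed.

Lemma momentumE m ka : momentum m ka = cov (iotaM m) (genQ ka (tauM m)).
Proof. by rewrite /momentum ThetaM_E tmap_tauM_genM. Qed.

Lemma genM_HM ka m : lie_alg ka -> genM ka m (HM N) = 0.
Proof.
(* A tangent vector is zero by convention on a function that is not smooth; in the smooth case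
   invariance makes the function constant on the orbit. *)
move=> Tk; have [Hs|nHs] := pselect (smooth SM (HM N)); last first.
  by rewrite /genM /tmap /on_smooth asboolF.
rewrite /genM tmapE// (_ : _ \o _ = fun=> HM N m); first exact: (tangent_cst Tk).
by apply/funext => g; rewrite /= HM_actM.
Qed.

Lemma tmap_iotaM_momentum u (V : Q -> vecQ) : vfield SQ V ->
  tmap ST (@iotaM R N) u (momentum_fun V) = u (momentum_fun V \o @iotaM R N).
Proof. by move=> VV; rewrite tmapE//; exact: smooth_momentum_fun. Qed.

Lemma OmegaM_anti m u v : tangent SM m u -> tangent SM m v ->
  OmegaM m u v = - OmegaM m v u.
Proof.
move=> Tu Tv; apply: (OmegaQ_anti (conf_manifold N)).
  exact: (tmap_tangent (@smooth_iotaM R N) Tu).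
exact: (tmap_tangent (@smooth_iotaM R N) Tv).
Qed.

(** The lifted action transports covector and vector together, so the pairing of Theta with the
    translates of [u] is constant. Cartan's formula then leaves [u] applied to Theta on the
    generator, which is its momentum function. *)
Lemma OmegaM_genM ka m u : lie_alg ka -> tangent SM m u ->
  OmegaM m u (genM ka m) = - u (momentum_fun (genQ ka) \o @iotaM R N).
Proof.
move=> Tk Tu; have [q [V [U [qs VV nU frame _]]]] := manifold_frame (tauM m) (conf_manifold N).
pose A j := momentum_fun (V j) \o @iotaM R N; pose B j := q j \o @tauM R N.
have As j : smooth SM (A j) by exact: smooth_iotaM (smooth_momentum_fun (VV j)).
have Bs j : smooth SM (B j) by exact: smooth_tauM (qs j).
have TIu := tmap_tangent (@smooth_iotaM R N) Tu.
have Tv := genM_tangent m Tk; have TIv := tmap_tangent (@smooth_iotaM R N) Tv.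
rewrite /OmegaM (OmegaQ_frame (conf_manifold N) qs VV nU frame TIu TIv).
under eq_bigr => j _ do rewrite !(tmap_iotaM_momentum _ (VV j))
  !(tmapE _ _ (@smooth_base _ _ SQ _ (qs j))).
have Ttu := tmap_tangent (@smooth_tauM R N) Tu.
have inv : exists C, \forall g \near (1%g : space_of SG),
    \sum_j A j (actM g m) * u (fun x => B j (actM g x)) = C.
  exists (cov (iotaM m) (tmap SQ (@tauM R N) u)).
  have nU1 : \forall g \near (1%g : space_of SG), U (act Y g (tauM m)).
    apply: (@smooth_map_cvg _ _ _ _ _ _ (1%g : G) (orbit_smooth (@act_smooth R N Y) (tauM m)) U).
    by rewrite act1.
  apply: filterS nU1 => g Ug.
  have Tg := tangent_act g Ttu.
  transitivity (cov (iotaM (actM g m)) (tmap SQ (act Y g) (tmap SQ (@tauM R N) u))).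
    rewrite (cov_frame VV frame); rewrite -?/(tauM (actM g m)) ?tauM_actM//.
    apply: eq_bigr => j _; rewrite mulrC; congr (_ * _).
    rewrite tmapE// tmapE; last exact: smooth_act (qs j).
    by congr (u _); apply/funext => x; rewrite /B /= tauM_actM.
  by rewrite cov_actM// (tmap_actK g Ttu).
have := invariant_form_extd (@actM_smooth R N Y) (@actM1 R N Y) As Bs Tu Tk inv.
rewrite -/(genM ka) /= => E.
rewrite (_ : \sum_j _ = - \sum_j (u (A j) * genM ka m (B j) - genM ka m (A j) * u (B j))).
  rewrite E; congr (- _); apply: (tangent_local Tu).
  - apply: smooth_sum => j; apply: smoothM => //.
    exact: (vfield_smooth (genM_vfield Tk) (Bs j)).
  - exact: smooth_iotaM (smooth_momentum_fun (genQ_vfield Tk)).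
  have nUm : \forall x \near (m : space_of SM), U (tauM x).
    exact: (@smooth_map_cvg _ _ _ _ _ _ m (@smooth_tauM R N) U nU).
  apply: filterS nUm => x Ux /=; rewrite [RHS](cov_frame VV frame Ux (genQ_tangent _ Tk)).
  apply: eq_bigr => j _; rewrite mulrC; congr (_ * _).
  by rewrite -tmap_tauM_genM tmapE.
by rewrite -sumrN; apply: eq_bigr => j _; rewrite opprB.
Qed.

End Generators.

Section DualCoframe.
Context {R : realType} {T : Type} (S : set (T -> R)).

Lemma smooth_det k (A : T -> 'M[R]_k) : (forall i j, smooth S (fun x => A x i j)) ->
  smooth S (fun x => \det (A x)).
Proof.
move=> As; rewrite /determinant; apply: smooth_sum => s.
apply: smoothM; first exact: smooth_cst.
by move=> p; apply: smooth_at_prod => i; exact: As.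
Qed.

Lemma smooth_adj k (A : T -> 'M[R]_k) i j : (forall i j, smooth S (fun x => A x i j)) ->
  smooth S (fun x => \adj (A x) i j).
Proof.
move=> As; under eq_fun do rewrite mxE /cofactor.
apply: smoothM; first exact: smooth_cst.
apply: smooth_det => i' j'; under eq_fun do rewrite !mxE.
exact: As.
Qed.

(** A right inverse [N0] of the component matrix at [p] makes [M x *m N0] the identity at [p] and
    invertible nearby; the adjugate formula inverts it with smooth entries. *)
Lemma dual_coframe k n (q : 'I_n -> T -> R)
    (F : 'I_k -> T -> vec (R := R) T) (p : T) :
  (forall j, smooth S (q j)) -> (forall i, vfield S (F i)) ->
  (forall v, tangent S p v -> (forall j, v (q j) = 0) -> v = 0) ->
  (forall c : 'I_k -> R, \sum_i c i *: F i p = 0 -> forall i, c i = 0) ->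
  exists beta : 'I_k -> 'I_n -> T -> R, (forall i j, smooth S (beta i j)) /\
    \forall x \near (p : space_of S), forall i i',
      \sum_j beta i j x * F i' x (q j) = (i == i')%:R.
Proof.
move=> qs Fv inj indep; pose M x := \matrix_(i, j) F i x (q j).
have Ms i j : smooth S (fun x => M x i j).
  by under eq_fun do rewrite mxE; exact: vfield_smooth.
have free : row_free (M p).
  apply: inj_row_free => u uM; have uF : \sum_i u 0 i *: F i p = 0.
    apply: inj => [|j].
      by apply: tangent_sumv => i; apply: tangent_scale; exact: vfield_tangent.
    have := congr1 (fun A : 'rV_n => A 0 j) uM; rewrite !mxE => <-.
    by rewrite vec_sumE; apply: eq_bigr => i _; rewrite mxE.
  by apply/rowP => i; rewrite mxE (indep _ uF).
have [N0 MN0] := row_freeP free.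
pose M2 x := M x *m N0.
have M2s i j : smooth S (fun x => M2 x i j).
  under eq_fun do rewrite mxE; apply: smooth_sum => l.
  by apply: smoothM => //; exact: smooth_cst.
pose b i j x := (\det (M2 x))^-1 * (N0 *m \adj (M2 x)) j i.
have bs i j : smooth_at S (b i j) p.
  apply: smooth_atM; first (apply: smooth_atV; last exact: smooth_det).
    by rewrite /M2 MN0 det1 oner_neq0.
  rewrite /=; under eq_fun do rewrite mxE; apply: smooth_at_sum => l.
  by apply: smooth_atM; [exact: smooth_at_cst|exact: smooth_adj].
have /choice[be beP] (ij : 'I_k * 'I_n) : exists be, smooth S be /\
    \forall x \near (p : space_of S), be x = b ij.1 ij.2 x.
  by have [be ? ?] := smooth_globalize (bs ij.1 ij.2); exists be.
exists (fun i j => be (i, j)); split=> [i j|]; first exact: (beP (i, j)).1.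
have near_be : \forall x \near (p : space_of S), forall ij, be ij x = b ij.1 ij.2 x.
  by apply: (@filter_forall _ _ _ (nbhs (p : space_of S))) => ij; exact: (beP ij).2.
have near_det : \forall x \near (p : space_of S), \det (M2 x) != 0.
  have : \forall t \near \det (M2 p), t != 0.
    by apply: open_nbhs_nbhs; split; [exact: open_neq|rewrite /= /M2 MN0 det1 oner_neq0].
  exact: (smooth_continuous (smooth_det M2s)).
apply: filterS2 near_be near_det => x bex dx i i'.
under eq_bigr => j _ do rewrite bex /b /= -mulrA.
rewrite -mulr_sumr.
rewrite (_ : \sum_j _ = (M2 x *m \adj (M2 x)) i' i); last first.
  transitivity ((M x *m (N0 *m \adj (M2 x))) i' i); last by rewrite mulmxA.
  by rewrite mxE; apply: eq_bigr => j _; rewrite [M x i' j]mxE mulrC.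
by rewrite mul_mx_adj mxE eq_sym; case: eqP => _; rewrite ?mulr0// mulVf.
Qed.

End DualCoframe.

(** * The vertical complement and the form A_W *)

Section Complement.
Context {R : realType} {N : nh_system R} {Y : symmetry N} (W : vertical_complement Y).
Local Notation Q := (conf N).
Local Notation SQ := (conf_str N).
Local Notation M := (cmfd N).
Local Notation SM := (cmfd_str N).
Local Notation G := (grp Y).
Local Notation SG := (grp_str Y).
Local Notation vecQ := (vec (R := R) Q).
Local Notation vecM := (vec (R := R) M).
Local Notation vecG := (vec (R := R) G).
Implicit Types (g : G) (x : Q) (m : M) (ka : vecG).

Lemma dist_sub x (u v : vecQ) : dist x u -> dist x v -> dist x (u - v).
Proof. by rewrite addrC -scaleN1r => Du Dv; exact: (distribution_lin _ (@distP R N) Dv Du). Qed.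

Lemma vcomp_sub x (u v : vecQ) : vcomp W x u -> vcomp W x v -> vcomp W x (u - v).
Proof.
by rewrite addrC -scaleN1r => Du Dv; exact: (distribution_lin _ (@vcompP _ _ _ W) Dv Du).
Qed.

Lemma dist_vcomp0 x (v : vecQ) : dist x v -> vcomp W x v -> v = 0.
Proof.
move=> Dv Wv; have [_ E] := vcomp_direct W x.
by have : (dist x `&` vcomp W x) v by []; rewrite E.
Qed.

Lemma dist_vcomp_split x (v : vecQ) : tangent SQ x v ->
  exists d w, [/\ dist x d, vcomp W x w & v = d + w].
Proof.
have [-> _] := vcomp_direct W x.
by move=> [d Dd [w Ww <-]]; exists d, w.
Qed.

Lemma lie_alg_W_genQ x (w : vecQ) : vcomp W x w -> exists2 ze, lie_alg_W W x ze & w = genQ ze x.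
Proof.
by move=> Ww; have [ze Tz zw] := vcomp_vertical Ww; exists ze => //; split=> //; rewrite zw.
Qed.

(** Split the generator of [eta] along D and W. The W-part is vertical, so it comes from an algebra
    element, and removing that element from [eta] leaves a member of g_S. *)
Lemma proj_S_spec x (eta : vecG) : lie_alg eta ->
  lie_alg_S x (proj_S W eta x) /\ lie_alg_W W x (eta - proj_S W eta x).
Proof.
move=> Te; apply: (@the_ind _ 0 [set a | lie_alg_S x a /\ lie_alg_W W x (eta - a)]).
have [d [w [Dd Ww E]]] := dist_vcomp_split (genQ_tangent x Te).
have [ze Wz zw] := lie_alg_W_genQ Ww; have Tz := Wz.1.
exists (eta - ze); split; last by rewrite opprB addrCA subrr addr0.
have Tez := lie_alg_sub Te Tz; split=> //; split; last by exists (eta - ze).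
by rewrite genQ_sub E zw addrK.
Qed.

Lemma proj_along_unique (U : Type) (A B : set (vec (R := R) U)) (v a : vec (R := R) U) :
  (forall u w, A u -> A w -> B (v - u) -> B (v - w) -> u = w) ->
  A a -> B (v - a) -> proj_along A B v = a.
Proof. by move=> uq Aa Bva; apply: the_unique => // b [Ab Bvb]; exact: uq. Qed.

Lemma calW_genM ka m : lie_alg ka -> vcomp W (tauM m) (genQ ka (tauM m)) -> calW W m (genM ka m).
Proof. by move=> Tk Wk; split; [exists ka|rewrite tmap_tauM_genM]. Qed.

Lemma calC_sub m (u v : vecM) : calC m u -> calC m v -> calC m (u - v).
Proof.
move=> [Tu Du] [Tv Dv]; split; first exact: tangent_sub.
by rewrite tmap_sub; exact: dist_sub.
Qed.

Lemma calW_inj m (u v : vecM) : calW W m u -> calW W m v -> calC m (u - v) -> u = v.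
Proof.
move=> [[a Ta <-] Wa] [[b Tb <-] Wb] [_].
move: Wa Wb; rewrite tmap_sub !tmap_tauM_genM => Wa Wb Dab.
have E := dist_vcomp0 Dab (vcomp_sub Wa Wb).
by rewrite (genQ_inj Ta Tb (subr0_eq E)).
Qed.

Lemma calW_sub m (u v : vecM) : calW W m u -> calW W m v -> calW W m (u - v).
Proof.
move=> [[a Ta <-] Wa] [[b Tb <-] Wb]; rewrite -genM_sub.
apply: calW_genM; first exact: lie_alg_sub.
rewrite genQ_sub; apply: vcomp_sub; first by move: Wa; rewrite tmap_tauM_genM.
by move: Wb; rewrite tmap_tauM_genM.
Qed.

Lemma calW0 m : calW W m 0.
Proof.
have G0 : genM (0 : vecG) m = 0 by exact: tmap0.
have T0 : lie_alg (0 : vecG) by exact: tangent0.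
rewrite -G0; apply: calW_genM => //.
have [d [w [_ Ww _]]] := dist_vcomp_split (tangent0 SQ (tauM m)).
by have := vcomp_sub Ww Ww; rewrite subrr /genQ tmap0.
Qed.

Lemma projC_id m (u : vecM) : calC m u -> projC W m u = u.
Proof.
move=> Cu; apply: proj_along_unique => //; last by rewrite subrr; exact: calW0.
move=> a b Ca Cb Wa Wb; have Wab := calW_sub Wb Wa.
have E : u - b - (u - a) = a - b by rewrite opprB addrC -addrA addKr.
rewrite E in Wab; apply: subr0_eq; apply: (calW_inj Wab (calW0 m)).
by rewrite subr0; exact: calC_sub.
Qed.

(** Thus A_W sees only the W-part of the projection of [w] to [Q]. Infinitesimal freeness gives
    uniqueness both of the projection onto [calW] and of the algebra element. *)
Lemma formAE m (w : vecM) ka (d : vecQ) : tangent SM m w -> lie_alg ka ->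
  dist (tauM m) d -> vcomp W (tauM m) (genQ ka (tauM m)) ->
  tmap SQ (@tauM R N) w = d + genQ ka (tauM m) -> formA W m w = ka.
Proof.
move=> Tw Tk Dd Wk E; have Wka := calW_genM Tk Wk.
have P : projW W m w = genM ka m.
  apply: proj_along_unique => //.
    move=> a b Wa Wb Ca Cb; apply: (calW_inj Wa Wb).
    have := calC_sub Cb Ca.
    by have -> : w - b - (w - a) = a - b by rewrite opprB addrC -addrA addKr.
  split; first exact: tangent_sub Tw (genM_tangent m Tk).
  by rewrite tmap_sub tmap_tauM_genM E addrK.
apply: the_unique => [|b [Tb]]; first by rewrite P.
rewrite P => Eb; apply: (genQ_inj (q := tauM m) Tb Tk).
by rewrite -!tmap_tauM_genM Eb.
Qed.

Section Constant.
Variable h : set vecG.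
Hypothesis hW : forall x, lie_alg_W W x = h.

(** A frame of W at the single point [x0] is lifted through the generators; as all fibres of g_W are
    the same set, the lifted elements serve at every point. *)
Lemma lie_alg_W_basis x0 : exists s (e : 'I_s -> vecG),
  [/\ forall b x, lie_alg_W W x (e b),
      forall x ze, lie_alg_W W x ze -> exists c : 'I_s -> R, ze = \sum_b c b *: e b &
      forall c : 'I_s -> R, \sum_b c b *: e b = 0 -> forall b, c b = 0].
Proof.
have [U [_ Ux] [F Fv FW]] := @vcompP _ _ _ W x0; have [WE indep] := FW x0 Ux.
have FWb b : vcomp W x0 (F b x0).
  rewrite WE; exists (fun i => (i == b)%:R) => //.
  rewrite (bigD1 b)//= eqxx scale1r big1 ?addr0// => i ib.
  by rewrite (negPf ib) scale0r.
have /choice[e eP] b : exists e, lie_alg_W W x0 e /\ F b x0 = genQ e x0.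
  by have [e ? ?] := lie_alg_W_genQ (FWb b); exists e.
have eT b : lie_alg (e b) by exact: (eP b).1.1.
exists (vcomp_rank W), e; split.
- by move=> b x; rewrite hW -(hW x0); exact: (eP b).1.
- move=> x ze; rewrite hW -(hW x0) => -[Tz]; rewrite WE => -[c _ cE].
  exists c; apply: (genQ_inj (q := x0) Tz (lie_alg_sum _ _ eT)).
  by rewrite genQ_sum -cE; apply: eq_bigr => b _; rewrite (eP b).2.
- move=> c c0; apply: indep; transitivity (genQ (\sum_b c b *: e b) x0).
    by rewrite genQ_sum; apply: eq_bigr => b _; rewrite (eP b).2.
  by rewrite c0 /genQ tmap0.
Qed.

End Constant.
End Complement.

(** * The adapted coframe, the curvature K_W and the conservation law *)

Section Main.
Context {R : realType} {N : nh_system R} {Y : symmetry N} (W : vertical_complement Y).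
Local Notation Q := (conf N).
Local Notation SQ := (conf_str N).
Local Notation M := (cmfd N).
Local Notation SM := (cmfd_str N).
Local Notation G := (grp Y).
Local Notation SG := (grp_str Y).
Local Notation ST := (cotangent_structure SQ).
Local Notation vecQ := (vec (R := R) Q).
Local Notation vecM := (vec (R := R) M).
Local Notation vecG := (vec (R := R) G).
Local Notation n := (conf_dim N).
Implicit Types (g : G) (x : Q) (m : M) (ka : vecG).
Variable h : set vecG.
Hypothesis hW : forall x, lie_alg_W W x = h.

(* The coefficients along the constant frame of g_W of the projection onto W of v. *)
Definition coframe_eval s (q : 'I_n -> Q -> R) (beta : 'I_s -> 'I_n -> Q -> R) b x (v : vecQ) : R :=
  \sum_j beta b j x * v (q j).

Definition adapted s (e : 'I_s -> vecG) (q : 'I_n -> Q -> R) (beta : 'I_s -> 'I_n -> Q -> R) x :=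
  (forall b d, dist x d -> coframe_eval q beta b x d = 0) /\
  (forall b (c : 'I_s -> R), coframe_eval q beta b x (genQ (\sum_a c a *: e a) x) = c b).

Lemma coframe_eval_lin s q (beta : 'I_s -> 'I_n -> Q -> R) b x (c : R) (u v : vecQ) :
  coframe_eval q beta b x (c *: u + v) = c * coframe_eval q beta b x u + coframe_eval q beta b x v.
Proof.
rewrite /coframe_eval mulr_sumr -big_split; apply: eq_bigr => j _ /=.
by rewrite vec_addE vec_scaleE; ring.
Qed.

Lemma coframe_eval_add s q (beta : 'I_s -> 'I_n -> Q -> R) b x (u v : vecQ) :
  coframe_eval q beta b x (u + v) = coframe_eval q beta b x u + coframe_eval q beta b x v.
Proof. by rewrite -[u]scale1r coframe_eval_lin scale1r mul1r. Qed.

Lemma coframe_eval_sum s q (beta : 'I_s -> 'I_n -> Q -> R) b x (I : Type) (r : seq I)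
    (c : I -> R) (u : I -> vecQ) :
  coframe_eval q beta b x (\sum_(i <- r) c i *: u i) =
  \sum_(i <- r) c i * coframe_eval q beta b x (u i).
Proof.
elim: r => [|i r IH]; last by rewrite !big_cons coframe_eval_lin IH.
by rewrite !big_nil /coframe_eval big1// => j _; rewrite [X in _ * X](_ : _ = 0)// mulr0.
Qed.

(** A local frame of D and the generators of the [e b] are jointly independent at [x0]. The last [s]
    members of a dual coframe then annihilate D and read off the coefficients of the W-part. *)
Lemma adapted_coframe x0 : exists s (e : 'I_s -> vecG) (q : 'I_n -> Q -> R)
    (beta : 'I_s -> 'I_n -> Q -> R),
  [/\ forall b x, lie_alg_W W x (e b),
      forall x ze, lie_alg_W W x ze -> exists c : 'I_s -> R, ze = \sum_b c b *: e b,
      forall j, smooth SQ (q j), forall b j, smooth SQ (beta b j) &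
      \forall x \near (x0 : space_of SQ), adapted e q beta x].
Proof.
have [s [e [eW espan eindep]]] := lie_alg_W_basis hW x0.
have [q [V [U [qs VV nU frame _]]]] := manifold_frame x0 (conf_manifold N).
have [U' [oU' U'x] [X XV DX]] := @distP R N x0.
have eT b : lie_alg (e b) by have [] := eW b x0.
pose F (i : 'I_(dist_rank N + s)) : Q -> vecQ :=
  match fintype.split i with inl l => X l | inr b => genQ (e b) end.
have Fl l : F (lshift s l) = X l by rewrite /F (unsplitK (inl l)).
have Fr b : F (rshift (dist_rank N) b) = genQ (e b) by rewrite /F (unsplitK (inr b)).
have Fv i : vfield SQ (F i).
  by rewrite /F; case: fintype.split => [l|b]; [exact: XV|exact: genQ_vfield].
have sumF (c : 'I_(dist_rank N + s) -> R) x : \sum_i c i *: F i x =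
    \sum_l c (lshift s l) *: X l x + genQ (\sum_b c (rshift (dist_rank N) b) *: e b) x.
  rewrite big_split_ord genQ_sum; congr (_ + _); apply: eq_bigr => i _.
    by rewrite Fl.
  by rewrite Fr.
have WT c x : vcomp W x (genQ (\sum_b c b *: e b) x).
  rewrite genQ_sum; apply: (distribution_sum _ _ (@vcompP _ _ _ W)) => b.
  by have [] := eW b x.
(* A vanishing combination puts its D-part in W, so that part is zero; infinitesimal freeness and
   the basis property remove the rest. *)
have indep (c : 'I_(dist_rank N + s) -> R) : \sum_i c i *: F i x0 = 0 -> forall i, c i = 0.
  rewrite sumF => E; have D0 : dist x0 (\sum_l c (lshift s l) *: X l x0).
    by rewrite (DX x0 U'x).1; exists (fun l => c (lshift s l)).
  have DW : vcomp W x0 (\sum_l c (lshift s l) *: X l x0).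
    rewrite (_ : \sum_l _ = genQ (\sum_b (- c (rshift (dist_rank N) b)) *: e b) x0)//.
    apply/eqP; rewrite -subr_eq0; apply/eqP; rewrite -[RHS]E; congr (_ + _).
    rewrite !genQ_sum -sumrN; apply: eq_bigr => b _.
    by rewrite scaleNr opprK.
  have Xc0 := dist_vcomp0 D0 DW.
  have Xc := (DX x0 U'x).2 _ Xc0; move: E; rewrite Xc0 add0r => Gc0.
  have ec0 : \sum_b c (rshift (dist_rank N) b) *: e b = 0.
    apply: (genQ_inj (q := x0)); [exact: lie_alg_sum|exact: tangent0|].
    by rewrite Gc0 /genQ tmap0.
  move=> i; case: (split_ordP i) => [l ->|b ->]; first exact: Xc.
  exact: (eindep _ ec0).
have inj v : tangent SQ x0 v -> (forall j, v (q j) = 0) -> v = 0.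
  move=> Tv vq; rewrite ((frame _ (nbhs_singleton nU)).2 v Tv) big1// => j _.
  by rewrite vq scale0r.
have [be [bes nbe]] := dual_coframe qs Fv inj indep.
exists s, e, q, (fun b => be (rshift (dist_rank N) b)); split=> //.
apply: filterS2 nbe (open_nbhs_nbhs (conj oU' U'x)) => x bex U'x'.
split=> [b d|b c].
  rewrite (DX x U'x').1 => -[c _ <-]; rewrite coframe_eval_sum big1// => l _.
  rewrite -Fl /coframe_eval bex eq_sym.
  by rewrite (_ : _ == _ = false) ?mulr0//; apply/eqP => /(congr1 val) /= E;
    have := ltn_ord l; rewrite E ltnNge leq_addr.
rewrite genQ_sum coframe_eval_sum (bigD1 b)//= big1 => [|a ab].
  by rewrite -Fr /coframe_eval bex eqxx mulr1 addr0.
rewrite -Fr /coframe_eval bex (inj_eq (@rshift_inj _ _)) eq_sym (negPf ab).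
by rewrite mulr0.
Qed.

Section AtPoint.
Variables (m0 : M) (s : nat) (e : 'I_s -> vecG) (q : 'I_n -> Q -> R)
  (beta : 'I_s -> 'I_n -> Q -> R).
Hypotheses (espan : forall x ze, lie_alg_W W x ze -> exists c : 'I_s -> R, ze = \sum_b c b *: e b)
  (qs : forall j, smooth SQ (q j)) (bes : forall b j, smooth SQ (beta b j))
  (nad : \forall x \near (tauM m0 : space_of SQ), adapted e q beta x).

Lemma near_adapted : \forall m \near (m0 : space_of SM), adapted e q beta (tauM m).
Proof. exact: (@smooth_map_cvg _ _ _ _ _ _ m0 (@smooth_tauM R N) _ nad). Qed.

Lemma formA_local m (w : vecM) : adapted e q beta (tauM m) -> tangent SM m w ->
  formA W m w = \sum_b coframe_eval q beta b (tauM m) (tmap SQ (@tauM R N) w) *: e b.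
Proof.
move=> [adD adW] Tw; have Tt := tmap_tangent (@smooth_tauM R N) Tw.
have [d [w' [Dd Ww E]]] := dist_vcomp_split W Tt.
have [ze Wz zw] := lie_alg_W_genQ Ww; have [c cE] := espan Wz.
rewrite (formAE Tw Wz.1 Dd Wz.2); last by rewrite E zw.
rewrite {1}cE; apply: eq_bigr => b _; congr (_ *: _).
by rewrite E coframe_eval_add adD// add0r zw cE adW.
Qed.

(** The j-th coefficient of A_W evaluated on the test function [f], which makes it a real one-form
    of the shape [sum_j a_j dq_j]. *)
Definition A_coef (f : G -> R) j m : R := \sum_b e b f * beta b j (tauM m).

Lemma A_coef_smooth f j : smooth SM (A_coef f j).
Proof.
apply: smooth_sum => b; apply: smoothM; first exact: smooth_cst.
exact: smooth_tauM (bes b j).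
Qed.

Lemma A_coefE f m (w : vecM) :
  \sum_b coframe_eval q beta b (tauM m) (tmap SQ (@tauM R N) w) * e b f =
  \sum_j A_coef f j m * w (q j \o @tauM R N).
Proof.
under eq_bigr do rewrite mulr_suml; rewrite exchange_big; apply: eq_bigr => j _ /=.
rewrite mulr_suml; apply: eq_bigr => b _; rewrite tmapE//; ring.
Qed.

Lemma formA_local_form f :
  local_form SM (fun m w => formA W m w f) m0 (A_coef f) (fun j => q j \o @tauM R N).
Proof.
split=> [j|j|]; first exact: A_coef_smooth.
  exact: smooth_tauM (qs j).
apply: filterS near_adapted => m adm w Tw.
by rewrite (formA_local adm Tw) vec_sumE -A_coefE.
Qed.

Definition W_coef ka b x : R := coframe_eval q beta b x (genQ ka x).

Lemma W_coef_smooth ka b : lie_alg ka -> smooth SQ (W_coef ka b).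
Proof.
move=> Tk; apply: smooth_sum => j; apply: smoothM => //.
exact: (vfield_smooth (genQ_vfield Tk)).
Qed.

(** Cartan's formula leaves [u] applied to the function A_W on the generator of [ka]. That function
    is zero at [m0], where the generator lies in C, but in general not nearby, and its derivative is
    the curvature. *)
Lemma formK_local (u : vecM) ka (X : M -> vecM) :
  (forall f, smooth_form SM (fun m w => formA W m w f)) ->
  vfield SM X -> X m0 = u -> calC m0 u -> lie_alg ka -> calC m0 (genM ka m0) ->
  formK W m0 u (genM ka m0) = \sum_b u (W_coef ka b \o @tauM R N) *: e b.
Proof.
move=> Af XV Xu Cu Tk Ck; have Tu := Cu.1.
apply/funext => f; rewrite /formK (projC_id W Cu) (projC_id W Ck).
rewrite (extdE (Af f) (formA_local_form f) (ex_intro2 _ _ X XV Xu)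
  (ex_intro2 _ _ (genM ka) (genM_vfield Tk) erefl)).
have inv : exists C, \forall g \near (1%g : space_of SG),
    \sum_j A_coef f j (actM g m0) * u (fun x : M => (q j \o @tauM R N) (actM g x)) = C.
  (* The translates of [u] stay over the invariant distribution D, which the coframe annihilates. *)
  exists 0; have nad1 : \forall g \near (1%g : space_of SG), adapted e q beta (act Y g (tauM m0)).
    apply: (@smooth_map_cvg _ _ _ _ _ _ (1%g : G) (orbit_smooth (@act_smooth R N Y) (tauM m0))
      (adapted e q beta)).
    by rewrite act1.
  apply: filterS nad1 => g [adD _].
  pose w := tmap SQ (act Y g) (tmap SQ (@tauM R N) u).
  have Dw : dist (act Y g (tauM m0)) w by apply: dist_act; exact: Cu.2.
  transitivity (\sum_b coframe_eval q beta b (act Y g (tauM m0)) w * e b f).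
    under [RHS]eq_bigr do rewrite mulr_suml; rewrite exchange_big; apply: eq_bigr => j _ /=.
    rewrite mulr_suml; apply: eq_bigr => b _; rewrite tauM_actM.
    rewrite /w tmapE// tmapE; last exact: smooth_act (qs j).
    have -> : (fun x : M => q j (tauM (actM g x))) = (q j \o act Y g) \o @tauM R N.
      by apply/funext => x; rewrite /= tauM_actM.
    by ring.
  by rewrite big1// => b _; rewrite adD// mul0r.
have := invariant_form_extd (@actM_smooth R N Y) (@actM1 R N Y) (A_coef_smooth f)
  (fun j => smooth_tauM (qs j)) Tu Tk inv.
rewrite -/(genM ka) /= => ->; rewrite vec_sumE.
have Wcs b : smooth SM (W_coef ka b \o @tauM R N) by exact: smooth_tauM (W_coef_smooth b Tk).
have -> : (fun x : M => \sum_j A_coef f j x * genM ka x (q j \o @tauM R N)) =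
    (fun x : M => \sum_b e b f * (W_coef ka b \o @tauM R N) x).
  apply/funext => x; rewrite -A_coefE tmap_tauM_genM.
  by apply: eq_bigr => b _; rewrite mulrC.
rewrite (tangent_sum Tu); last by move=> b; apply: smoothM => //; exact: smooth_cst.
by apply: eq_bigr => b _; rewrite (tangentZ Tu)// vec_scaleE mulrC.
Qed.

Lemma proj_S_local (eta : vecG) m : lie_alg eta -> adapted e q beta (tauM m) ->
  proj_S W eta (tauM m) = eta - \sum_b W_coef eta b (tauM m) *: e b.
Proof.
move=> Te [adD adW]; have [[Tp [Dp _]] Wz] := proj_S_spec W (tauM m) Te.
have [c cE] := espan Wz; set ze := eta - _ in Wz cE.
have etaE : eta = proj_S W eta (tauM m) + ze by rewrite /ze addrCA subrr addr0.
have -> : \sum_b W_coef eta b (tauM m) *: e b = ze.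
  rewrite cE; apply: eq_bigr => b _; congr (_ *: _).
  have gE : genQ eta (tauM m) = genQ (proj_S W eta (tauM m)) (tauM m) + genQ ze (tauM m).
    by rewrite {1}etaE /genQ tmap_add.
  by rewrite /W_coef gE coframe_eval_add adD// add0r cE adW.
by rewrite /ze opprB addrCA subrr addr0.
Qed.

End AtPoint.

Lemma formA_smooth_form f : smooth_form SM (fun m w => formA W m w f).
Proof.
move=> m0; have [s [e [q [beta [eW espan qs bes nad]]]]] := adapted_coframe (tauM m0).
exists n, (A_coef e beta f), (fun j => q j \o @tauM R N).
exact: (formA_local_form espan qs bes nad f).
Qed.

Lemma nh_momentumE (xi : Q -> vecG) m :
  nh_momentum xi m = cov (iotaM m) (genQ (xi (tauM m)) (tauM m)).
Proof. exact: momentumE. Qed.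

Section Conservation.
Variables (Xnh : M -> vecM) (eta : vecG).
Hypotheses (hX : nh_dynamics Xnh) (Te : lie_alg eta)
  (hJK : forall m, JK W m (Xnh m) (genM (proj_S W eta (tauM m)) m) = 0).

Let XV : vfield SM Xnh. Proof. by case: hX. Qed.
Let XC m : calC m (Xnh m). Proof. by case: hX. Qed.

(** Both claims come from one formula valid near [m0]. The second is conditional because locality of
    a derivation applies to globally smooth functions, and that is known only after the first claim
    has been proved at every point. *)
Lemma nh_momentum_conserved m0 :
  smooth_at SM (nh_momentum (proj_S W eta)) m0 /\
  (smooth SM (nh_momentum (proj_S W eta)) -> Xnh m0 (nh_momentum (proj_S W eta)) = 0).
Proof.
have [s [e [q [beta [eW espan qs bes nad]]]]] := adapted_coframe (tauM m0).
have eT b : lie_alg (e b) by have [] := eW b (tauM m0).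
set u := Xnh m0; have Cu : calC m0 u := XC m0; have Tu := Cu.1.
pose P ka := momentum_fun (genQ ka) \o @iotaM R N.
have Ps ka : lie_alg ka -> smooth SM (P ka).
  by move=> Tk; exact: smooth_iotaM (smooth_momentum_fun (genQ_vfield Tk)).
pose z b := W_coef q beta eta b \o @tauM R N.
have zs b : smooth SM (z b) by exact: smooth_tauM (W_coef_smooth qs bes b Te).
have zPs b : smooth SM (fun m => z b m * P (e b) m) by apply: smoothM => //; exact: Ps.
pose F m := P eta m - \sum_b z b m * P (e b) m.
have Fs : smooth SM F by apply: smoothB; [exact: Ps|exact: smooth_sum].
have fF : \forall m \near (m0 : space_of SM), nh_momentum (proj_S W eta) m = F m.
  apply: filterS (near_adapted nad) => m adm.
  have Tg b : tangent SQ (tauM m) (genQ (e b) (tauM m)) by exact: genQ_tangent.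
  rewrite nh_momentumE (proj_S_local espan Te adm) genQ_sub genQ_sum cov_sub.
  - by rewrite cov_sum.
  - exact: genQ_tangent.
  - by apply: tangent_sumv => b; exact: tangent_scale.
split; first by apply: smooth_at_congr (Fs m0); apply: filterS fF => m ->.
move=> fs; rewrite (tangent_local Tu fs Fs fF).
have adm0 : adapted e q beta (tauM m0) := nbhs_singleton nad.
(* Freezing the section at the base point makes it a constant algebra element, whose generator is
   Hamiltonian. *)
pose xi := proj_S W eta (tauM m0).
have [[Txi [Dxi _]] _] := proj_S_spec W (tauM m0) Te.
have xiE : xi = eta - \sum_b z b m0 *: e b := proj_S_local espan Te adm0.
have Cxi : calC m0 (genM xi m0).
  by split; [exact: genM_tangent|rewrite tmap_tauM_genM].
(* The generator of [xi] lies in C at [m0], so the equation of motion may be tested on it, and the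
   Hamiltonian is invariant. *)
have Pxi0 : u (P xi) = 0.
  apply/eqP; rewrite -oppr_eq0 -(OmegaM_genM Txi Tu).
  by case: hX => _ _ ->//; rewrite genM_HM.
have Pxi : P xi = fun m => P eta m - \sum_b z b m0 * P (e b) m.
  apply/funext => m; rewrite /P xiE /momentum_fun /= genQ_sub genQ_sum.
  have Tg b : tangent SQ (tauM m) (genQ (e b) (tauM m)) by exact: genQ_tangent.
  rewrite cov_sub; [|exact: genQ_tangent|].
    by rewrite cov_sum.
  by apply: tangent_sumv => b; exact: tangent_scale.
have cPs b : smooth SM (fun m => z b m0 * P (e b) m).
  by apply: smoothM; [exact: smooth_cst|exact: Ps].
have uxi : u (P eta) = \sum_b z b m0 * u (P (e b)).
  have uz b : u (fun m => z b m0 * P (e b) m) = z b m0 * u (P (e b)).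
    exact: (tangentZ Tu _ (Ps _ (eT b))).
  move: Pxi0; rewrite Pxi (tangentB Tu (Ps _ Te) (smooth_sum _ cPs)) (tangent_sum Tu)//.
  by rewrite (eq_bigr _ (fun b _ => uz b)) => /eqP; rewrite subr_eq0 => /eqP.
have wE b : u (W_coef q beta xi b \o @tauM R N) = u (z b).
  have zc : smooth SM (fun m => z b m - z b m0) by apply: smoothB => //; exact: smooth_cst.
  rewrite (tangent_local (g := fun m => z b m - z b m0) Tu)//.
  - by rewrite (tangentB Tu (zs b) (smooth_cst _ _)) (tangent_cst Tu) subr0.
  - exact: smooth_tauM (W_coef_smooth qs bes b Txi).
  apply: filterS (near_adapted nad) => m [_ adW]; rewrite /= /W_coef xiE addrC.
  have -> : genQ (- (\sum_b z b m0 *: e b) + eta) (tauM m) =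
     (-1) *: genQ (\sum_b z b m0 *: e b) (tauM m) + genQ eta (tauM m).
    by rewrite -scaleN1r genQ_lin.
  by rewrite coframe_eval_lin adW mulN1r addrC.
have JK0 : \sum_b u (z b) * P (e b) m0 = 0.
  have := hJK m0; rewrite /JK momentumE.
  rewrite (formK_local espan qs bes nad formA_smooth_form XV erefl Cu Txi Cxi).
  rewrite genQ_sum cov_sum => [H|b]; last exact: genQ_tangent.
  by rewrite -[RHS]H; apply: eq_bigr => b _; rewrite -wE.
(* By the product rule, the terms with [u (P (e b))] cancel against [uxi], and those with [u (z b)]
   sum to zero by the curvature hypothesis. *)
rewrite (tangentB Tu (Ps _ Te) (smooth_sum _ zPs)) (tangent_sum Tu)// uxi.
have uzP b : u (fun m => z b m * P (e b) m) = u (z b) * P (e b) m0 + z b m0 * u (P (e b)).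
  exact: (tangentM Tu (zs b) (Ps _ (eT b))).
by rewrite (eq_bigr _ (fun b _ => uzP b)) big_split/= JK0 add0r subrr.
Qed.

Lemma nh_momentum_first_integral : first_integral Xnh (nh_momentum (proj_S W eta)).
Proof.
have fs : smooth SM (nh_momentum (proj_S W eta)) by move=> m; have [] := nh_momentum_conserved m.
by split=> // m; have [_] := nh_momentum_conserved m; exact.
Qed.

Lemma nh_momentum_linear : linear_in_momenta (nh_momentum (proj_S W eta)).
Proof.
move=> c m1 m2 m t1 t2 E; rewrite !nh_momentumE t1 t2 E.
by [].
Qed.

Lemma M_cotangent_lift_HM m :
  M_cotangent_lift (fun x => genQ (proj_S W eta x) x) m (HM N) = 0.
Proof.
pose Z x := genQ (proj_S W eta x) x.
rewrite /M_cotangent_lift; set A := [set v | _].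
(* The default value of the definite description is the zero vector, which kills every function;
   otherwise the defining properties are at hand. *)
have [|->//] := the_cases 0 A; set v := the 0 A => -[Cv [Tuv orth]].
have [_ _ dyn] := hX; rewrite -(dyn m v Cv).
have TX := (XC m).1; have Tv := Cv.1.
rewrite (OmegaM_anti TX Tv) /OmegaM.
have TIX := tmap_tangent (@smooth_iotaM R N) TX.
have TIv := tmap_tangent (@smooth_iotaM R N) Tv.
set u0 := cotangent_lift Z (iotaM m).
have Tu0 : tangent ST (iotaM m) u0.
  have := tangent_add Tuv TIv; rewrite -/Z -/u0.
  by have -> : u0 - tmap ST (@iotaM R N) v + tmap ST (@iotaM R N) v = u0 by rewrite subrK.
(* As [Xnh] lies in C, orthogonality replaces the projected vector by the full cotangent lift inside
   Omega. *)
have := orth _ (XC m); rewrite -/Z -/u0 (OmegaQ_subl (conf_manifold N) Tu0 TIv TIX).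
move=> /eqP; rewrite subr_eq0 => /eqP <-.
(* If the lift takes its default value [0], then Omega on it is zero; otherwise it is dual to the
   fibrewise linear function of the section. *)
have [|u00] := the_cases 0 [set u | tangent ST (iotaM m) u /\
    forall w, tangent ST (iotaM m) w ->
      OmegaQ (iotaM m) u w = w (fun y => cov y (Z (base y)))]; last first.
  have -> : u0 = 0 by exact: u00.
  have T0 := tangent0 ST (iotaM m).
  have := OmegaQ_subl (conf_manifold N) T0 T0 TIX.
  by rewrite !subrr => ->; rewrite oppr0.
(* A non-smooth linear function would again give zero by convention; a smooth one restricts on the
   constraint submanifold to the conserved momentum. *)
move=> [_ lift]; rewrite [OmegaQ _ _ _](lift _ TIX) /tmap /on_smooth.
case: ifP => _; last by rewrite oppr0.
have [_ /(_ m)] := nh_momentum_first_integral.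
have -> : nh_momentum (proj_S W eta) = (fun y => cov y (Z (base y))) \o @iotaM R N.
  by apply/funext => m'; rewrite nh_momentumE.
by move=> ->; rewrite oppr0.
Qed.

End Conservation.
End Main.

Theorem proposition3p8 (R : realType) (N : nh_system R) (Y : symmetry N)
    (hdim : dimension_assumption Y)
    (W : vertical_complement Y) (hW : vertical_symmetry_condition W)
    (Xnh : cmfd N -> vec (R := R) (cmfd N)) (hX : nh_dynamics Xnh)
    (eta : vec (R := R) (grp Y)) (heta : lie_alg eta)
    (hJK : forall m : cmfd N,
      JK W m (Xnh m) (genM (proj_S W eta (tauM m)) m) = 0) :
  (first_integral Xnh (nh_momentum (proj_S W eta)) /\
   linear_in_momenta (nh_momentum (proj_S W eta))) /\
  (forall m : cmfd N,
     M_cotangent_lift (fun q => genQ (proj_S W eta q) q) m (HM N) = 0).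
Proof.
have [h _ hWh] := hW; split; last exact: (M_cotangent_lift_HM hWh hX heta hJK).
split; first exact: (nh_momentum_first_integral hWh hX heta hJK).
exact: nh_momentum_linear.
Qed.
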